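(* Let $d\ge2$ and let $\{\mathbb{X}_i,i\ge1\}$ be a sequence of i.i.d. random vectors with the same distribution as $\mathbb{X}=T\mathbb{W}$, where $T$ and $\mathbb{W}$ are independent, $\mathbb{W}$ is uniformly distributed on the Euclidean unit sphere $\mathcal{S}^{d-1}$, and $T$ is a positive random variable satisfying the Gumbel domain of attraction condition with auxiliary function $\psi_T$ (see context). Let $q\in(2,\infty]$, let $a_n$ be the $1-1/n$ quantile of the distribution of $\|\mathbb{X}\|_q$, let $b_n=\psi_T(a_n)$, and let $M_{n,q}^{(2)}(\mathbb{X})=\max_{1\le i<j\le n}\|\mathbb{X}_i-\mathbb{X}_j\|_q$. Then, as $n\to\infty$, $$\frac{M_{n,q}^{(2)}(\mathbb{X})-2a_n}{b_n}\quad\text{converges weakly to}\quad\max_{1\le i\le d}(\Gamma_i^++\Gamma_i^-),$$ where $\Gamma_i^+,\Gamma_i^-$, $1\le i\le d$, are independent random variables each distributed as $\Gamma-\log(2d)$, with $\Gamma$ a standard Gumbel random variable, i.e. with distribution function $x\mapsto\exp\left(-\frac{1}{2d}e^{-x}\right)$.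
   Context: For $x\in\mathbb{R}^d$, $\|x\|_q=(|x_1|^q+\cdots+|x_d|^q)^{1/q}$ for $q<\infty$ and $\|x\|_\infty=\max_i|x_i|$. The standard Gumbel distribution function is $x\mapsto e^{-e^{-x}}$. Gumbel domain of attraction condition on $T$: $\mathbb{P}(T>x)>0$ for all $x$, and there is a function $\psi_T:(0,\infty)\to(0,\infty)$ with $\lim_{x\to\infty}\psi_T(x)/x=0$ and $\lim_{x\to\infty}\mathbb{P}(T>x+\psi_T(x)z)/\mathbb{P}(T>x)=e^{-z}$ locally uniformly with respect to $z\in\mathbb{R}$. *)

(* Defs.v *)
From HB Require Import structures.
From mathcomp Require Import all_boot all_order all_algebra.
From mathcomp Require Import all_classical all_reals all_analysis.

Set Implicit Arguments.
Unset Strict Implicit.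
Unset Printing Implicit Defensive.

Import Order.TTheory GRing.Theory Num.Theory.
Import numFieldNormedType.Exports.

Local Open Scope classical_set_scope.
Local Open Scope ring_scope.

(* Vectors of R^d are represented as d.-tuple R, whose canonical sigma-algebra
   is generated by the coordinates, i.e. the Borel sigma-algebra of R^d. *)
Definition tscale (R : realType) (d : nat) (t : R) (x : d.-tuple R) :
  d.-tuple R := [tuple t * tnth x i | i < d].

Definition tsub (R : realType) (d : nat) (x y : d.-tuple R) : d.-tuple R :=
  [tuple tnth x i - tnth y i | i < d].

Definition tmulmx (R : realType) (d : nat) (Q : 'M[R]_d) (x : d.-tuple R) :
  d.-tuple R := [tuple \sum_(j < d) Q i j * tnth x j | i < d].

(* The value at -oo is a dummy: only exponents q >= 2 are used. *)
Definition qnorm (R : realType) (d : nat) (q : \bar R) (x : d.-tuple R) : R :=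
  match q with
  | r%:E => (\sum_(i < d) `|tnth x i| `^ r) `^ r^-1
  | +oo%E => \big[Num.max/0]_(i < d) `|tnth x i|
  | -oo%E => 0
  end.

Definition sphere (R : realType) (d : nat) : set (d.-tuple R) :=
  [set x | qnorm 2%:E x = 1].
Arguments sphere : clear implicits.

(* The uniform distribution on the sphere is the unique probability measure
   carried by the sphere and invariant under the orthogonal group. *)
Definition uniform_on_sphere (dO : measure_display) (O : measurableType dO)
    (R : realType) (P : probability O R) (d : nat)
    (W : {RV P >-> d.-tuple R}) : Prop :=
  {ae P, forall w, sphere R d (W w)} /\
  forall (Q : 'M[R]_d) (A : set (d.-tuple R)), Q *m Q^T = 1%:M ->
    measurable A -> P [set w | A (tmulmx Q (W w))] = P [set w | A (W w)].

Definition mutually_independent (dO : measure_display)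
    (O : measurableType dO) (R : realType) (P : probability O R)
    (I : eqType) (dE : measure_display) (E : measurableType dE)
    (X : I -> {RV P >-> E}) : Prop :=
  forall (s : seq I) (B : I -> set E), uniq s ->
    (forall i, measurable (B i)) ->
    P [set w | forall i, i \in s -> B i (X i w)] =
    (\prod_(i <- s) P [set w | B i (X i w)])%E.

Definition independent2 (dO : measure_display)
    (O : measurableType dO) (R : realType) (P : probability O R)
    (d1 d2 : measure_display) (E1 : measurableType d1)
    (E2 : measurableType d2) (X : {RV P >-> E1}) (Y : {RV P >-> E2}) : Prop :=
  forall (A : set E1) (B : set E2), measurable A -> measurable B ->
    P [set w | A (X w) /\ B (Y w)] =
    (P [set w | A (X w)] * P [set w | B (Y w)])%E.

Definition gumbel_domain (dO : measure_display) (O : measurableType dO)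
    (R : realType) (P : probability O R) (T : {RV P >-> R})
    (psi : R -> R) : Prop :=
  [/\ forall x : R, (0 < ccdf T x)%E,
      forall x : R, 0 < x -> 0 < psi x,
      psi x / x @[x --> +oo] --> (0 : R) &
      forall z0 : R, exists2 U : set R, nbhs z0 U &
        {uniform U,
          (fun x z : R => fine (ccdf T (x + psi x * z)) / fine (ccdf T x))
            @ +oo --> (fun z : R => expR (- z))}].

(* Generalized inverse of the distribution function of Y. *)
Definition quantile (dO : measure_display) (O : measurableType dO)
    (R : realType) (P : probability O R) (Y : O -> R) (p : R) : R :=
  inf [set x : R | (p%:E <= P [set w | (Y w <= x)%R])%E].

(* The indices 1 <= i < j <= n are shifted to 0 <= i < j < n. *)
Definition max_interpoint (R : realType) (d : nat) (q : \bar R) (n : nat)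
    (x : nat -> d.-tuple R) : R :=
  \big[Num.max/0]_(ij : 'I_n * 'I_n | (ij.1 < ij.2)%N)
     qnorm q (tsub (x ij.1) (x ij.2)).

Definition cvg_weakly (dO dO' : measure_display) (O : measurableType dO)
    (O' : measurableType dO') (R : realType) (P : probability O R)
    (P' : probability O' R) (Y : nat -> O -> R) (Z : O' -> R) : Prop :=
  forall f : R -> R, continuous f -> bounded_fun f ->
    ('E_P[f \o Y n] @[n --> \oo] --> 'E_P'[f \o Z])%E.

(* Main.v *)
Require Import Defs.
From HB Require Import structures.
From mathcomp Require Import all_boot all_order all_algebra.
From mathcomp Require Import all_classical all_reals all_analysis.
From mathcomp Require Import measurable_realfun ring lra.

Import Order.TTheory GRing.Theory Num.Theory.
Import numFieldNormedType.Exports.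

Local Open Scope classical_set_scope.
Local Open Scope ring_scope.

(** The tail of [T] is so light that a sample point of large [q]-norm, [q > 2], has a
    direction very close to one of the [2 d] vertices [+- e_i] of the sphere, where
    the [q]-norm is largest.  Write [m] and [rho] for the maximum norm and the
    [q]-norm of the direction [W].  Then [rho] is at most [1 - th * (1 - m)]
    ([qnorm_gap]), and [rho - m = o (1 - m)] near the vertices
    ([qnorm_near_vertex]).

    The key estimate is [radial_tightness]: when the norm of [X = T W] exceeds
    [x - B psi x], its radial part [T] is at most [x + K psi x], up to a negligible
    fraction of the event; hence [1 - m] has order [psi x / x], and the [q]-norm and
    the maximum norm of [X] differ by [o (psi x)].  It is proved slice by slice: in
    the slice where [T - x] has order [4 ^ j psi x], the direction lies in a cap
    around a vertex whose measure is at most [N ^ j] times that of the basic cap, by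
    the doubling property [cap_doubling] of caps, which is a consequence of rotation
    invariance, while the tail of [T] has decreased by [(2 N) ^ j]
    ([gumbel_tail_decay]).  It follows that the tails of the [q]-norm, of the maximum
    norm and of each signed coordinate, up to the factor [2 d] for the latter, are
    equivalent and in the Gumbel domain with the same [psi]
    ([max_norm_tail_shift], [qnorm_tail_equivalent], [coord_tail_equivalent]).  At the
    quantile [a n] this gives [n P(s x_i > a n + b n t) --> expR (- t) / (2 d)] for each
    signed coordinate, and two signed coordinates are not large together, so that
    their [2 d] normalized maxima over the sample converge jointly to independent
    Gumbel variables ([cvg_joint_max]).

    The diameter is at least the largest, over the axes [i], of the sum of the maxima
    of the signed coordinates [+ x_i] and [- x_i].  Conversely two points at
    [q]-distance above [2 a n - C b n] both have nearly maximal norm, so their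
    Euclidean norms are at most [a n + K b n], and their difference [v] satisfies
    [|v|_2 <= 2 a n + 2 K b n] and [|v|_q > 2 a n - C b n]; by the same two
    inequalities between norms it is nearly parallel to an axis, and
    [|v|_q <= |v|_oo + e b n] ([diameter_stat_close]).  So the normalized diameter is
    asymptotically a Lipschitz function of the [2 d] normalized maxima, and the weak
    convergence follows from their joint convergence by approximation on a grid
    ([cvg_mean_lipschitz]). *)

Set Implicit Arguments.
Unset Strict Implicit.
Unset Printing Implicit Defensive.

(** * Tails in the Gumbel domain of attraction *)
Section gumbel_tails.
Context {R : realType}.
Implicit Types (F psi : R -> R).

Lemma near_pinfty_upward (P : R -> Prop) :
  (\forall x \near +oo, P x) -> \forall x \near +oo, forall y, x <= y -> P y.
Proof.
move=> [M [Mr MP]]; exists M; split => // x Mx y xy.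
exact/MP/(lt_le_trans Mx).
Qed.

Lemma le_natX (b : nat) (x : R) : (1 < b)%N -> exists k, x <= b%:R ^+ k.
Proof.
move=> b1; exists (Num.bound `|x|).
rewrite (le_trans (ler_norm x))// (le_trans (ltW (archi_boundP (normr_ge0 _))))//.
by rewrite -natrX ler_nat ltnW// ltn_expl.
Qed.

(** The domain of attraction condition for the real-valued tail function: the
    local uniformity in [z] has been turned, by compactness, into uniformity on
    the intervals [[- r, r]]. *)
Definition gumbel_tail F psi :=
  [/\ forall x, 0 < F x, {homo F : x y /~ x <= y}, forall x, 0 < x -> 0 < psi x,
      forall e, 0 < e -> \forall x \near +oo, psi x <= e * x &
      forall r e, 0 < e -> \forall x \near +oo, forall z, `|z| <= r ->
        `|F (x + psi x * z) / F x - expR (- z)| < e].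

Lemma gumbel_domain_tail (dO : measure_display) (O : measurableType dO)
    (P : probability O R) (T : {RV P >-> R}) psi :
  gumbel_domain T psi -> gumbel_tail (fun x => fine (ccdf T x)) psi.
Proof.
move=> [T0 psi0 psix unif].
have Tfin x : ccdf T x \is a fin_num by rewrite fin_num_measure.
split=> [x|x y xy|//|e e0|r e e0].
- by rewrite fine_gt0// T0/= ltey_eq Tfin.
- by rewrite fine_le//; exact: ccdf_nonincreasing.
- move/cvgrPdist_le : psix => /(_ _ e0) H; near=> x.
  have x0 : 0 < x by near: x; exact: nbhs_pinfty_gt.
  have : `|0 - psi x / x| <= e by near: x.
  rewrite sub0r normrN ler_norml => /andP[_].
  by rewrite ler_pdivrMr.
- have := @segment_compact R (- r) r.
  move/compact_near_coveringP => /(_ _ +oo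
    (fun x z => `|fine (ccdf T (x + psi x * z)) / fine (ccdf T x) - expR (- z)| < e)).
  have H : forall z0 : R, `[- r, r]%classic z0 ->
     \forall z \near z0 & x \near +oo,
     `|fine (ccdf T (x + psi x * z)) / fine (ccdf T x) - expR (- z)| < e.
    move=> z0 _; have [U z0U HU] := unif z0.
    have : \forall x \near +oo, forall z, U z ->
        `|fine (ccdf T (x + psi x * z)) / fine (ccdf T x) - expR (- z)| < e.
      apply: (HU [set h | forall z, U z -> `|h z - expR (- z)| < e]).
      apply/uniform_nbhs.
      exists [set p | ball p.1 e p.2]; split; first exact: (entourage_ball _ (PosNum e0)).
      by move=> h /= hh z Uz; rewrite distrC; apply: hh.
    move=> HV; exists (U, [set x | forall z, U z ->
        `|fine (ccdf T (x + psi x * z)) / fine (ccdf T x) - expR (- z)| < e]) => //.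
    by move=> [z x] /= [Uz]; apply.
  move/(_ _ H); apply: filterS => x Hx z zr; apply: Hx.
  by rewrite /= in_itv/= -ler_norml.
Unshelve. all: by end_near. Qed.

Section consequences.
Variables (F psi : R -> R).
Hypothesis FG : gumbel_tail F psi.

Let F0 x : 0 < F x. Proof. by case: FG. Qed.
Let Fle x y : x <= y -> F y <= F x. Proof. by case: FG => _ + _ _ _; apply. Qed.
Let psi0 x : 0 < x -> 0 < psi x. Proof. by case: FG => _ _ + _ _; apply. Qed.

Lemma gumbel_tail_near z e : 0 < e ->
  \forall x \near +oo, (expR (- z) - e) * F x < F (x + psi x * z) < (expR (- z) + e) * F x.
Proof.
move=> e0; case: FG => _ _ _ _ /(_ `|z| e e0); apply: filterS => x /(_ z (lexx _)).
by rewrite ltr_distl ltr_pdivrMr// ltr_pdivlMr//.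
Qed.

(** If [psi (x + psi x)] were much larger than [psi x], the two shifts
    [x -> y = x + psi x -> y + psi y] would move beyond [x + (2 + e) psi x]
    while dividing the tail by about [expR 2] only, contrary to the limit
    [expR (- (2 + e))]. *)
Lemma auxiliary_step e : 0 < e ->
  \forall x \near +oo, psi (x + psi x) <= (1 + e) * psi x.
Proof.
move=> e0; pose eta := (expR (- 1) ^+ 2 - expR (- (2 + e))) / 3 : R.
have E2 : expR (- 1) ^+ 2 = expR (- 2) :> R.
  by rewrite -expRM_natr; congr expR; lra.
have eta0 : 0 < eta.
  by rewrite divr_gt0 // E2 subr_gt0 ltr_expR; lra.
have E1 : expR (- 1) <= 1 :> R by rewrite expR_le1; lra.
have E0 : 0 < expR (- 1) :> R by exact: expR_gt0.
near=> x.
have x0 : 0 < x by near: x; exact: nbhs_pinfty_gt.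
have px := psi0 x0.
rewrite leNgt; apply/negP => lt_psi.
have /andP[+ _] : (expR (- 1) - eta) * F x < F (x + psi x * 1) < (expR (- 1) + eta) * F x.
  by near: x; exact: gumbel_tail_near.
rewrite mulr1; set y := x + psi x in lt_psi * => HFy.
have /andP[+ _] : (expR (- 1) - eta) * F y < F (y + psi y * 1) < (expR (- 1) + eta) * F y.
  have xy : x <= y by rewrite lerDl ltW.
  move: y xy {lt_psi HFy}.
  by near: x; apply: near_pinfty_upward; exact: gumbel_tail_near.
rewrite mulr1 => HFyy.
have /andP[_] : (expR (- (2 + e)) - eta) * F x < F (x + psi x * (2 + e)) <
    (expR (- (2 + e)) + eta) * F x.
  by near: x; exact: gumbel_tail_near.
have : F (y + psi y) <= F (x + psi x * (2 + e)).
  by apply: Fle; rewrite /y; nra.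
move=> h1 h2; have Fx := F0 x.
have h3 : (expR (- 1) - eta) * F y < (expR (- (2 + e)) + eta) * F x by lra.
have e3 : 3 * eta = expR (- 1) ^+ 2 - expR (- (2 + e)) by rewrite /eta; lra.
have h4 : (expR (- 1) - eta) * ((expR (- 1) - eta) * F x) <= (expR (- 1) - eta) * F y.
  apply: ler_wpM2l; last exact: ltW.
  have h6 : eta < expR (- 1) by (have := expR_gt0 (- (2 + e)) ; rewrite E2 in e3; nra).
  by rewrite subr_ge0 ltW.
have h5 : (expR (- 1) - eta) ^+ 2 * F x < (expR (- (2 + e)) + eta) * F x by lra.
by move: h5; rewrite ltr_pM2r //; nra.
Unshelve. all: by end_near. Qed.

Lemma half_step : \forall x \near +oo, F (x + psi x) <= F x / 2.
Proof.
have E1 : expR (- 1) < 1 / 2 :> R.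
  rewrite expRN div1r ltf_pV2 ?posrE ?expR_gt0 //.
  by have := @expR_gt1Dx R 1 (oner_neq0 _); lra.
have e0 : 0 < 1 / 2 - expR (- 1) :> R by rewrite subr_gt0.
have := gumbel_tail_near 1 e0; apply: filterS => x /andP[_]; rewrite mulr1.
lra.
Qed.

(** A polynomial decay, uniform in the number of steps: iterating the shift
    [y -> y + psi y], which halves the tail and enlarges [psi] by a factor
    [1 + e] at most, [L * j] shifts divide the tail by [(2 N) ^ j] and travel a
    distance of at most [psi x / e * (1 + e) ^ (L j) <= psi x / e * 4 ^ j].  The
    rate [2 N] at scale [4] is what beats the doubling constant of the caps. *)
Lemma gumbel_tail_decay (N : R) : 1 <= N ->
  exists2 C, 0 < C & \forall x \near +oo, forall j : nat,
    F (x + C * 4 ^+ j * psi x) <= (2 * N) ^- j * F x.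
Proof.
move=> N1.
have [L L0 HL] : exists2 L : nat, (0 < L)%N & 2 * N <= 2 ^+ L.
  have [L HL] := le_natX (2 * N) (ltnSn 1).
  by exists L.+1 => //; rewrite (le_trans HL)// ler_eXn2l// ltr1n.
(* [e] is chosen so that [L] steps enlarge [psi] by a factor [4] at most. *)
pose e : R := ln 4 / L%:R.
have e0 : 0 < e by rewrite divr_gt0 ?ltr0n ?ln_gt0//; lra.
have He : (1 + e) ^+ L <= 4.
  rewrite (@le_trans _ _ (expR e ^+ L)) //.
    by rewrite lerXn2r ?nnegrE ?addr_ge0 ?expR_ge0 ?(ltW e0)// expR_ge1Dx.
  by rewrite -expRM_natr /e divfK ?pnatr_eq0 -?lt0n// lnK// posrE.
exists e^-1; first by rewrite invr_gt0.
near=> x => j.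
have x0 : 0 < x by near: x; exact: nbhs_pinfty_gt.
have Hstep y : x <= y -> psi (y + psi y) <= (1 + e) * psi y /\ F (y + psi y) <= F y / 2.
  move: y; near: x; apply: near_pinfty_upward; near=> y; split; near: y.
    exact: auxiliary_step.
  exact: half_step.
have iterP k : exists2 y, x <= y <= x + psi x * (((1 + e) ^+ k - 1) / e) &
    psi y <= (1 + e) ^+ k * psi x /\ F y <= 2 ^- k * F x.
  elim: k => [|k [y /andP[xy yle] [py Fy]]].
    by exists x; rewrite !expr0 ?invr1 ?subrr ?mul0r ?mulr0 ?addr0 ?lexx ?mul1r.
  have [p1 F1] := Hstep _ xy.
  have py0 : 0 < psi y by apply: psi0; lra.
  exists (y + psi y); last split.
  - rewrite (le_trans xy) ?lerDl ?(ltW py0)//=.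
    apply: (le_trans (lerD yle py)); rewrite -addrA lerD2l.
    rewrite [_ ^+ k * _]mulrC -mulrDr ler_pM2l ?psi0// exprS.
    by rewrite le_eqVlt; apply/orP; left; apply/eqP; field; rewrite gt_eqF.
  - rewrite (le_trans p1)// exprS -mulrA ler_pM2l//; lra.
  - by rewrite (le_trans F1)// exprS invfM -mulrA mulrC ler_pM2l// invr_gt0.
have [y /andP[xy yle] [_ Fy]] := iterP (L * j)%N.
apply: (@le_trans _ _ (F y)).
  apply: Fle; apply: (le_trans yle); rewrite lerD2l [_ * psi x]mulrC.
  rewrite ler_pM2l ?psi0// mulrC ler_pM2l ?invr_gt0//.
  rewrite exprM; apply: (@le_trans _ _ (((1 + e) ^+ L) ^+ j)); first by rewrite gerBl.
  by rewrite lerXn2r// nnegrE// exprn_ge0// addr_ge0// ltW.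
apply: (le_trans Fy); rewrite ler_pM2r// lef_pV2 ?posrE ?exprn_gt0// ?mulr_gt0//; last lra.
by rewrite exprM lerXn2r// nnegrE ?mulr_ge0//; lra.
Unshelve. all: by end_near. Qed.

Lemma gumbel_tail_rapid (c e : R) : 1 < c -> 0 < e ->
  \forall x \near +oo, F (c * x) <= e * F x.
Proof.
move=> c1 e0; pose z := 2 / e.
have z0 : 0 < z by rewrite divr_gt0.
have Ez : expR (- z) <= e / 2.
  rewrite expRN -[leRHS]invrK lef_pV2 ?posrE ?expR_gt0 ?invr_gt0 ?divr_gt0//.
  rewrite invf_div -/z; have := expR_ge1Dx z; lra.
have e20 : 0 < e / 2 by rewrite divr_gt0.
have d0 : 0 < (c - 1) / z by rewrite divr_gt0// subr_gt0.
near=> x.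
have x0 : 0 < x by near: x; exact: nbhs_pinfty_gt.
have px : psi x <= (c - 1) / z * x.
  by near: x; case: FG => _ _ _ + _; exact.
have /andP[_ h] : (expR (- z) - e / 2) * F x < F (x + psi x * z) < (expR (- z) + e / 2) * F x.
  by near: x; exact: gumbel_tail_near.
have : F (c * x) <= F (x + psi x * z).
  apply: Fle; move: px; rewrite -(ler_pM2r z0) mulrAC divfK ?gt_eqF//; lra.
move=> /le_trans; apply; rewrite (le_trans (ltW h))// ler_pM2r//; lra.
Unshelve. all: by end_near. Qed.

Lemma gumbel_tail_uniform r e : 0 < e -> \forall x \near +oo, forall b, `|b| <= r ->
  (1 - e) * expR (- b) * F x <= F (x + psi x * b) <= (1 + e) * expR (- b) * F x.
Proof.
move=> e0; case: FG => _ _ _ _ unif.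
have e1 : 0 < e * expR (- r) by rewrite mulr_gt0// expR_gt0.
have := unif r _ e1; apply: filterS => x Hx b br; have := Hx b br.
have : e * expR (- r) <= e * expR (- b).
  by rewrite ler_pM2l// ler_expR lerN2 (le_trans (ler_norm b)).
move=> h1 h2; have /ltW := lt_le_trans h2 h1; rewrite ler_distl.
by rewrite ler_pdivlMr// ler_pdivrMr// [(1 - e) * _]mulrBl [(1 + e) * _]mulrDl !mul1r.
Qed.

(** The arithmetic of the comparison of [F] at two shifts of the same point: [B]
    and [B * Z * S'] stand for the limits of the two ratios, where [Z] is the
    factor sought, [S'] is close to [1], and [Z'], [S] are the inverses of [Z]
    and [S']. *)
Lemma ratio_bounds (e n B Z Z' S S' f f1 f2 : R) :
  0 < e -> 0 < n -> n <= 4^-1 -> n <= e / 5 -> 0 < B -> 0 < Z -> 0 < Z' -> 0 < S ->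
  S' <= 1 + n -> S <= 1 + n -> S' * S = 1 -> Z' * Z = 1 -> 0 < f ->
  (1 - n) * B * f <= f1 <= (1 + n) * B * f ->
  (1 - n) * (B * Z * S') * f <= f2 <= (1 + n) * (B * Z * S') * f ->
  f2 <= (1 + e) * Z * f1 /\ f1 <= (1 + e) * Z' * f2.
Proof.
move=> e0 n0 n4 n5 B0 Z0 Z0' S0 E1 E2 EN EZ f0 /andP[L1 U1] /andP[L2 U2].
have key : (1 + n) * (1 + n) <= (1 + e) * (1 - n) by nra.
have n1 : 0 < 1 - n by lra.
have n1' : 0 < 1 + n by lra.
have e1 : 0 < 1 + e by lra.
clear n4 n5.
have P0 : 0 < B * f by rewrite mulr_gt0.
split.
  apply: (@le_trans _ _ ((1 + n) * (1 + n) * (Z * (B * f)))).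
    apply: (le_trans U2).
    have -> : (1 + n) * (B * Z * S') * f = (1 + n) * (Z * (B * f)) * S' by ring.
    have -> : (1 + n) * (1 + n) * (Z * (B * f)) = (1 + n) * (Z * (B * f)) * (1 + n) by ring.
    by rewrite ler_pM2l// !mulr_gt0.
  apply: (@le_trans _ _ ((1 + e) * (1 - n) * (Z * (B * f)))).
    by rewrite ler_pM2r// mulr_gt0.
  have -> : (1 + e) * (1 - n) * (Z * (B * f)) = (1 + e) * Z * ((1 - n) * B * f) by ring.
  by rewrite ler_pM2l// mulr_gt0.
have S'1 : 1 <= (1 + n) * S'.
  have S'0 : 0 < S' by rewrite -(pmulr_lgt0 _ S0) EN.
  by rewrite -[leLHS]EN [S' * S]mulrC ler_pM2r.
have h1 : (1 - n) * (Z * (B * f)) <= (1 + n) * f2.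
  apply: (@le_trans _ _ ((1 - n) * (Z * (B * f)) * ((1 + n) * S'))).
    by rewrite ler_peMr// ltW// !mulr_gt0.
  have -> : (1 - n) * (Z * (B * f)) * ((1 + n) * S') = (1 + n) * ((1 - n) * (B * Z * S') * f) by ring.
  by rewrite ler_pM2l// -?mulrA; move: L1 L2 U1 U2; rewrite -?mulrA.
apply: (le_trans U1).
have h2 : (1 - n) * (B * f) <= (1 + n) * (Z' * f2).
  have : Z' * ((1 - n) * (Z * (B * f))) <= Z' * ((1 + n) * f2) by rewrite ler_pM2l.
  have -> : Z' * ((1 - n) * (Z * (B * f))) = (Z' * Z) * ((1 - n) * (B * f)) by ring.
  by rewrite EZ mul1r [Z' * (_ * f2)]mulrCA.
rewrite -(ler_pM2l n1).
apply: (@le_trans _ _ ((1 + n) * ((1 + n) * (Z' * f2)))).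
  have -> : (1 - n) * ((1 + n) * B * f) = (1 + n) * ((1 - n) * (B * f)) by ring.
  by rewrite ler_pM2l// -?mulrA; move: L1 L2 U1 U2; rewrite -?mulrA.
have f20 : 0 <= Z' * f2.
  rewrite mulr_ge0 ?(ltW Z0')//.
  have : 0 <= (1 + n) * f2 by apply: le_trans h1; rewrite ltW// !mulr_gt0.
  by rewrite pmulr_rge0.
have -> : (1 - n) * ((1 + e) * Z' * f2) = (1 + e) * (1 - n) * (Z' * f2) by ring.
by rewrite mulrA ler_wpM2r.
Qed.

(** Dividing by [v] with [1 - v] of order [psi x / x] shifts [x] by a bounded
    multiple of [psi x], so the uniform convergence applies at [x / v] too.  It is
    used for the section of [T * m] at a fixed direction, [v] being the value
    of [m]. *)
Lemma gumbel_tail_rescale z k e : 0 < e -> 0 < k -> \forall x \near +oo,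
  forall v, 1 - k * (psi x / x) <= v <= 1 -> 0 < v /\
    (F ((x + psi x * z) / v) <= (1 + e) * expR (- z) * F (x / v) /\
     F (x / v) <= (1 + e) * expR z * F ((x + psi x * z) / v)).
Proof.
move=> e0 k0.
have [n nE] : {n | n = Num.min 4^-1 (e / 5)} by exact: (exist _ _ erefl).
have n0 : 0 < n by rewrite nE lt_min invr_gt0 ltr0n divr_gt0.
have n4 : n <= 4^-1 by rewrite nE ge_min lexx.
have n5 : n <= e / 5 by rewrite nE ge_min lexx orbT.
clear nE.
have [del delE] : {del | del = ln (1 + n) / (2 * (`|z| + 1) * k)} by exact: (exist _ _ erefl).
have z1 : 0 < `|z| + 1 by rewrite ltr_wpDl.
have del0 : 0 < del by rewrite delE divr_gt0 ?ln_gt0 ?mulr_gt0// ltrDl.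
have delP : del * (2 * (`|z| + 1) * k) = ln (1 + n).
  by rewrite delE divfK// gt_eqF// !mulr_gt0.
clear delE; near=> x => v /andP[v_ge v_le].
have x0 : 0 < x by near: x; exact: nbhs_pinfty_gt.
have px0 := psi0 x0.
have px : psi x <= Num.min (2 * k)^-1 del * x.
  near: x; case: FG => _ _ _ + _; apply.
  by rewrite lt_min del0 invr_gt0 mulr_gt0.
have [u uE] : {u | u = psi x / x} by exact: (exist _ _ erefl).
rewrite -uE in v_ge.
have u0 : 0 < u by rewrite uE divr_gt0.
have xu : psi x = x * u by rewrite uE mulrC divfK ?gt_eqF.
have [uk ud] : 2 * (k * u) <= 1 /\ u <= del.
  split; last by rewrite uE ler_pdivrMr// (le_trans px)// ler_pM2r// ge_min lexx orbT.
  rewrite mulrA -ler_pdivlMl ?mulr_gt0// mulr1 uE ler_pdivrMr// (le_trans px)//.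
  by rewrite ler_pM2r// ge_min lexx.
clear px.
have v2 : 2^-1 <= v by lra.
have v0 : 0 < v by lra.
split=> //.
have iv1 : 1 <= v^-1 by rewrite invf_ge1.
have iv : v^-1 - 1 <= 2 * (k * u).
  rewrite lerBlDr -[leLHS]div1r ler_pdivrMr//; nra.
have [b bE] : {b | b = (v^-1 - 1) / u} by exact: (exist _ _ erefl).
have b0 : 0 <= b by rewrite bE divr_ge0 ?(ltW u0)// subr_ge0.
have bk : b <= 2 * k by rewrite bE ler_pdivrMr//; lra.
(* [1 / v - 1] is at most [2 k] times [u], so that [b] stays bounded. *)
have xv : x / v = x + psi x * b.
  by rewrite xu bE; field; rewrite !gt_eqF.
have xzv : (x + psi x * z) / v = x + psi x * (b + z / v).
  by rewrite xu bE; field; rewrite !gt_eqF.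
have iv2 : v^-1 <= 2 by lra.
have rP : `|b + z / v| <= 2 * k + 2 * `|z|.
  rewrite (le_trans (ler_normD _ _))// ger0_norm// normrM lerD//.
  rewrite mulrC [`|v^-1|]gtr0_norm ?invr_gt0// ler_wpM2r//.
have bP : `|b| <= 2 * k + 2 * `|z|.
  by rewrite ger0_norm// (le_trans bk)// lerDl mulr_ge0.
have unif : forall b, `|b| <= 2 * k + 2 * `|z| ->
    (1 - n) * expR (- b) * F x <= F (x + psi x * b) <= (1 + n) * expR (- b) * F x.
  by near: x; exact: gumbel_tail_uniform.
have /andP[L1 U1] := unif _ bP; have /andP[L2 U2] := unif _ rP.
rewrite xzv xv.
have dz : `|z * (v^-1 - 1)| <= ln (1 + n).
  rewrite normrM [`|v^-1 - 1|]ger0_norm ?subr_ge0//.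
  apply: (@le_trans _ _ ((`|z| + 1) * (2 * (k * u)))).
    by apply: ler_pM; rewrite ?subr_ge0 ?lerDl.
  have -> : (`|z| + 1) * (2 * (k * u)) = u * (2 * (`|z| + 1) * k) by ring.
  by rewrite -delP ler_pM2r// !mulr_gt0.
have [E1 E2] : expR (- (z * (v^-1 - 1))) <= 1 + n /\ expR (z * (v^-1 - 1)) <= 1 + n.
  have n1 : 0 < 1 + n by rewrite addr_gt0.
  split; rewrite -[leRHS](lnK n1) ler_expR; apply: le_trans dz; last exact: ler_norm.
  by rewrite -normrN; exact: ler_norm.
have zv : - (b + z / v) = - b - z - z * (v^-1 - 1) by ring.
rewrite zv in L2 U2; rewrite !expRD in L2 U2.
have EN : expR (- (z * (v^-1 - 1))) * expR (z * (v^-1 - 1)) = 1.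
  by rewrite mulrC expRxMexpNx_1.
have EZ : expR z * expR (- z) = 1 by rewrite expRxMexpNx_1.
have B0 := expR_gt0 (- b); have Z0 := expR_gt0 (- z); have Z0' := expR_gt0 z.
have S0 := expR_gt0 (z * (v^-1 - 1)).
by apply: (@ratio_bounds e n (expR (- b)) (expR (- z)) (expR z) _ _ (F x)
  _ _ _ _ _ _ _ _ _ S0 E1 E2 EN EZ) => //; apply/andP.
Unshelve. all: by end_near. Qed.

End consequences.
End gumbel_tails.

(** * Norms on the sphere *)
Section qnorms.
Context {R : realType} {d : nat}.
Implicit Types (x y : d.-tuple R) (q : \bar R) (r : R).

Lemma qnorm_ge0 q x : 0 <= qnorm q x.
Proof.
case: q => [r| |] //=; first exact: powR_ge0.
by elim/big_ind: _ => // a b; rewrite le_max => ->.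
Qed.

Lemma qnorm_powR r x : 0 < r -> qnorm r%:E x `^ r = \sum_(i < d) `|tnth x i| `^ r.
Proof.
move=> r0; rewrite /= -powRrM mulVf ?gt_eqF// powRr1//.
by apply: sumr_ge0 => i _; exact: powR_ge0.
Qed.

Lemma qnorm_le r x c : 0 < r -> 0 <= c ->
  (qnorm r%:E x <= c) = (\sum_(i < d) `|tnth x i| `^ r <= c `^ r).
Proof.
move=> r0 c0; rewrite -qnorm_powR//; apply/idP/idP => h.
  by rewrite ge0_ler_powR ?nnegrE ?(ltW r0) ?qnorm_ge0.
rewrite leNgt; apply/negP => /(gt0_ltr_powR r0).
by rewrite !nnegrE qnorm_ge0 c0 ltNge h => /(_ isT isT).
Qed.

Lemma qnormy_le x c : 0 <= c -> (forall i, `|tnth x i| <= c) -> qnorm +oo x <= c.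
Proof. by move=> c0 h /=; apply: bigmax_le. Qed.

Lemma tnth_qnorm q x i : (0 < q)%E -> `|tnth x i| <= qnorm q x.
Proof.
case: q => [r| |] //; last by move=> _; exact: le_bigmax.
rewrite lte_fin => r0; rewrite leNgt; apply/negP => /(gt0_ltr_powR r0).
rewrite !nnegrE qnorm_ge0 normr_ge0 qnorm_powR// => /(_ isT isT).
by rewrite ltNge (bigD1 i)//= lerDl sumr_ge0// => j _; exact: powR_ge0.
Qed.

Lemma qnormy_le_qnorm q x : (0 < q)%E -> qnorm +oo x <= qnorm q x.
Proof. by move=> q0; apply: qnormy_le => [|i]; [exact: qnorm_ge0|exact: tnth_qnorm]. Qed.

Lemma qnormyP x : qnorm +oo x = 0 \/ exists i, qnorm +oo x = `|tnth x i|.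
Proof.
rewrite /=; elim/big_ind: _ => [|a b Ha Hb|i _]; first by left.
  by rewrite /Num.max; case: ifP.
by right; exists i.
Qed.

Lemma qnorm2_sqr x : qnorm 2%:E x ^+ 2 = \sum_(i < d) tnth x i ^+ 2.
Proof.
rewrite -(@powR_mulrn _ _ 2) ?qnorm_ge0// qnorm_powR//.
by apply: eq_bigr => i _; rewrite powR_mulrn// -normrX ger0_norm// sqr_ge0.
Qed.

Lemma qnormZ q t x : (0 < q)%E -> qnorm q (tscale t x) = `|t| * qnorm q x.
Proof.
case: q => [r| |] //; rewrite ?lte_fin => r0.
  rewrite /=; under eq_bigr do rewrite tnth_mktuple normrM powRM//.
  rewrite -mulr_sumr powRM ?powR_ge0//; last first.
    by apply: sumr_ge0 => i _; exact: powR_ge0.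
  by rewrite -powRrM mulfV ?gt_eqF// powRr1.
apply/eqP; rewrite eq_le; apply/andP; split.
  apply: qnormy_le => [|i]; first by rewrite mulr_ge0// qnorm_ge0.
  by rewrite tnth_mktuple normrM ler_wpM2l// tnth_qnorm.
have [->|[i ->]] := qnormyP x; first by rewrite mulr0 qnorm_ge0.
by rewrite -normrM; have := @tnth_qnorm +oo (tscale t x) i r0; rewrite tnth_mktuple.
Qed.

#[local] Opaque qnorm.

(** Minkowski's inequality, from the convexity of [t -> t ^ r]: [x / a] and
    [y / b] are in the unit ball, and so is their convex combination with weights
    [a / (a + b)] and [b / (a + b)].  The slack [e] keeps [a] and [b] positive. *)
Lemma le_qnormB q x y : (1 <= q)%E -> qnorm q (tsub x y) <= qnorm q x + qnorm q y.
Proof.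
case: q => [r| |] //; rewrite ?lee_fin => r1; last first.
  apply: qnormy_le => [|i]; first by rewrite addr_ge0 ?qnorm_ge0.
  by rewrite tnth_mktuple (le_trans (ler_normB _ _))// lerD// tnth_qnorm.
have r0 : 0 < r by exact: lt_le_trans r1.
apply/ler_addgt0Pr => e e0.
have [a aE] : {a | a = qnorm r%:E x + e / 2} by exact: (exist _ _ erefl).
have [b bE] : {b | b = qnorm r%:E y + e / 2} by exact: (exist _ _ erefl).
have e20 : 0 < e / 2 by rewrite divr_gt0.
have a0 : 0 < a by rewrite aE ltr_wpDl ?qnorm_ge0.
have b0 : 0 < b by rewrite bE ltr_wpDl ?qnorm_ge0.
have ab0 : 0 < a + b by rewrite addr_gt0.
have -> : qnorm r%:E x + qnorm r%:E y + e = a + b by rewrite aE bE addrACA -splitr.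
rewrite qnorm_le ?(ltW ab0)//.
have t0 : 0 <= a / (a + b) by rewrite divr_ge0// ltW.
have t1 : a / (a + b) <= 1 by rewrite ler_pdivrMr// mul1r lerDl ltW.
have ta : 1 - a / (a + b) = b / (a + b) by field; rewrite gt_eqF.
have key i : `|tnth (tsub x y) i| `^ r <= (a + b) `^ r *
    (a / (a + b) * (`|tnth x i| / a) `^ r + b / (a + b) * (`|tnth y i| / b) `^ r).
  have := @convex_powR R r r1 (Itv01 t0 t1) (`|tnth x i| / a) (`|tnth y i| / b).
  rewrite !inE/= !in_itv/= !andbT !divr_ge0 ?(ltW a0) ?(ltW b0)// => /(_ isT isT).
  move=> h.
  have {}h : (a / (a + b) * (`|tnth x i| / a) + (1 - a / (a + b)) * (`|tnth y i| / b)) `^ r <=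
    a / (a + b) * (`|tnth x i| / a) `^ r + (1 - a / (a + b)) * (`|tnth y i| / b) `^ r := h.
  rewrite ta in h.
  apply: le_trans (ler_wpM2l (powR_ge0 _ _) h).
  have xa : 0 <= `|tnth x i| / a by rewrite divr_ge0// ltW.
  have yb : 0 <= `|tnth y i| / b by rewrite divr_ge0// ltW.
  have tb : 0 <= b / (a + b) by rewrite divr_ge0// ltW.
  have uv0 : 0 <= a / (a + b) * (`|tnth x i| / a) + b / (a + b) * (`|tnth y i| / b).
    by apply: addr_ge0; apply: mulr_ge0.
  rewrite -powRM ?(ltW ab0)//; apply: ge0_ler_powR; rewrite ?nnegrE ?(ltW r0)//.
    by apply: mulr_ge0 => //; exact: ltW.
  rewrite tnth_mktuple (le_trans (ler_normB _ _))// le_eqVlt; apply/orP; left.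
  by apply/eqP; field; rewrite !gt_eqF.
apply: (le_trans (ler_sum _ (fun i _ => key i))).
rewrite -mulr_sumr ler_piMr ?powR_ge0// big_split/= -!mulr_sumr.
have unit (z : d.-tuple R) c : 0 < c -> qnorm r%:E z <= c ->
    \sum_(i < d) (`|tnth z i| / c) `^ r <= 1.
  move=> c0 zc; under eq_bigr do rewrite powRM ?invr_ge0 ?(ltW c0)//.
  rewrite -mulr_suml -qnorm_powR// -powRM ?qnorm_ge0 ?invr_ge0 ?(ltW c0)//.
  apply: (@le_trans _ _ (1 `^ r)); last by rewrite powR1.
  apply: ge0_ler_powR; rewrite ?nnegrE ?(ltW r0)//.
    by rewrite divr_ge0 ?qnorm_ge0 ?ltW.
  by rewrite ler_pdivrMr// mul1r.
have xa : \sum_(i < d) (`|tnth x i| / a) `^ r <= 1 by rewrite unit// aE lerDl ltW.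
have yb : \sum_(i < d) (`|tnth y i| / b) `^ r <= 1 by rewrite unit// bE lerDl ltW.
rewrite -[leRHS](subrKC (a / (a + b))) ta lerD// ler_piMr// ?divr_ge0 ?ltW//.
Qed.

(** The norms are homogeneous of the same degree: it suffices to compare them on
    the Euclidean sphere. *)
Lemma qnorm_homogeneous (P : R -> R -> R -> Prop) q : (0 < q)%E ->
    (forall c a b e, 0 <= c -> P a b e -> P (c * a) (c * b) (c * e)) ->
    (forall x, qnorm 2%:E x = 1 -> P 1 (qnorm +oo x) (qnorm q x)) ->
  P 0 0 0 -> forall x, P (qnorm 2%:E x) (qnorm +oo x) (qnorm q x).
Proof.
move=> q0 PZ P1 P0 x; have two0 : (0 < 2%:E :> \bar R)%E by rewrite lte_fin.
have [S0|S0] := eqVneq (qnorm 2%:E x) 0.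
  have x0 : x = tscale 0 x.
    apply: eq_from_tnth => i; rewrite tnth_mktuple mul0r; apply/normr0_eq0/eqP.
    by rewrite eq_le normr_ge0 andbT -S0 tnth_qnorm.
  by rewrite x0 !qnormZ// normr0 !mul0r.
have Sp : 0 < qnorm 2%:E x by rewrite lt_neqAle eq_sym S0 qnorm_ge0.
set S := qnorm 2%:E x in S0 Sp *.
pose y := tscale S^-1 x.
have yE p : (0 < p)%E -> qnorm p x = S * qnorm p y.
  by move=> p0; rewrite qnormZ// gtr0_norm ?invr_gt0// mulVKf.
have y1 : qnorm 2%:E y = 1.
  by apply: (mulfI S0); rewrite -yE// mulr1.
by rewrite -[X in P X](mulr1 S) !yE//; apply: PZ; [exact: ltW|exact: P1].
Qed.

Lemma powR_factor_sqr (a r : R) : 2 < r -> 0 <= a -> a `^ r = a `^ (r - 2) * a ^+ 2.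
Proof.
move=> r2 a0; have r0 : r - 2 + 2 != 0 by rewrite subrK gt_eqF// (lt_trans _ r2).
by rewrite -[in RHS]powR_mulrn// -powRD ?(negPf r0)// subrK.
Qed.

Section sphere_vertices.
Variable q : \bar R.
Hypothesis q2 : (2%:E < q)%E.

Let q0 : (0 < q)%E. Proof. by apply: lt_trans q2; rewrite lte_fin. Qed.

(** On the sphere [sum |x_i| ^ r <= m ^ (r - 2) * sum x_i ^ 2 = m ^ (r - 2)] with
    [m] the maximum norm, so that [qnorm q x <= m ^ th] with [th = (r - 2) / r];
    Young's inequality linearizes the bound into [1 - th * (1 - m)], where [th > 0]
    because [r > 2]. *)
Lemma qnorm_gap : exists2 th, 0 < th <= 1 & forall x,
  qnorm q x <= qnorm 2%:E x - th * (qnorm 2%:E x - qnorm +oo x).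
Proof.
case: q q2 q0 => [r| |] //; rewrite ?lte_fin => r2 r0; last first.
  exists 1; first by rewrite ltr01 lexx.
  by move=> x; rewrite mul1r subKr.
pose th := (r - 2) / r.
have th0 : 0 < th by rewrite divr_gt0// subr_gt0.
have th1 : th < 1 by rewrite ltr_pdivrMr// mul1r ltrBlDr ltrDl.
exists th; first by rewrite th0 ltW.
apply: (@qnorm_homogeneous (fun a b e => e <= a - th * (a - b)) r%:E r0).
- by move=> c a b e c0 h; rewrite -mulrBr mulrCA -mulrBr ler_wpM2l.
- move=> x x1; set m := qnorm +oo x.
  have m0 : 0 <= m by exact: qnorm_ge0.
  have r20 : 0 < r - 2 by rewrite subr_gt0.
  apply: (@le_trans _ _ (m `^ th)).
    rewrite qnorm_le ?powR_ge0// -powRrM divfK ?gt_eqF//.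
    have S1 : \sum_(i < d) tnth x i ^+ 2 = 1 by rewrite -qnorm2_sqr x1 expr1n.
    rewrite -[leRHS]mulr1 -[X in _ <= _ * X]S1 mulr_sumr; apply: ler_sum => i _.
    have xm : `|tnth x i| <= m by exact: tnth_qnorm.
    rewrite powR_factor_sqr// -normrX (ger0_norm (sqr_ge0 _)) ler_wpM2r ?sqr_ge0//.
    by rewrite ge0_ler_powR ?nnegrE ?(ltW r20).
  have th1' : 0 < 1 - th by rewrite subr_gt0.
  have := @conjugate_powR R (m `^ th) 1 th^-1 (1 - th)^-1 (powR_ge0 _ _) ler01.
  rewrite !invr_gt0 !invrK => /(_ th0 th1' (subrKC _ _)).
  by rewrite -powRrM mulfV ?gt_eqF// powRr1// powR1 mulr1 mul1r; lra.
- by rewrite subr0 mulr0 subr0.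
Qed.

(** Near a vertex of the sphere the coordinates other than the largest one have
    squares of total mass [1 - m ^ 2 <= 2 * (1 - m)], and each of them is small, so
    that their [r]-th powers with [r > 2] sum to [o (1 - m)]. *)
Lemma qnorm_near_vertex e : 0 < e -> exists2 del, 0 < del & forall x,
  qnorm 2%:E x - qnorm +oo x <= del * qnorm 2%:E x ->
  qnorm q x <= qnorm +oo x + e * (qnorm 2%:E x - qnorm +oo x).
Proof.
move=> e0; case: q q2 q0 => [r| |] //; rewrite ?lte_fin => r2 r0; last first.
  exists 1 => // x _; rewrite lerDl mulr_ge0 ?(ltW e0)// subr_ge0.
  by apply: qnormy_le_qnorm; rewrite lte_fin.
(* [m >= 1 / 2] makes the slope of [t -> t ^ r] at [m] at least [(1 / 2) ^ (r - 1)]. *)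
pose eta : R := e * (1 / 2) `^ (r - 1) / 2.
have r20 : 0 < (r - 2) / 2 by rewrite divr_gt0// subr_gt0.
have eta0 : 0 < eta by rewrite divr_gt0// mulr_gt0// powR_gt0.
pose del := Num.min (1 / 2) (eta `^ ((r - 2) / 2)^-1 / 2).
have del0 : 0 < del by rewrite lt_min !divr_gt0// powR_gt0.
have del_eta : (2 * del) `^ ((r - 2) / 2) <= eta.
  have -> : eta = (eta `^ ((r - 2) / 2)^-1) `^ ((r - 2) / 2).
    by rewrite -powRrM mulVf ?gt_eqF// powRr1// ltW.
  apply: ge0_ler_powR; rewrite ?nnegrE ?powR_ge0 ?(ltW r20) ?mulr_ge0 ?(ltW del0)//.
  by rewrite mulrC -ler_pdivlMr// ge_min lexx orbT.
have del2 : del <= 1 / 2 by rewrite ge_min lexx.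
exists del => //.
apply: (@qnorm_homogeneous (fun a b c => a - b <= del * a -> c <= b + e * (a - b)) r%:E r0).
- move=> c a b f; rewrite le_eqVlt => /predU1P[<-|c0] h; first by rewrite !mul0r subrr !mulr0 addr0.
  by rewrite -mulrBr !(mulrCA _ c) -mulrDr !ler_pM2l.
- move=> x x1; rewrite mulr1; have [m mE] : {m | m = qnorm +oo x} by exact: (exist _ _ erefl).
  have m_le1 : m <= 1 by rewrite mE -x1; apply: qnormy_le_qnorm; rewrite lte_fin.
  have mP := qnormyP x; rewrite -mE in mP *; move=> mdel.
  have m12 : 1 / 2 <= m by lra.
  case: mP => [m0|[k mk]]; first by move: m12; rewrite m0 ler_pdivrMr// mul0r ler10.
  have S1 : \sum_(i < d) tnth x i ^+ 2 = 1 by rewrite -qnorm2_sqr x1 expr1n.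
  have Sk : \sum_(i < d | i != k) tnth x i ^+ 2 = 1 - m ^+ 2.
    by rewrite -S1 [X in _ = X - _](bigD1 k)//= mk -normrX ger0_norm ?sqr_ge0// addrAC subrr add0r.
  have m0 : 0 <= m by lra.
  have s2 : 1 - m ^+ 2 <= 2 * (1 - m) by rewrite expr2; nra.
  have s0 : 0 <= 1 - m ^+ 2 by rewrite expr2; nra.
  have coord i : i != k -> `|tnth x i| `^ r <= eta * tnth x i ^+ 2.
    move=> ik; have xi : tnth x i ^+ 2 <= 1 - m ^+ 2.
      by rewrite -Sk (bigD1 i)//= lerDl sumr_ge0// => j _; exact: sqr_ge0.
    rewrite powR_factor_sqr// -normrX (ger0_norm (sqr_ge0 _)) ler_wpM2r ?sqr_ge0//.
    have -> : `|tnth x i| `^ (r - 2) = (tnth x i ^+ 2) `^ ((r - 2) / 2).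
      rewrite -(ger0_norm (sqr_ge0 (tnth x i))) normrX -powR_mulrn// -powRrM.
      by rewrite [2%:R * _]mulrC divfK.
    apply: le_trans del_eta; apply: ge0_ler_powR;
      rewrite ?nnegrE ?sqr_ge0 ?(ltW r20) ?mulr_ge0 ?(ltW del0)//.
    by rewrite (le_trans xi)// (le_trans s2)// ler_pM2l.
  have h0 : 0 <= e * (1 - m) by rewrite mulr_ge0 ?(ltW e0)// subr_ge0.
  rewrite qnorm_le ?addr_ge0// (bigD1 k)//= -mk.
  apply: (@le_trans _ _ (m `^ r + eta * (2 * (1 - m)))).
    rewrite lerD2l (le_trans (ler_sum _ coord))// -mulr_sumr Sk ler_wpM2l// ltW//.
  rewrite -(@mulr_powRB1 _ (m + _)) ?addr_ge0// -(@mulr_powRB1 _ m)//.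
  have r10 : 0 < r - 1 by rewrite subr_gt0; lra.
  apply: (@le_trans _ _ ((m + e * (1 - m)) * m `^ (r - 1))).
    rewrite [leRHS]mulrDl lerD2l.
    have : (1 / 2) `^ (r - 1) <= m `^ (r - 1).
      by apply: ge0_ler_powR; rewrite ?nnegrE ?(ltW r10).
    move=> /(ler_wpM2l h0); apply: le_trans.
    by rewrite /eta le_eqVlt; apply/orP; left; apply/eqP; field.
  apply: ler_wpM2l; rewrite ?addr_ge0//; apply: ge0_ler_powR;
    by rewrite ?nnegrE ?(ltW r10) ?addr_ge0// lerDl.
- by rewrite subr0 !mulr0 addr0.
Qed.

End sphere_vertices.

Lemma measurable_bigmax (dO : measure_display) (O : measurableType dO) (I : Type)
    (s : seq I) (p : pred I) (f : I -> O -> R) (g : O -> R) :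
  measurable_fun setT g -> (forall i, measurable_fun setT (f i)) ->
  measurable_fun setT (fun w => \big[Num.max/g w]_(i <- s | p i) f i w).
Proof.
move=> mg mf; elim: s => [|i s IH]; first by under eq_fun do rewrite big_nil.
under eq_fun do rewrite big_cons; case: (p i) => //.
exact: measurable_maxr.
Qed.

#[local] Transparent qnorm.

Lemma measurable_qnorm q : measurable_fun setT (fun x : d.-tuple R => qnorm q x).
Proof.
case: q => [r| |] /=; last exact: measurable_cst.
  apply: (measurableT_comp (measurable_powR _)).
  apply: measurable_sum => i; apply: (measurableT_comp (measurable_powR _)).
  by apply: measurableT_comp => //; exact: measurable_tnth.
apply: measurable_bigmax => [|i]; first exact: measurable_cst.
by apply: measurableT_comp => //; exact: measurable_tnth.
Qed.

End qnorms.

(** * Real-valued probabilities and independence *)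
Section real_probabilities.
Context {dO : measure_display} {O : measurableType dO} {R : realType}.
Variable P : probability O R.
Implicit Types A B : set O.

Definition pr A : R := fine (P A).

Lemma prE A : measurable A -> P A = (pr A)%:E.
Proof. by move=> mA; rewrite fineK// fin_num_measure. Qed.

Lemma pr_ge0 A : 0 <= pr A. Proof. exact: fine_ge0. Qed.

Lemma prT : pr setT = 1. Proof. by rewrite /pr probability_setT. Qed.

Lemma le_pr A B : measurable A -> measurable B -> A `<=` B -> pr A <= pr B.
Proof. by move=> mA mB AB; rewrite fine_le ?fin_num_measure// le_measure ?inE. Qed.

Lemma pr_le1 A : measurable A -> pr A <= 1.
Proof. by move=> mA; rewrite -prT le_pr. Qed.

Lemma prU_disjoint A B : measurable A -> measurable B -> [disjoint A & B] ->
  pr (A `|` B) = pr A + pr B.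
Proof.
move=> mA mB; rewrite disj_set2E => /eqP AB.
by rewrite /pr measureU// fineD// fin_num_measure.
Qed.

Lemma prID A B : measurable A -> measurable B ->
  pr A = pr (A `&` B) + pr (A `&` ~` B).
Proof.
move=> mA mB; rewrite -[in LHS](setIT A) -(setUv B) setIUr prU_disjoint//.
- exact: measurableI.
- exact/measurableI/measurableC.
- by rewrite disj_set2E setIACA setICr setI0 eqxx.
Qed.

Lemma prC A : measurable A -> pr (~` A) = 1 - pr A.
Proof.
move=> mA; have := prID measurableT mA; rewrite !setTI prT => ->.
by rewrite addrAC subrr add0r.
Qed.

Lemma prU_le A B : measurable A -> measurable B -> pr (A `|` B) <= pr A + pr B.
Proof.
move=> mA mB; rewrite (@prID _ A)//; last exact: measurableU.
rewrite lerD// le_pr//.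
- exact/measurableI/mA/measurableU.
- exact/measurableI/measurableC/mA/measurableU.
- by move=> x [[]].
Qed.

Lemma prU_ge A B D : measurable A -> measurable B -> measurable D ->
  A `&` B `<=` D -> pr A + pr B <= pr (A `|` B) + pr D.
Proof.
move=> mA mB mD ABD; rewrite (@prID _ A (measurableU _ _ mA mB))//.
rewrite (@prID B A)// [pr (B `&` A) + _]addrC addrA lerD//.
  rewrite lerD// le_pr//.
  - exact/measurableI/mA/measurableU.
  - by move=> x; split=> //; left.
  - exact/measurableI/measurableC.
  - exact/measurableI/measurableC/mA/measurableU.
  - by move=> x [Bx Ax]; split=> //; right.
by rewrite le_pr//; [exact: measurableI|rewrite setIC].
Qed.

Lemma existsin_cons (I : eqType) (i : I) (s : seq I) (B : I -> set O) :
  [set w | exists2 j, j \in i :: s & B j w] =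
  B i `|` [set w | exists2 i, i \in s & B i w].
Proof.
apply/seteqP; split=> w /=.
  by move=> [j]; rewrite inE => /predU1P[->|js] Bj; [left|right; exists j].
by move=> [Bi|[j js Bj]]; [exists i|exists j] => //; rewrite inE ?eqxx// js orbT.
Qed.

Lemma measurable_existsin (I : eqType) (s : seq I) (B : I -> set O) :
  (forall i, measurable (B i)) -> measurable [set w | exists2 i, i \in s & B i w].
Proof.
move=> mB; elim: s => [|i s IH].
  rewrite (_ : [set _ | _] = set0)// -subset0 => w [//].
by rewrite existsin_cons; exact: measurableU.
Qed.

Lemma pr_existsin_le (I : eqType) (s : seq I) (B : I -> set O) :
  (forall i, measurable (B i)) ->
  pr [set w | exists2 i, i \in s & B i w] <= \sum_(i <- s) pr (B i).
Proof.
move=> mB; elim: s => [|i s IH].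
  by rewrite big_nil (_ : [set _ | _] = set0) ?/pr ?measure0// -subset0 => w [].
rewrite big_cons existsin_cons (le_trans (prU_le _ _))//.
  exact: measurable_existsin.
by rewrite lerD2l.
Qed.

(** Bonferroni's inequality: the union bound is sharp up to the probability of
    a set that contains all the pairwise intersections. *)
Lemma pr_existsin_ge (I : eqType) (s : seq I) (B : I -> set O) (D : set O) :
  (forall i, measurable (B i)) -> measurable D -> uniq s ->
  (forall i j, i != j -> B i `&` B j `<=` D) ->
  \sum_(i <- s) pr (B i) <= pr [set w | exists2 i, i \in s & B i w] + (size s)%:R * pr D.
Proof.
move=> mB mD + BD; elim: s => [|i s IH /=].
  by rewrite big_nil addr_ge0 ?mulr_ge0 ?pr_ge0.
move=> /andP[is_ us]; rewrite big_cons existsin_cons.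
have mS := measurable_existsin s mB.
have := @prU_ge (B i) _ D (mB i) mS mD.
have BS : B i `&` [set w | exists2 i, i \in s & B i w] `<=` D.
  move=> w [Bi [j js Bj]]; apply: (BD i j) => //.
  by apply: contraNneq is_ => ->.
move=> /(_ BS); have := IH us; rewrite -natr1 mulrDl mul1r; lra.
Qed.

Lemma le_pr_ae A B : measurable A -> measurable B ->
  {ae P, forall w, A w -> B w} -> pr A <= pr B.
Proof.
move=> mA mB [N [mN N0 ABN]].
have -> : pr B = pr B + pr N by rewrite /pr N0 /= addr0.
apply: le_trans (prU_le mB mN); apply: le_pr => //; first exact: measurableU.
move=> w Aw; have [Bw|nBw] := pselect (B w); first by left.
by right; apply: ABN => /= /(_ Aw).
Qed.

Lemma measurable_set_ltr (f g : O -> R) : measurable_fun setT f ->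
  measurable_fun setT g -> measurable [set w | f w < g w].
Proof.
move=> mf mg; have := measurable_fun_ltr mf mg.
by move=> /(_ measurableT [set true] I); rewrite setTI.
Qed.

Lemma measurable_set_ler (f g : O -> R) : measurable_fun setT f ->
  measurable_fun setT g -> measurable [set w | f w <= g w].
Proof.
move=> mf mg; have := measurable_fun_ler mf mg.
by move=> /(_ measurableT [set true] I); rewrite setTI.
Qed.

End real_probabilities.
Arguments le_pr {dO O R P A B}.

Section independence.
Context {dO : measure_display} {O : measurableType dO} {R : realType}.
Variable P : probability O R.

Definition independent_maps d1 d2 (E1 : measurableType d1) (E2 : measurableType d2)
    (U : O -> E1) (V : O -> E2) :=
  forall (A : set E1) (B : set E2), measurable A -> measurable B ->
    P [set w | A (U w) /\ B (V w)] = (P [set w | A (U w)] * P [set w | B (V w)])%E.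

Context d1 d2 (E1 : measurableType d1) (E2 : measurableType d2).

Lemma pr_independent (U : O -> E1) (V : O -> E2) A B :
  measurable_fun setT U -> measurable_fun setT V ->
  independent_maps U V -> measurable A -> measurable B ->
  pr P [set w | A (U w) /\ B (V w)] = pr P [set w | A (U w)] * pr P [set w | B (V w)].
Proof.
move=> mU mV indep mA mB; rewrite /pr indep// fineM// fin_num_measure//.
  by rewrite -[X in measurable X]setTI; exact: mU.
by rewrite -[X in measurable X]setTI; exact: mV.
Qed.

(** The joint law of independent maps and the product of their laws agree on the
    rectangles, hence everywhere. *)
Lemma pr_joint (U : O -> E1) (V : O -> E2)
    (mU : measurable_fun setT U) (mV : measurable_fun setT V) :
  independent_maps U V -> forall A, measurable A ->
  P [set w | A (U w, V w)] =
    (\int[distribution P (mfun_Sub (mem_set mU))]_u P [set w | A (u, V w)])%E.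
Proof.
move=> indep A mA.
pose U' := mfun_Sub (mem_set mU); pose V' := mfun_Sub (mem_set mV).
pose Z' := mfun_Sub (mem_set (measurable_fun_pair mU mV)).
have -> : P [set w | A (U w, V w)] = distribution P Z' A by [].
rewrite -(@product_measure_unique _ _ _ _ _ (distribution P U') (distribution P V'))//.
  rewrite /product_measure1; apply: eq_integral => u _ /=.
  rewrite /distribution /pushforward /=; congr (P _).
  by apply/seteqP; split=> w /=; rewrite /xsection/= inE.
Qed.

(** Conditioning on [U]: inequalities between the sections at fixed values of
    [U] pass to the joint law of independent maps. *)
Lemma le_pr_sections (U : O -> E1) (V : O -> E2) (A B : set (E1 * E2)) (c : R) :
  measurable_fun setT U -> measurable_fun setT V -> independent_maps U V ->
  measurable A -> measurable B -> 0 <= c ->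
  (forall u, pr P [set w | A (u, V w)] <= c * pr P [set w | B (u, V w)]) ->
  pr P [set w | A (U w, V w)] <= c * pr P [set w | B (U w, V w)].
Proof.
move=> mU mV indep mA mB c0 AB.
have mS (C : set (E1 * E2)) u : measurable C -> measurable [set w | C (u, V w)].
  move=> mC; rewrite -[X in measurable X]setTI.
  by apply: (measurable_fun_pair (measurable_cst u) mV) => //.
have mJ (C : set (E1 * E2)) : measurable C -> measurable [set w | C (U w, V w)].
  move=> mC; rewrite -[X in measurable X]setTI.
  by apply: (measurable_fun_pair mU mV) => //.
have mF (C : set (E1 * E2)) : measurable C ->
    measurable_fun setT (fun u => P [set w | C (u, V w)]).
  move=> mC; pose V' := mfun_Sub (mem_set mV).
  have := measurable_fun_xsection (distribution P V') mC.
  apply: eq_measurable_fun => u _ /=.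
  rewrite /distribution /pushforward /=; congr (P _).
  by apply/seteqP; split=> w /=; rewrite /xsection/= inE.
rewrite -lee_fin EFinM -!prE//; [|exact: mJ..].
rewrite !(pr_joint mU mV indep)// -ge0_integralZl_EFin//; last exact: mF.
apply: ge0_le_integral => //.
- exact: mF.
- exact/measurable_funeM/mF.
- by move=> u _; rewrite (prE P (mS A u mA)) (prE P (mS B u mB)) -EFinM lee_fin; exact: AB.
Qed.

(** Both joint laws are the product of the same two marginal laws. *)
Lemma pr_joint_same_law (U U' : O -> E1) (V : O -> E2) (A : set (E1 * E2)) :
  measurable_fun setT U -> measurable_fun setT U' -> measurable_fun setT V ->
  independent_maps U V -> independent_maps U' V -> measurable A ->
  (forall B, measurable B -> P [set w | B (U w)] = P [set w | B (U' w)]) ->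
  P [set w | A (U w, V w)] = P [set w | A (U' w, V w)].
Proof.
move=> mU mU' mV iU iU' mA UU'.
pose V' := mfun_Sub (mem_set mV).
pose u_ := mfun_Sub (mem_set mU); pose u'_ := mfun_Sub (mem_set mU').
pose Z' := mfun_Sub (mem_set (measurable_fun_pair mU mV)).
pose Y' := mfun_Sub (mem_set (measurable_fun_pair mU' mV)).
pose mu := (distribution P u'_ \x distribution P V')%E.
apply: (@eq_trans _ _ (mu A)).
  apply: esym; apply: (@product_measure_unique _ _ _ _ _ _ _ (distribution P Z')) => //.
  by move=> B C mB mC; have := iU B C mB mC; rewrite UU'.
by apply: (@product_measure_unique _ _ _ _ _ _ _ (distribution P Y')).
Qed.

End independence.

(** * Products of a Gumbel tail and an independent direction *)

(** Used to show that a product above [x - B p] with a radius of at most [x + K p]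
    forces the direction above [1 - (B + K) p / x]. *)
Lemma dilated_le {R : realType} (x p u B K : R) :
  x * u = p -> 0 <= p -> 0 <= u -> 0 <= B -> 0 <= K ->
  (x + K * p) * (1 - (B + K) * u) <= x - B * p.
Proof.
move=> xu p0 u0 B0 K0.
have -> : (x + K * p) * (1 - (B + K) * u) =
  x + K * p - (B + K) * (x * u) - (K * p) * ((B + K) * u) by ring.
have h : 0 <= (K * p) * ((B + K) * u).
  by apply: mulr_ge0; apply: mulr_ge0; rewrite ?addr_ge0.
rewrite xu mulrDl; lra.
Qed.

(** [g1] and [g2] are the tails to be compared, [d1] and [d2] their main parts, up
    to errors [e2 * g1]; [a] and [b] are the inverse exponentials. *)
Lemma tail_ratio_sandwich {R : realType} (e e2 a b d1 d2 g1 g2 : R) :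
  0 < e -> 0 < b -> a * b = 1 -> e2 <= e / 2 * b -> e2 <= e / 2 ->
  0 <= g1 -> 0 <= (1 + e / 2) * b ->
  g1 <= d1 + e2 * g1 -> g2 <= d2 + e2 * g1 ->
  d2 <= (1 + e / 2) * b * d1 -> d1 <= (1 + e / 2) * a * d2 -> d1 <= g1 -> d2 <= g2 ->
  (1 - e) * b * g1 <= g2 <= (1 + e) * b * g1.
Proof.
move=> e0 b0 ab e2b e2e g10 c0 h1 h2 h3 h4 h5 h6.
apply/andP; split.
  have h7 : b * d1 <= (1 + e / 2) * g2.
    have : b * d1 <= b * ((1 + e / 2) * a * d2) by rewrite ler_pM2l.
    have -> : b * ((1 + e / 2) * a * d2) = (a * b) * ((1 + e / 2) * d2) by ring.
    rewrite ab mul1r => /le_trans; apply; rewrite ler_pM2l//; lra.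
  have h8 : (1 - e2) * g1 <= d1 by lra.
  have h9 : (1 - e / 2) * (b * g1) <= b * d1.
    apply: (@le_trans _ _ (b * ((1 - e2) * g1))); last by rewrite ler_pM2l.
    by rewrite [leRHS]mulrCA ler_wpM2r ?mulr_ge0 ?(ltW b0)//; lra.
  have h10 : 0 <= b * g1 by rewrite mulr_ge0// ltW.
  rewrite -mulrA; move: (b * g1) h10 h9 => y yP h9.
  have h11 : (1 - e / 2) * y <= (1 + e / 2) * g2 by lra.
  have h12 : (1 - e) * (1 + e / 2) * y <= (1 - e / 2) * y.
    by rewrite ler_wpM2r//; nra.
  by rewrite -(@ler_pM2l _ (1 + e / 2)); [lra|lra].
have h7 : (1 + e / 2) * b * d1 <= (1 + e / 2) * b * g1 by rewrite ler_wpM2l.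
have h8 : e2 * g1 <= e / 2 * b * g1 by rewrite ler_wpM2r.
lra.
Qed.

(** A radius in [(x, x + K p]] and a value [T r > x] force [1 - m] to be of order
    [u = p / x], where [r - m] is at most a small multiple of [1 - m]; replacing
    [r] by [m] then lowers [T r] by [z p] at most. *)
Lemma direction_switch {R : realType} (x p u K th z del T r m : R) :
  0 < x -> 0 < p -> x * u = p -> 0 < u -> 0 < K -> 0 < th -> 0 < z ->
  u * K <= 1 -> u * K <= del * th ->
  0 < T -> 0 <= m -> m <= r -> r <= 1 - th * (1 - m) ->
  (1 - m <= del -> r <= m + z * th / (2 * K) * (1 - m)) ->
  x < T * r -> T <= x + K * p -> x + p * - z < T * m.
Proof.
move=> x0 px0 xu u0 K0 th0 z0 uK udel T0 m0 mr rm Hv xT TK.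
have r0 : 0 <= r by exact: le_trans mr.
have h1 : x < (x + K * p) * r by apply: (lt_le_trans xT); rewrite ler_wpM2r.
have h2 : 1 - K * u <= r.
  rewrite leNgt; apply/negP => h0.
  have h' : (x + K * p) * r <= (x + K * p) * (1 - K * u).
    by rewrite ler_wpM2l ?(ltW h0)// addr_ge0 ?mulr_ge0 ?ltW.
  have := dilated_le xu (ltW px0) (ltW u0) (lexx 0) (ltW K0).
  rewrite add0r mul0r subr0 leNgt => /negP; apply.
  exact: lt_le_trans h'.
have h3 : (1 - m) * th <= u * K by lra.
have h4 : 1 - m <= del by rewrite -(ler_pM2r th0) (le_trans h3).
have h5 : (z * th / (2 * K)) * (1 - m) <= z * u / 2.
  apply: (@le_trans _ _ (z / (2 * K) * (u * K))).
    have -> : z * th / (2 * K) * (1 - m) = z / (2 * K) * ((1 - m) * th) by ring.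
    by rewrite ler_wpM2l// divr_ge0 ?mulr_ge0 ?ltW.
  by rewrite le_eqVlt; apply/orP; left; apply/eqP; field; rewrite gt_eqF.
have h6 := Hv h4.
have T2 : T <= 2 * x.
  have : K * p <= x by rewrite -xu mulrCA ler_piMr ?(ltW x0)// mulrC.
  by lra.
have h7 : T * r <= T * m + T * (z * u / 2).
  by rewrite -mulrDr ler_pM2l//; lra.
have h8 : T * (z * u / 2) <= 2 * x * (z * u / 2).
  by rewrite ler_wpM2r// divr_ge0// mulr_ge0// ltW.
have h9 : 2 * x * (z * u / 2) = p * z by rewrite -xu; field.
by lra.
Qed.

Lemma square_budget {R : realType} (e e1 : R) :
  0 < e1 -> 4 * e1 <= 1 -> 4 * e1 <= e -> (1 + e1) * (1 + e1) + e1 <= 1 + e.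
Proof. by move=> *; nra. Qed.

(** [T] is the radius, [m] and [rho] are the maximum norm and the [q]-norm of the
    direction, so that [h] is the measure of the caps around the vertices and [G]
    the tail of the maximum norm of the product. *)
Section radial_product.
Context {dO : measure_display} {O : measurableType dO} {R : realType}.
Variables (P : probability O R) (T rho m : O -> R) (psi : R -> R).
Let F x := pr P [set w | x < T w].
Let h v := pr P [set w | 1 - v <= m w].
Let G x := pr P [set w | x < T w * m w].

Hypotheses (mT : measurable_fun setT T) (mrho : measurable_fun setT rho)
  (mm : measurable_fun setT m).
Hypothesis FG : gumbel_tail F psi.
Hypotheses (indep_rho : independent_maps P rho T) (indep_m : independent_maps P m T).
Variables (th N : R).
Hypotheses (th0 : 0 < th) (N1 : 1 <= N).
Hypothesis good : {ae P, forall w,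
  [/\ 0 < T w, 0 <= m w <= 1, m w <= rho w & rho w <= 1 - th * (1 - m w)]}.
Hypothesis vertex : forall e, 0 < e -> exists2 del, 0 < del &
  {ae P, forall w, 1 - m w <= del -> rho w <= m w + e * (1 - m w)}.
Hypothesis doubling : forall v, 0 < v -> h (4 * v) <= N * h v.

Let F0 x : 0 < F x. Proof. by case: FG. Qed.
Let Fle x y : x <= y -> F y <= F x. Proof. by case: FG => _ + _ _ _; apply. Qed.
Let psi0 x : 0 < x -> 0 < psi x. Proof. by case: FG => _ _ + _ _; apply. Qed.

Let mset_lt (f g : O -> R) : measurable_fun setT f -> measurable_fun setT g ->
  measurable [set w | f w < g w].
Proof. exact: measurable_set_ltr. Qed.
Let mset_le (f g : O -> R) : measurable_fun setT f -> measurable_fun setT g ->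
  measurable [set w | f w <= g w].
Proof. exact: measurable_set_ler. Qed.
Let mTm : measurable_fun setT (fun w => T w * m w).
Proof. exact: measurable_funM. Qed.
Let mTr : measurable_fun setT (fun w => T w * rho w).
Proof. exact: measurable_funM. Qed.
Let mF x : measurable [set w | x < T w]. Proof. exact: mset_lt. Qed.
Let mh v : measurable [set w | 1 - v <= m w]. Proof. exact: mset_le. Qed.
Let mG x : measurable [set w | x < T w * m w]. Proof. exact: mset_lt. Qed.
Let mQ x : measurable [set w | x < T w * rho w]. Proof. exact: mset_lt. Qed.

Let mI (A B : O -> Prop) : measurable [set w | A w] -> measurable [set w | B w] ->
  measurable [set w | A w /\ B w].
Proof. by move=> mA mB; exact: (measurableI _ _ mA mB). Qed.

Let h_iter k v : 0 < v -> h (4 ^+ k * v) <= N ^+ k * h v.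
Proof.
move=> v0; elim: k => [|k IH]; first by rewrite !expr0 !mul1r.
rewrite !exprS -!mulrA (le_trans (doubling _))// ?mulr_gt0 ?exprn_gt0//.
by rewrite ler_wpM2l// (le_trans _ N1).
Qed.

Lemma cap_gt0 v : 0 < v -> 0 < h v.
Proof.
move=> v0; have [k] := le_natX v^-1 (isT : 1 < 4)%N.
rewrite -div1r ler_pdivrMr// => kv.
have h1 : 1 <= h (4 ^+ k * v).
  apply: (@le_trans _ _ (pr P setT)); first by rewrite prT.
  apply: le_pr_ae => //.
  move: good; apply: filterS => w [_ /andP[mw _] _ _] _ /=; lra.
have Nk : 0 < N ^+ k by rewrite exprn_gt0// (lt_le_trans _ N1).
by rewrite -(pmulr_rgt0 _ Nk) (lt_le_trans _ (h_iter k v0))// (lt_le_trans _ h1).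
Qed.

Lemma tail_cap x v : pr P [set w | 1 - v <= m w /\ x < T w] = h v * F x.
Proof.
rewrite (pr_independent mm mT indep_m (A := [set r | 1 - v <= r]) (B := [set t | x < t]))//.
  by rewrite -set_itvcy; exact: measurable_itv.
by rewrite -set_itvoy; exact: measurable_itv.
Qed.

Lemma tail_direction x v : pr P [set w | v < rho w /\ x < T w] = pr P [set w | v < rho w] * F x.
Proof.
rewrite (pr_independent mrho mT indep_rho (A := [set r | v < r]) (B := [set t | x < t]))//.
  by rewrite -set_itvoy; exact: measurable_itv.
by rewrite -set_itvoy; exact: measurable_itv.
Qed.

(** On the event that [m] is within [psi x / x] of [1] and [T] exceeds
    [x + 2 psi x], the product exceeds [x]. *)
Lemma product_tail_ge : exists2 c, 0 < c &
  \forall x \near +oo, c * (h (psi x / x) * F x) <= G x.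
Proof.
pose c : R := expR (- 2) / 2.
have c0 : 0 < c by rewrite divr_gt0// expR_gt0.
exists c => //; near=> x.
have x0 : 0 < x by near: x; exact: nbhs_pinfty_gt.
have px0 := psi0 x0.
have px : psi x <= 4^-1 * x.
  by near: x; case: FG => _ _ _ + _; apply; rewrite invr_gt0.
have u0 : 0 < psi x / x by rewrite divr_gt0.
have u4 : psi x / x <= 4^-1 by rewrite ler_pdivrMr.
have xu : x * (psi x / x) = psi x by rewrite mulrC divfK ?gt_eqF.
have /andP[FF _] : (expR (- 2) - c) * F x < F (x + psi x * 2) < (expR (- 2) + c) * F x.
  by near: x; exact: gumbel_tail_near.
apply: (@le_trans _ _ (h (psi x / x) * F (x + psi x * 2))).
  have -> : c = expR (- 2) - c by rewrite /c; field.
  by rewrite mulrCA ler_wpM2l ?pr_ge0// ltW.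
rewrite -tail_cap; apply: le_pr => //; first exact: mI.
move=> w /= [mw Tw].
set u := psi x / x in u0 u4 xu mw.
have T0 : 0 < T w by lra.
have : T w * (1 - u) <= T w * m w by rewrite ler_pM2l.
by apply: lt_le_trans; nra.
Unshelve. all: by end_near. Qed.

(** The radial part of a large value of [T * rho] is within a multiple of
    [psi x] of [x].  The slices [x + C 4^j psi x < T <= x + C 4^(j+1) psi x]
    force [rho], hence [m], to be within a multiple of [4^j psi x / x] of [1];
    the doubling bound then loses a factor [N] per slice while the tail of [T]
    gains a factor [2 N]. *)
Lemma radial_tightness (B e : R) : 0 <= B -> 0 < e -> exists2 K, 0 < K &
  \forall x \near +oo,
    pr P [set w | x - B * psi x < T w * rho w /\ x + K * psi x < T w] <= e * G x.
Proof.
move=> B0 e0.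
have [c c0 Hc] := product_tail_ge.
have [C C0 HC] := gumbel_tail_decay FG N1.
(* [4 ^ s] absorbs the constants in the size of the caps, and [J] is the slice from
   which the geometric series, of order [2 ^ (- J) * N ^ s], is below [e * c]. *)
have [s sP] := le_natX ((B + 4 * C) / th) (isT : 1 < 4)%N.
have N0 : 0 < N by exact: lt_le_trans N1.
have ec0 : 0 < e * c by rewrite mulr_gt0.
have [J JP] := le_natX (2 * N ^+ s / (e * c)) (isT : 1 < 2)%N.
exists (C * 4 ^+ J); first by rewrite mulr_gt0// exprn_gt0.
near=> x.
have x0 : 0 < x by near: x; exact: nbhs_pinfty_gt.
have px0 := psi0 x0.
have HFx : forall j : nat, F (x + C * 4 ^+ j * psi x) <= (2 * N) ^- j * F x by near: x.
have HGx : c * (h (psi x / x) * F x) <= G x by near: x.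
pose A j := pr P [set w | x - B * psi x < T w * rho w /\ x + C * 4 ^+ j * psi x < T w].
rewrite -/(A J).
set u := psi x / x in HGx.
have u0 : 0 < u by rewrite divr_gt0.
have xu : x * u = psi x by rewrite /u mulrC divfK ?gt_eqF.
pose M := N ^+ s * (h u * F x).
have M0 : 0 <= M by rewrite !mulr_ge0 ?exprn_ge0 ?pr_ge0 ?(ltW N0).
have mA j : measurable [set w | x - B * psi x < T w * rho w /\ x + C * 4 ^+ j * psi x < T w].
  exact: mI.
have slice j : A j <= A j.+1 + 2 ^- j * M.
  have [k kE] : {k | k = C * 4 ^+ j.+1} by exact: (exist _ _ erefl).
  have k0 : 0 < k by rewrite kE mulr_gt0// exprn_gt0.
  pose S := [set w | 1 - (B + k) * u < rho w /\ x + C * 4 ^+ j * psi x < T w].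
  have mS : measurable S by apply: mI => //; exact: mset_lt.
  apply: (@le_trans _ _ (A j.+1 + pr P S)).
    apply: le_trans (prU_le P (mA j.+1) mS); apply: le_pr_ae => //.
      exact: measurableU.
    move: good; apply: filterS => w [T0 /andP[m0 _] mr _] /= [Tr Tj].
    have [Tk|Tk] := ltP (x + k * psi x) (T w); [by left; split=> //=; rewrite -kE|right; split=> //].
    rewrite ltNge; apply/negP => rho_le.
    have r0 : 0 <= rho w by lra.
    have h1 : T w * rho w <= (x + k * psi x) * (1 - (B + k) * u).
      apply: (@le_trans _ _ (T w * (1 - (B + k) * u))); first by rewrite ler_pM2l.
      by rewrite ler_wpM2r// (le_trans r0).
    have := dilated_le xu (ltW px0) (ltW u0) B0 (ltW k0).
    by rewrite leNgt (lt_le_trans Tr).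
  rewrite lerD2l /S tail_direction.
  have hS : pr P [set w | 1 - (B + k) * u < rho w] <= N ^+ (s + j) * h u.
    apply: le_trans (h_iter _ u0); apply: le_pr_ae => //; first exact: mset_lt.
    move: good; apply: filterS => w [_ _ _ rm] /= rw.
    have h1 : 1 - m w <= (B + k) * u / th by rewrite ler_pdivlMr//; lra.
    have h2 : (B + k) / th <= 4 ^+ (s + j).
      have j1 : 1 <= 4 ^+ j :> R by rewrite exprn_ege1// ler1n.
      rewrite exprD; apply: (@le_trans _ _ ((B + 4 * C) / th * 4 ^+ j)).
        rewrite mulrAC ler_pM2r ?invr_gt0// kE exprS; nra.
      by rewrite ler_wpM2r// exprn_ge0.
    have h3 : (B + k) / th * u <= 4 ^+ (s + j) * u by rewrite ler_pM2r.
    rewrite mulrAC in h1; lra.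
  apply: (le_trans (ler_pM (pr_ge0 _ _) (pr_ge0 _ _) hS (HFx j))).
  rewrite le_eqVlt; apply/orP; left; apply/eqP.
  rewrite /M exprMn exprD invfM; field.
  by rewrite !expf_neq0 ?gt_eqF.
have tele k : A J <= A (J + k)%N + (2 * 2 ^- J - 2 * 2 ^- (J + k)) * M.
  elim: k => [|k IH]; first by rewrite addn0 subrr mul0r addr0.
  rewrite (le_trans IH)// addnS; have := slice (J + k)%N.
  have -> : 2 * 2 ^- (J + k).+1 = 2 ^- (J + k) :> R by rewrite exprS invfM mulVKf.
  rewrite !mulrBl -[2 * 2 ^- (J + k) * M]mulrA; move: (2 ^- (J + k) * M) => y; lra.
have AJ : A J <= 2 * 2 ^- J * M.
  apply/ler_addgt0Pr => d d0.
  have [k kP] := le_natX d^-1 (isT : 1 < 2)%N.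
  have kd : 2 ^- k <= d by rewrite -[leRHS]invrK lef_pV2 ?posrE ?invr_gt0// ?exprn_gt0.
  apply: (le_trans (tele k)).
  have h1 : A (J + k)%N <= 2 ^- (J + k).
    apply: (@le_trans _ _ (F (x + C * 4 ^+ (J + k) * psi x))).
      by apply: le_pr => // w /= [].
    apply: (le_trans (HFx _)).
    have F1 : F x <= 1 by exact: pr_le1.
    apply: (@le_trans _ _ ((2 * N) ^- (J + k))).
      by rewrite ler_piMr// invr_ge0 exprn_ge0// mulr_ge0// ltW.
    rewrite lef_pV2 ?posrE ?exprn_gt0 ?mulr_gt0//.
    by rewrite lerXn2r// ?nnegrE ?mulr_ge0 ?(ltW N0)// ler_peMr.
  have h2 : (2 : R) ^- (J + k) <= 2 ^- k.
    by rewrite lef_pV2 ?posrE ?exprn_gt0// ler_eXn2l ?ltr1n// leq_addl.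
  have h3 : 0 <= 2 * 2 ^- (J + k) * M by rewrite mulr_ge0// mulr_ge0// invr_ge0 exprn_ge0.
  rewrite mulrBl; move: (2 * 2 ^- (J + k) * M) (2 * 2 ^- J * M) h3 => y z; lra.
apply: (le_trans AJ).
apply: (@le_trans _ _ (e * (c * (h u * F x)))); last by rewrite ler_pM2l.
rewrite /M !mulrA ler_wpM2r ?pr_ge0// ler_wpM2r ?pr_ge0//.
by move: JP; rewrite ler_pdivrMr// mulrAC ler_pdivrMr ?exprn_gt0// [e * c * _]mulrC.
Unshelve. all: by end_near. Qed.

(** The limit of the ratio [G (x + psi x * z) / G x]: up to [radial_tightness] the
    direction is in the cap where [1 - m] has order [psi x / x], and there, at each
    fixed direction [v], the tails of [T] at [(x + psi x * z) / v] and at [x / v]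
    have ratio close to [expR (- z)]. *)
Lemma product_tail_near z e : 0 < e -> \forall x \near +oo,
  (1 - e) * expR (- z) * G x <= G (x + psi x * z) <= (1 + e) * expR (- z) * G x.
Proof.
move=> e0.
have E0 : 0 < expR (- z) by exact: expR_gt0.
pose e1 := Num.min (e / 2 * expR (- z)) (e / 2).
have e10 : 0 < e1 by rewrite lt_min !mulr_gt0// divr_gt0.
have [e1z e1e] : e1 <= e / 2 * expR (- z) /\ e1 <= e / 2.
  by split; rewrite ge_min lexx ?orbT.
have [K K0 HK] := radial_tightness (normr_ge0 z) e10.
pose k := `|z| + K.
have k0 : 0 < k by rewrite ltr_wpDl.
have e20 : 0 < e / 2 by rewrite divr_gt0.
near=> x.
have x0 : 0 < x by near: x; exact: nbhs_pinfty_gt.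
have px0 := psi0 x0.
have sec : forall v, 1 - k * (psi x / x) <= v <= 1 -> 0 < v /\
    (F ((x + psi x * z) / v) <= (1 + e / 2) * expR (- z) * F (x / v) /\
    F (x / v) <= (1 + e / 2) * expR z * F ((x + psi x * z) / v)).
  by near: x; exact: gumbel_tail_rescale.
have tight : pr P [set w | x - `|z| * psi x < T w * rho w /\ x + K * psi x < T w] <= e1 * G x.
  by near: x.
set u := psi x / x in sec.
have u0 : 0 < u by rewrite divr_gt0.
have xu : x * u = psi x by rewrite /u mulrC divfK ?gt_eqF.
pose D y := pr P [set w | (y < T w * m w) /\ (1 - k * u <= m w /\ m w <= 1)].
have mD y : measurable [set w | (y < T w * m w) /\ (1 - k * u <= m w /\ m w <= 1)].
  by apply: mI => //; apply: mI; exact: mset_le.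
have GD y : x - `|z| * psi x <= y -> G y <= D y + e1 * G x.
  move=> xy; apply: (le_trans _ (lerD (lexx (D y)) tight)).
  have mt : measurable [set w | x - `|z| * psi x < T w * rho w /\ x + K * psi x < T w].
    by apply: mI => //; exact: mset_lt.
  apply: le_trans (prU_le P (mD y) mt); apply: le_pr_ae => //.
    exact: measurableU.
  move: good; apply: filterS => w [T0 /andP[m0 m1] mr _] /= yT.
  have [TK|TK] := ltP (x + K * psi x) (T w).
    right; split=> //; apply: (le_lt_trans xy); apply: (lt_le_trans yT).
    by rewrite ler_pM2l.
  left; split=> //; split=> //; rewrite leNgt; apply/negP => m_lt.
  have h1 : T w * m w <= (x + K * psi x) * (1 - k * u).
    by apply: ler_pM => //; exact: ltW.
  have := dilated_le xu (ltW px0) (ltW u0) (normr_ge0 z) (ltW K0).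
  rewrite -/k leNgt => /negP; apply.
  by apply: (le_lt_trans xy); exact: lt_le_trans h1.
have sections y y' c : 0 <= c ->
    (forall v, 1 - k * u <= v <= 1 -> 0 < v /\ F (y / v) <= c * F (y' / v)) ->
    D y <= c * D y'.
  move=> c0 yy'.
  have mE (t : R) : measurable [set p : R * R | t < p.2 * p.1 /\ (1 - k * u <= p.1 /\ p.1 <= 1)].
    have m1 : measurable [set p : R * R | t < p.2 * p.1].
      by apply: measurable_set_ltr => //; exact: measurable_funM.
    have m2 : measurable [set p : R * R | 1 - k * u <= p.1] by exact: measurable_set_ler.
    have m3 : measurable [set p : R * R | p.1 <= 1] by exact: measurable_set_ler.
    exact: (measurableI _ _ m1 (measurableI _ _ m2 m3)).
  apply: (le_pr_sections mm mT indep_m (mE y) (mE y') c0) => v /=.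
  have [vk|vk] := boolP ((1 - k * u <= v) && (v <= 1)); last first.
    rewrite [X in pr P X <= _](_ : _ = set0); last first.
      by rewrite -subset0 => w [_ [h1 h2]]; move: vk; rewrite h1 h2.
    by rewrite /pr measure0 mulr_ge0// pr_ge0.
  have [v0 Fv] := yy' v vk; case/andP: vk => vk1 vk2.
  have E t : [set w | t < T w * v /\ 1 - k * u <= v /\ v <= 1] = [set w | t / v < T w].
    apply/seteqP; split=> w /=; rewrite ltr_pdivrMr//; first by case.
  by rewrite !E.
have y1 : x - `|z| * psi x <= x by rewrite gerBl mulr_ge0// ltW.
have y2 : x - `|z| * psi x <= x + psi x * z.
  by rewrite lerD2l -lerN2 opprK -mulrN [_ * psi x]mulrC ler_pM2l// -normrN ler_norm.
have c0 a : 0 <= (1 + e / 2) * expR a by rewrite mulr_ge0 ?expR_ge0// addr_ge0// ltW.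
have D1 : D (x + psi x * z) <= (1 + e / 2) * expR (- z) * D x.
  by apply: sections => // v /sec[? []].
have D2 : D x <= (1 + e / 2) * expR z * D (x + psi x * z).
  by apply: sections => // v /sec[? []].
have DG y : D y <= G y by apply: le_pr => // w /= [].
have G0 y : 0 <= G y by exact: pr_ge0.
have H1 := GD _ y1; have H2 := GD _ y2.
by apply: (@tail_ratio_sandwich _ e e1 (expR z) (expR (- z)) (D x) (D (x + psi x * z))); rewrite ?expRxMexpNx_1.
Unshelve. all: by end_near. Qed.

(** The [q]-norm of the product exceeds its maximum norm by a small multiple of
    [psi x] on the event that matters, and a shift of [G] by [- z psi x] costs the
    factor [expR z = 1 + e1] only. *)
Lemma direction_tail_le e : 0 < e ->
  \forall x \near +oo, pr P [set w | x < T w * rho w] <= (1 + e) * G x.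
Proof.
move=> e0; have [e1 e1E] : {e1 | e1 = Num.min 1 e / 4} by exact: (exist _ _ erefl).
have e10 : 0 < e1 by rewrite e1E divr_gt0// lt_min ltr01.
have e11 : 4 * e1 <= 1 by rewrite e1E mulrC divfK// ge_min lexx.
have e1e : 4 * e1 <= e by rewrite e1E mulrC divfK// ge_min lexx orbT.
clear e1E.
have [z zE] : {z | z = ln (1 + e1)} by exact: (exist _ _ erefl).
have z0 : 0 < z by rewrite zE ln_gt0// ltrDl.
have [K K0 HK] := radial_tightness (lexx 0) e10.
have e20 : 0 < z * th / (2 * K) by rewrite divr_gt0 ?mulr_gt0.
have [del del0 Hdel] := vertex e20.
near=> x.
have x0 : 0 < x by near: x; exact: nbhs_pinfty_gt.
have px0 := psi0 x0.
have tight : pr P [set w | x - 0 * psi x < T w * rho w /\ x + K * psi x < T w] <= e1 * G x.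
  by near: x.
have /andP[_ Gz] : (1 - e1) * expR (- - z) * G x <= G (x + psi x * - z) <=
    (1 + e1) * expR (- - z) * G x.
  by near: x; exact: product_tail_near.
rewrite opprK [in expR z]zE lnK ?posrE ?addr_gt0// in Gz; clear zE.
have pK : psi x <= Num.min K^-1 (del * th / K) * x.
  near: x; case: FG => _ _ _ + _; apply.
  by rewrite lt_min invr_gt0 K0/= divr_gt0// mulr_gt0.
have [u uE] : {u | u = psi x / x} by exact: (exist _ _ erefl).
have u0 : 0 < u by rewrite uE divr_gt0.
have xu : x * u = psi x by rewrite uE mulrC divfK ?gt_eqF.
have [uK udel] : u * K <= 1 /\ u * K <= del * th.
  split; rewrite uE -ler_pdivlMr// ler_pdivrMr// (le_trans pK)// ler_pM2r// ge_min.
    by rewrite div1r lexx.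
  by rewrite lexx orbT.
clear uE.
have G0 : 0 <= G x by exact: pr_ge0.
have mt : measurable [set w | x - 0 * psi x < T w * rho w /\ x + K * psi x < T w].
  by apply: mI => //; exact: mset_lt.
apply: (@le_trans _ _ (G (x + psi x * - z) + e1 * G x)); last first.
  rewrite (le_trans (lerD Gz (lexx _)))// -mulrDl ler_wpM2r//.
  exact: square_budget.
apply: (le_trans _ (lerD (lexx _) tight)).
apply: le_trans (prU_le P (mG _) mt); apply: le_pr_ae => //; first exact: measurableU.
move: good Hdel; apply: filterS2 => w [T0 /andP[m0 m1] mr rm] Hv /= xT.
have [TK|TK] := ltP (x + K * psi x) (T w); first by right; rewrite mul0r subr0.
left.
by apply: (@direction_switch _ x (psi x) u K th z del (T w) (rho w) (m w)).
Unshelve. all: by end_near. Qed.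

(** [F] decreases by an arbitrary factor between [x / v] and [c * x] for [v] between
    [c ^ (-1)] and [1], while the directions with [m >= v] have positive
    probability. *)
Lemma tail_rapid_product c e : 1 < c -> 0 < e ->
  \forall x \near +oo, F (c * x) <= e * G x.
Proof.
move=> c1 e0; have c0 : 0 < c by lra.
have [v vE] : {v | v = (1 + c^-1) / 2} by exact: (exist _ _ erefl).
have ci1 : c^-1 < 1 by rewrite invf_lt1.
have ci0 : 0 < c^-1 by rewrite invr_gt0.
have [v0 v1] : 0 < v /\ v < 1 by rewrite vE; split; lra.
have cv : 1 < c * v.
  by rewrite vE mulrA mulrDr mulr1 mulfV ?gt_eqF// ltr_pdivlMr//; lra.
have h0 : 0 < e * h (1 - v) by rewrite mulr_gt0// cap_gt0// subr_gt0.
near=> x.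
have x0 : 0 < x by near: x; exact: nbhs_pinfty_gt.
have : F (c * v * (x / v)) <= e * h (1 - v) * F (x / v).
  have : x <= x / v by rewrite ler_pdivlMr// ler_piMr// ltW.
  move: (x / v).
  by near: x; apply: near_pinfty_upward; exact: (gumbel_tail_rapid FG cv h0).
have -> : c * v * (x / v) = c * x by field; rewrite gt_eqF.
rewrite -mulrA => /le_trans; apply.
rewrite ler_pM2l// -tail_cap; apply: le_pr => //; first exact: mI.
move=> w /= [mw]; rewrite ltr_pdivrMr// => xT; rewrite subKr in mw.
have T0 : 0 <= T w by rewrite -(pmulr_lge0 _ v0) (le_trans (ltW x0))// ltW.
by apply: (lt_le_trans xT); rewrite ler_wpM2l.
Unshelve. all: by end_near. Qed.

End radial_product.

(** * Caps of the sphere under the uniform distribution *)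
Section orthogonal_invariance.
Context {R : realType} {d : nat}.
Implicit Types (p : 'I_d -> R).

Definition dot p (x : d.-tuple R) := \sum_(j < d) p j * tnth x j.

Lemma measurable_dot p : measurable_fun setT (dot p).
Proof.
apply: measurable_sum => j; apply: measurable_funM; first exact: measurable_cst.
exact: measurable_tnth.
Qed.

(** A Householder reflection exchanges a prescribed unit vector with a vector
    of the standard basis. *)
Lemma orthogonal_with_row (i0 : 'I_d) p : \sum_j p j ^+ 2 = 1 ->
  exists Q : 'M[R]_d, Q *m Q^T = 1%:M /\ forall j, Q i0 j = p j.
Proof.
move=> p1; pose s := 1 - p i0.
have [s0|s0] := eqVneq s 0.
  have pi1 : p i0 = 1 by apply/eqP; rewrite eq_sym -subr_eq0 -/s s0.
  exists 1%:M; split; first by rewrite trmx1 mulmx1.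
  move=> j; rewrite mxE; have [<-|ij] := eqVneq i0 j; first by rewrite pi1.
  move: p1; rewrite (bigD1 i0)//= pi1 expr1n => /eqP.
  rewrite -subr_eq0 addrAC subrr add0r psumr_eq0; last by move=> *; exact: sqr_ge0.
  move=> /allP/(_ j (mem_index_enum _)); rewrite eq_sym ij/= sqrf_eq0 => /eqP ->.
  by [].
pose v j : R := (j == i0)%:R - p j.
have vi0 : v i0 = s by rewrite /v eqxx.
have vv : \sum_j v j ^+ 2 = 2 * s.
  have -> : \sum_j v j ^+ 2 = \sum_j ((j == i0)%:R * (1 - 2 * p j) + p j ^+ 2).
    by apply: eq_bigr => j _; rewrite /v; case: (j == i0) => /=; ring.
  rewrite big_split/= p1 (bigD1 i0)//= eqxx big1 => [|j /negPf ->]; last by rewrite mul0r.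
  by rewrite /s mulr1n; ring.
exists (\matrix_(i, j) ((i == j)%:R - v i * v j / s)); split; last first.
  by move=> j; rewrite mxE vi0 mulrAC mulfV// mul1r /v eq_sym subKr.
apply/matrixP => i j; rewrite !mxE.
under eq_bigr => k _ do rewrite !mxE.
have -> : \sum_k ((i == k)%:R - v i * v k / s) * ((j == k)%:R - v j * v k / s) =
  \sum_k ((i == k)%:R * ((j == k)%:R - v j * v k / s) - (j == k)%:R * (v i * v k / s)
    + v i * v j / s ^+ 2 * v k ^+ 2).
  by apply: eq_bigr => k _; field.
rewrite big_split/= -mulr_sumr vv sumrB.
rewrite (bigD1 i)//= eqxx [X in _ + X - _]big1 => [|k]; last first.
  by rewrite eq_sym => /negPf ->; rewrite mul0r.
rewrite (bigD1 j)//= eqxx [X in _ - (_ + X)]big1 => [|k]; last first.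
  by rewrite eq_sym => /negPf ->; rewrite mul0r.
by rewrite [j == i]eq_sym mulr1n; move: (v i) (v j) ((i == j)%:R : R) => a b c; field.
Qed.

Context {dO : measure_display} {O : measurableType dO} {P : probability O R}.
Variable W : {RV P >-> d.-tuple R}.
Hypothesis unifW : uniform_on_sphere W.

Lemma law_dot (i0 : 'I_d) p (B : set R) : \sum_j p j ^+ 2 = 1 -> measurable B ->
  P [set w | B (dot p (W w))] = P [set w | B (tnth (W w) i0)].
Proof.
move=> p1 mB; have [Q [QQ Qp]] := orthogonal_with_row i0 p1.
have mA : measurable [set x : d.-tuple R | B (tnth x i0)].
  by rewrite -[X in measurable X]setTI; exact: measurable_tnth.
have [_ /(_ Q _ QQ mA) <-] := unifW.
congr (P _); apply/seteqP; split => w /=; rewrite tnth_mktuple.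
  by under [in X in _ -> X]eq_bigr do rewrite Qp.
by under [in X in X -> _]eq_bigr do rewrite Qp.
Qed.

Lemma sphere_sqr (x : d.-tuple R) : sphere R d x -> \sum_j tnth x j ^+ 2 = 1.
Proof. by rewrite -qnorm2_sqr /sphere/= => ->; rewrite expr1n. Qed.

Let onsphere : {ae P, forall w, sphere R d (W w)}. Proof. by case: unifW. Qed.

(** Doubling for spherical caps.  The cap of squared radius [8 v] about a pole
    is cut by a grid of mesh [r / d], [r ^+ 2 = 2 v], into a number of cells that
    depends on [d] only; a cell is contained in the cap of squared radius [2 v]
    about any of its points, which is a rotation of the cap about the pole. *)
Lemma cap_doubling (i0 : 'I_d) : exists2 N : R, 1 <= N & forall v, 0 < v ->
  pr P [set w | 1 - 4 * v <= tnth (W w) i0] <= N * pr P [set w | 1 - v <= tnth (W w) i0].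
Proof.
pose cell := {ffun 'I_d -> 'I_(4 * d).+1}.
exists #|cell|%:R.
  by rewrite ler1n; apply/card_gt0P; exists [ffun=> ord0].
move=> v v0.
have mtn i : measurable_fun setT (fun w => tnth (W w) i).
  by apply: (measurableT_comp (measurable_tnth i)).
pose r := Num.sqrt (2 * v).
have r0 : 0 < r by rewrite sqrtr_gt0 mulr_gt0.
have r2 : r ^+ 2 = 2 * v by rewrite sqr_sqrtr// mulr_ge0// ltW.
have d0 : 0 < d%:R :> R by rewrite ltr0n (leq_trans _ (ltn_ord i0)).
pose e j : R := (j == i0)%:R.
(* On the large cap the coordinates of [x - e] lie in [[- 2 r, 2 r]], so [g x j] lies
   in [[0, 4 d]]. *)
pose g (x : d.-tuple R) j := (tnth x j - e j + 2 * r) * (d%:R / r).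
pose kap x : cell := [ffun j => inord (Num.truncn (g x j))].
pose good x := sphere R d x /\ 1 - 4 * v <= tnth x i0.
have e1 : \sum_j e j ^+ 2 = 1.
  rewrite (bigD1 i0)//= /e eqxx expr1n big1 ?addr0// => j /negPf ->.
  by rewrite expr0n.
have g_bd x : good x -> forall j, 0 <= g x j /\ (Num.truncn (g x j) < (4 * d).+1)%N.
  move=> [xS xcap] j.
  have h : (tnth x j - e j) ^+ 2 <= (2 * r) ^+ 2.
    apply: (@le_trans _ _ (\sum_j (tnth x j - e j) ^+ 2)).
      by rewrite (bigD1 j)//= lerDl sumr_ge0// => k _; exact: sqr_ge0.
    have -> : \sum_j (tnth x j - e j) ^+ 2 =
        \sum_j (tnth x j ^+ 2 + e j ^+ 2 - 2 * (e j * tnth x j)).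
      by apply: eq_bigr => k _; ring.
    rewrite sumrB big_split/= sphere_sqr// e1 -mulr_sumr (bigD1 i0)//= {1}/e eqxx mul1r.
    rewrite big1 ?addr0; last by move=> k /negPf ki; rewrite /e ki mul0r.
    by rewrite exprMn r2; lra.
  have : `|tnth x j - e j| <= 2 * r.
    rewrite -(@ler_pXn2r _ 2)// ?nnegrE ?mulr_ge0 ?(ltW r0)//.
    by rewrite -normrX ger0_norm// sqr_ge0.
  rewrite ler_norml => /andP[h1 h2].
  have dr : 0 < d%:R / r by rewrite divr_gt0.
  split; first by rewrite mulr_ge0 ?(ltW dr)//; lra.
  rewrite ltnS truncn_le_nat (@le_lt_trans _ _ ((4 * d)%:R))//; last by rewrite ltr_nat.
  have -> : (4 * d)%:R = (4 * r) * (d%:R / r) :> R.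
    by rewrite natrM; field; rewrite gt_eqF.
  by rewrite ler_pM2r//; lra.
have same_cell x y : good x -> good y -> kap x = kap y ->
    \sum_j (tnth x j - tnth y j) ^+ 2 <= r ^+ 2.
  move=> gx gy /ffunP xy.
  have coord j : (tnth x j - tnth y j) ^+ 2 <= (r / d%:R) ^+ 2.
    have [x0 xd] := g_bd x gx j; have [y0 yd] := g_bd y gy j.
    have := congr1 val (xy j); rewrite !ffunE/= !inordK// => tr.
    have /andP[x1 x2] := truncn_itv x0; have /andP[y1 y2] := truncn_itv y0.
    rewrite tr in x1 x2.
    have h : `|g x j - g y j| < 1.
      rewrite -natr1 in x2; rewrite -natr1 in y2; rewrite ltr_norml.
      rewrite ltrBrDr addrC ltrBlDr (lt_le_trans y2) ?lerD2r//=.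
      by rewrite ltrBlDr (lt_le_trans x2)// addrC lerD2l.
    have -> : tnth x j - tnth y j = (g x j - g y j) * (r / d%:R).
      by rewrite /g; field; rewrite !gt_eqF.
    rewrite exprMn ler_piMl ?sqr_ge0// -(ger0_norm (sqr_ge0 _)) normrX.
    by rewrite expr_le1// ltW.
  apply: (le_trans (ler_sum _ (fun j _ => coord j))).
  rewrite sumr_const card_ord -[leLHS]mulr_natr exprMn exprVn -mulrA ler_piMr ?sqr_ge0//.
  rewrite expr2 invfM -mulrA mulVf ?gt_eqF// mulr1 invf_le1// ler1n.
  by rewrite (leq_trans _ (ltn_ord i0)).
have rep (k : cell) : {p : 'I_d -> R | \sum_j p j ^+ 2 = 1 /\
    forall x, good x -> kap x = k -> 1 - v <= dot p x}.
  apply: cid; have [[y [gy yk]]|no] := pselect (exists y, good y /\ kap y = k).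
    exists (fun j => tnth y j); split; first by apply: sphere_sqr; case: gy.
    move=> x gx xk; have := same_cell x y gx gy (etrans xk (esym yk)).
    have -> : \sum_j (tnth x j - tnth y j) ^+ 2 =
        \sum_j (tnth x j ^+ 2 + tnth y j ^+ 2 - 2 * (tnth y j * tnth x j)).
      by apply: eq_bigr => j _; ring.
    rewrite sumrB big_split/= !sphere_sqr; [|by case: gy|by case: gx].
    by rewrite -mulr_sumr -/(dot _ x) r2; lra.
  by exists e; split=> // x gx xk; exfalso; apply: no; exists x.
pose B k := [set w | 1 - v <= dot (sval (rep k)) (W w)].
have mB k : measurable (B k).
  by apply: measurable_set_ler => //; apply: (measurableT_comp (measurable_dot _)).
have prB k : pr P (B k) = pr P [set w | 1 - v <= tnth (W w) i0].
  rewrite /pr /B; case: (rep k) => p [p1 _] /=.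
  rewrite (law_dot i0 p1 (B := [set t | 1 - v <= t]))//.
  by rewrite -set_itvcy; exact: measurable_itv.
apply: (@le_trans _ _ (\sum_(k <- enum cell) pr P (B k))).
  apply: le_trans (pr_existsin_le P (enum cell) mB).
  apply: le_pr_ae; [exact: measurable_set_ler|exact: measurable_existsin|].
  move: onsphere; apply: filterS => w Ww /= cap; exists (kap (W w)).
    by rewrite mem_enum.
  by rewrite /B/=; case: (rep (kap (W w))) => p [p1 /=]; apply.
under eq_bigr do rewrite prB.
by rewrite big_const_seq count_predT -cardE iter_addr_0 mulr_natl.
Qed.

End orthogonal_invariance.

(** * Tails of the norms and of the coordinates of the product *)
Section limits_at_infinity.
Context {R : realType}.
Implicit Types (f g : R -> R).

Lemma cvg_ratio f g l : (\forall x \near +oo, 0 < g x) ->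
  (forall e, 0 < e -> \forall x \near +oo, (1 - e) * l * g x <= f x <= (1 + e) * l * g x) ->
  0 <= l -> f x / g x @[x --> +oo] --> l.
Proof.
move=> g0 H l0; apply/cvgrPdist_le => e e0.
have l1 : 0 < l + 1 by lra.
have e1 : 0 < e / (l + 1) by rewrite divr_gt0.
have el : e / (l + 1) * l <= e.
  by rewrite mulrAC ler_pdivrMr// ler_pM2l//; lra.
near=> x.
have gx : 0 < g x by near: x.
have : (1 - e / (l + 1)) * l * g x <= f x <= (1 + e / (l + 1)) * l * g x.
  by near: x; exact: H.
move=> /andP[h1 h2]; rewrite -(ler_pdivlMr _ _ gx) in h1; rewrite -(ler_pdivrMr _ _ gx) in h2.
rewrite distrC ler_distl; move: (e / (l + 1)) el h1 h2 => e' el h1 h2.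
by apply/andP; split; lra.
Unshelve. all: by end_near. Qed.

Lemma near_shift (psi : R -> R) (P : R -> Prop) z :
  (forall e, 0 < e -> \forall x \near +oo, psi x <= e * x) ->
  (forall x, 0 < x -> 0 < psi x) ->
  (\forall x \near +oo, P x) -> \forall x \near +oo, P (x + psi x * z).
Proof.
move=> psix psi0 [M [Mr MP]].
have z1 : 0 < 2 * (`|z| + 1) by rewrite mulr_gt0// ltr_wpDl.
near=> x; apply: MP.
have x0 : 0 < x by near: x; exact: nbhs_pinfty_gt.
have x1 : 2 * M < x by near: x; apply: nbhs_pinfty_gt; rewrite realM.
have px : psi x <= (2 * (`|z| + 1))^-1 * x by near: x; apply: psix; rewrite invr_gt0.
have px0 := psi0 x x0.
have : psi x * (2 * (`|z| + 1)) <= x.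
  by rewrite -ler_pdivlMr// mulrC.
have : - (psi x * `|z|) <= psi x * z.
  by rewrite -mulrN ler_pM2l// -[leRHS]opprK lerN2 -normrN ler_norm.
lra.
Unshelve. all: by end_near. Qed.

End limits_at_infinity.

(** The signed coordinates [sgn s * x_i] are indexed by the pairs [(i, s)]. *)
Definition sgn {R : realType} (s : bool) : R := if s then 1 else -1.
Arguments sgn {R} s.

Section law_of_the_product.
#[local] Arguments qnorm : simpl never.
Context {dO : measure_display} {O : measurableType dO} {R : realType}.
Context {P : probability O R} {d : nat} {q : \bar R}.
Variables (T : {RV P >-> R}) (W : {RV P >-> d.-tuple R}) (psi : R -> R).
Variable i0 : 'I_d.
Hypothesis q2 : (2%:E < q)%E.
Hypothesis T0 : {ae P, forall w, 0 < T w}.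
Hypothesis gumbelT : gumbel_domain T psi.
Hypothesis unifW : uniform_on_sphere W.
Hypothesis indepTW : independent2 T W.

Definition product_vector w := tscale (T w) (W w).
Definition nu (A : set (d.-tuple R)) := pr P [set w | A (product_vector w)].

Let F x := pr P [set w | x < T w].
Let G x := pr P [set w | x < T w * qnorm +oo (W w)].
Let N x := nu [set y | x < qnorm q y].

Let q0 : (0 < q)%E. Proof. by apply: lt_trans q2; rewrite lte_fin. Qed.
Let d0 : 0 < d%:R :> R. Proof. by rewrite ltr0n (leq_trans _ (ltn_ord i0)). Qed.
Let mT : measurable_fun setT T. Proof. by []. Qed.
Let mW p : measurable_fun setT (fun w => qnorm p (W w)).
Proof. exact: (measurableT_comp (measurable_qnorm p)). Qed.
Let onsphere : {ae P, forall w, sphere R d (W w)}. Proof. by case: unifW. Qed.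

Lemma measurable_product_vector : measurable_fun setT product_vector.
Proof.
apply/measurable_fun_tnthP => i.
rewrite (_ : _ \o _ = fun w => T w * tnth (W w) i).
  by apply: measurable_funM => //; exact: (measurableT_comp (measurable_tnth i)).
by apply: funext => w /=; rewrite tnth_mktuple.
Qed.

Lemma measurable_preX A : measurable A -> measurable [set w | A (product_vector w)].
Proof.
by move=> mA; rewrite -[X in measurable X]setTI; exact: measurable_product_vector.
Qed.

Lemma radial_gumbel_tail : gumbel_tail F psi.
Proof.
have := gumbel_domain_tail gumbelT; congr (gumbel_tail _ _).
apply: funext => x; rewrite /ccdf /distribution /pushforward /F /pr; congr (fine (P _)).
by apply/seteqP; split => w /=; rewrite in_itv/= andbT.
Qed.
Let FG := radial_gumbel_tail.

Let psi0 x : 0 < x -> 0 < psi x. Proof. by case: FG => _ _ + _ _; apply. Qed.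
Let psix e : 0 < e -> \forall x \near +oo, psi x <= e * x.
Proof. by case: FG => _ _ _ + _; apply. Qed.

Lemma independent_direction (g : d.-tuple R -> R) : measurable_fun setT g ->
  independent_maps P (fun w => g (W w)) T.
Proof.
move=> mg A B mA mB.
have mgA : measurable (g @^-1` A) by rewrite -[X in measurable X]setTI; exact: mg.
rewrite muleC -(indepTW mB mgA); congr (P _).
by apply/seteqP; split => w /= [].
Qed.

Lemma qnorm_product : {ae P, forall w, 0 < T w /\ qnorm 2%:E (product_vector w) = T w /\
  forall p, (0 < p)%E -> qnorm p (product_vector w) = T w * qnorm p (W w)}.
Proof.
move: T0 onsphere; apply: filterS2 => w Tw Sw; split => //; split.
  by rewrite qnormZ ?lte_fin// Sw mulr1 gtr0_norm.
by move=> p p0; rewrite qnormZ// gtr0_norm.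
Qed.

Lemma qnormyE (x : d.-tuple R) : exists i : 'I_d, qnorm +oo x = `|tnth x i|.
Proof.
have [x0|//] := qnormyP x; exists i0; apply/eqP.
by rewrite x0 eq_le normr_ge0/= -x0 tnth_qnorm// ltry.
Qed.

Lemma signed_coordinate (x : R) : exists s, `|x| = sgn s * x.
Proof.
have [x0|x0] := leP 0 x; [exists true|exists false]; rewrite /sgn ?mul1r ?mulN1r//.
  by rewrite ger0_norm.
by rewrite ltr0_norm.
Qed.

Lemma signed_le (x : R) s : sgn s * x <= `|x|.
Proof.
case: s; first by rewrite /sgn mul1r ler_norm.
by rewrite /sgn mulN1r -normrN ler_norm.
Qed.

Let coord_dot (k : 'I_d * bool) (x : d.-tuple R) :
  sgn k.2 * tnth x k.1 = dot (fun j => sgn k.2 * (j == k.1)%:R) x.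
Proof.
rewrite /dot (bigD1 k.1)//= eqxx mulr1 big1 ?addr0// => j /negPf ->.
by rewrite mulr0 mul0r.
Qed.

Let coord_unit (k : 'I_d * bool) : \sum_(j < d) (sgn k.2 * (j == k.1)%:R : R) ^+ 2 = 1.
Proof.
rewrite (bigD1 k.1)//= eqxx mulr1 big1 ?addr0; last first.
  by move=> j /negPf ->; rewrite mulr0 expr0n.
by case: k.2; rewrite /sgn ?expr1n// sqrrN expr1n.
Qed.

Let measurable_coord (k : 'I_d * bool) :
  measurable_fun setT (fun x : d.-tuple R => sgn k.2 * tnth x k.1).
Proof. by apply: measurable_funM; [exact: measurable_cst|exact: measurable_tnth]. Qed.

Lemma law_coord (k : 'I_d * bool) (B : set R) : measurable B ->
  P [set w | B (sgn k.2 * tnth (W w) k.1)] = P [set w | B (tnth (W w) i0)].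
Proof.
move=> mB; rewrite -(law_dot unifW i0 (coord_unit k) mB); congr (P _).
by apply/seteqP; split => w /=; rewrite coord_dot.
Qed.

Let card_signs : size (enum (({: 'I_d * bool}))) = (2 * d)%N.
Proof. by rewrite -cardE card_prod card_ord card_bool mulnC. Qed.

(** The maximum norm is the largest of the [2 d] signed coordinates, all of which
    have the law of the coordinate [i0]. *)
Lemma max_cap_doubling : exists2 M : R, 1 <= M & forall v, 0 < v ->
  pr P [set w | 1 - 4 * v <= qnorm +oo (W w)] <= M * pr P [set w | 1 - v <= qnorm +oo (W w)].
Proof.
have [M M1 HM] := cap_doubling unifW i0.
have mW0 : measurable_fun setT (fun w => tnth (W w) i0).
  exact: (measurableT_comp (measurable_tnth i0)).
exists ((2 * d)%:R * M).
  by rewrite mulr_ege1// ler1n muln_gt0/= (leq_trans _ (ltn_ord i0)).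
move=> v v0.
pose B (k : 'I_d * bool) := [set w | 1 - 4 * v <= sgn k.2 * tnth (W w) k.1].
have mB k : measurable (B k).
  by apply: measurable_set_ler => //; exact: (measurableT_comp (measurable_coord k)).
apply: (@le_trans _ _ (\sum_(k <- enum {: 'I_d * bool}) pr P (B k))).
  apply: le_trans (pr_existsin_le P _ mB).
  apply: le_pr; [exact: measurable_set_ler|exact: measurable_existsin|].
  move=> w /= h; have [i Wi] := qnormyE (W w); have [s Ws] := signed_coordinate (tnth (W w) i).
  by exists (i, s); rewrite ?mem_enum// /B/= -Ws -Wi.
have prB k : pr P (B k) = pr P [set w | 1 - 4 * v <= tnth (W w) i0].
  rewrite /pr /B; congr fine; apply: (law_coord k (B := [set t | 1 - 4 * v <= t])).
  by rewrite -set_itvcy; exact: measurable_itv.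
under eq_bigr do rewrite prB.
rewrite big_const_seq count_predT card_signs iter_addr_0 -[leLHS]mulr_natl -mulrA ler_wpM2l//.
apply: (le_trans (HM v v0)); rewrite ler_wpM2l ?(le_trans _ M1)//.
apply: le_pr; [exact: measurable_set_ler|exact: measurable_set_ler|].
move=> w /= /le_trans; apply; apply: (le_trans (ler_norm _)).
by rewrite tnth_qnorm// ltry.
Qed.

Let th_gap := qnorm_gap (R := R) (d := d) q2.

Let product_good th : (forall x : d.-tuple R,
    qnorm q x <= qnorm 2%:E x - th * (qnorm 2%:E x - qnorm +oo x)) ->
  {ae P, forall w, [/\ 0 < T w, 0 <= qnorm +oo (W w) <= 1, qnorm +oo (W w) <= qnorm q (W w) &
     qnorm q (W w) <= 1 - th * (1 - qnorm +oo (W w))]}.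
Proof.
move=> Hth; move: T0 onsphere; apply: filterS2 => w Tw Sw; split => //.
- by rewrite qnorm_ge0 -Sw qnormy_le_qnorm ?lte_fin.
- exact: qnormy_le_qnorm.
- by have := Hth (W w); rewrite Sw.
Qed.

Let product_vertex e : 0 < e -> exists2 del, 0 < del &
  {ae P, forall w, 1 - qnorm +oo (W w) <= del ->
     qnorm q (W w) <= qnorm +oo (W w) + e * (1 - qnorm +oo (W w))}.
Proof.
move=> e0; have [del del0 Hdel] := qnorm_near_vertex (d := d) q2 e0.
exists del => //; move: onsphere; apply: filterS => w Sw h.
by have := Hdel (W w); rewrite Sw mulr1; apply.
Qed.

Let indep_q := independent_direction (measurable_qnorm q).
Let indep_oo := independent_direction (measurable_qnorm +oo).

Lemma max_norm_tail_gt0 : \forall x \near +oo, 0 < G x.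
Proof.
have [th /andP[th0 _] Hth] := th_gap; have [M M1 HM] := max_cap_doubling.
have good := product_good Hth.
have [c c0 Hc] := product_tail_ge mT (mW +oo) FG indep_oo.
near=> x.
have x0 : 0 < x by near: x; exact: nbhs_pinfty_gt.
have : c * (pr P [set w | 1 - psi x / x <= qnorm +oo (W w)] * F x) <= G x by near: x.
apply: lt_le_trans; rewrite mulr_gt0// mulr_gt0//; last by case: FG.
by apply: (cap_gt0 (mW +oo) M1 good HM); rewrite divr_gt0// psi0.
Unshelve. all: by end_near. Qed.

Lemma max_norm_tail_shift z : G (x + psi x * z) / G x @[x --> +oo] --> expR (- z).
Proof.
have [th /andP[th0 _] Hth] := th_gap; have [M M1 HM] := max_cap_doubling.
have good := product_good Hth.
apply: cvg_ratio; [exact: max_norm_tail_gt0| |exact: expR_ge0].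
move=> e e0.
exact: (product_tail_near mT (mW q) (mW +oo) FG indep_q indep_oo th0 M1 good HM z e0).
Qed.

Lemma nu_qnorm p x : (0 < p)%E ->
  nu [set y | x < qnorm p y] = pr P [set w | x < T w * qnorm p (W w)].
Proof.
move=> p0; have mX : measurable [set w | x < qnorm p (product_vector w)].
  apply: measurable_set_ltr => //; apply: measurableT_comp (measurable_qnorm p) _.
  exact: measurable_product_vector.
have mY : measurable [set w | x < T w * qnorm p (W w)].
  by apply: measurable_set_ltr => //; apply: measurable_funM.
apply/eqP; rewrite eq_le; apply/andP; split; apply: le_pr_ae => //.
  by move: qnorm_product; apply: filterS => w [_ [_ Xp]] /=; rewrite Xp.
by move: qnorm_product; apply: filterS => w [_ [_ Xp]] /=; rewrite Xp.
Qed.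

Lemma nu_qnorm2 x : nu [set y | x < qnorm 2%:E y] = F x.
Proof.
have mX : measurable [set w | x < qnorm 2%:E (product_vector w)].
  apply: measurable_set_ltr => //; apply: measurableT_comp (measurable_qnorm _) _.
  exact: measurable_product_vector.
have mF : measurable [set w | x < T w] by exact: measurable_set_ltr.
apply/eqP; rewrite eq_le; apply/andP; split; apply: le_pr_ae => //.
  by move: qnorm_product; apply: filterS => w [_ [X2 _]] /=; rewrite X2.
by move: qnorm_product; apply: filterS => w [_ [X2 _]] /=; rewrite X2.
Qed.

Lemma measurable_qnorm_gt p x : measurable [set y : d.-tuple R | x < qnorm p y].
Proof. by apply: measurable_set_ltr => //; exact: measurable_qnorm. Qed.

Lemma measurable_coord_gt (k : 'I_d * bool) x :
  measurable [set y : d.-tuple R | x < sgn k.2 * tnth y k.1].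
Proof. exact: measurable_set_ltr. Qed.

Lemma le_nu A B : measurable A -> measurable B -> A `<=` B -> nu A <= nu B.
Proof. by move=> mA mB AB; apply: le_pr => [||w /AB]; try exact: measurable_preX. Qed.

Lemma max_norm_tail_le x : G x <= N x.
Proof.
rewrite /G -nu_qnorm ?ltry//; apply: le_nu; [exact: measurable_qnorm_gt..|].
by move=> y /= /lt_le_trans; apply; exact: qnormy_le_qnorm.
Qed.

Lemma qnorm_tail_equivalent : N x / G x @[x --> +oo] --> (1 : R).
Proof.
have [th /andP[th0 _] Hth] := th_gap; have [M M1 HM] := max_cap_doubling.
apply: cvg_ratio => //; first exact: max_norm_tail_gt0.
move=> e e0; rewrite !mulr1; near=> x; apply/andP; split.
  apply: le_trans (max_norm_tail_le x); rewrite ler_piMl ?pr_ge0//; lra.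
rewrite /N nu_qnorm//; near: x.
exact: (direction_tail_le mT (mW q) (mW +oo) FG indep_q indep_oo th0 M1
  (product_good Hth) product_vertex HM e0).
Unshelve. all: by end_near. Qed.

Lemma nu_qnorm2_small c e : 1 < c -> 0 < e ->
  \forall x \near +oo, nu [set y | c * x < qnorm 2%:E y] <= e * G x.
Proof.
move=> c1 e0; have [th /andP[th0 _] Hth] := th_gap; have [M M1 HM] := max_cap_doubling.
have := tail_rapid_product mT (mW +oo) FG indep_oo M1 (product_good Hth) HM c1 e0.
by apply: filterS => x; rewrite nu_qnorm2.
Qed.

Lemma nu_radial_tight B e : 0 <= B -> 0 < e -> exists2 K, 0 < K & \forall x \near +oo,
  nu [set y | x - B * psi x < qnorm q y /\ x + K * psi x < qnorm 2%:E y] <= e * G x.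
Proof.
move=> B0 e0; have [th /andP[th0 _] Hth] := th_gap; have [M M1 HM] := max_cap_doubling.
have [K K0 HK] := radial_tightness mT (mW q) (mW +oo) FG indep_q indep_oo th0 M1
  (product_good Hth) HM B0 e0.
exists K => //; move: HK; apply: filterS => x; apply: le_trans.
apply: le_pr_ae.
- apply: measurable_preX; apply: measurableI; exact: measurable_qnorm_gt.
- apply: measurableI; apply: measurable_set_ltr => //.
  exact: measurable_funM.
- move: qnorm_product; apply: filterS => w [_ [X2 Xq]] /=.
  by rewrite X2 Xq.
Qed.

Let H x := nu [set y | x < tnth y i0].

Lemma nu_coord (k : 'I_d * bool) x : nu [set y | x < sgn k.2 * tnth y k.1] = H x.
Proof.
have mA : measurable [set p : R * R | x < p.2 * p.1].
  by apply: measurable_set_ltr => //; exact: measurable_funM.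
have mU : measurable_fun setT (fun w => sgn k.2 * tnth (W w) k.1).
  exact: (measurableT_comp (measurable_coord k)).
have mU' : measurable_fun setT (fun w => tnth (W w) i0).
  exact: (measurableT_comp (measurable_tnth i0)).
have := pr_joint_same_law mU mU' mT (independent_direction (measurable_coord k))
  (independent_direction (measurable_tnth i0)) mA (law_coord k).
rewrite /H /nu /pr /= => E; congr fine.
transitivity (P [set w | x < T w * (sgn k.2 * tnth (W w) k.1)]).
  by congr (P _); apply/seteqP; split => w /=; rewrite tnth_mktuple mulrCA.
rewrite E; congr (P _); apply/seteqP; split => w /=; by rewrite tnth_mktuple.
Qed.

Lemma measurable_some_coord (t : 'I_d * bool -> R) :
  measurable [set y : d.-tuple R | exists2 k, k \in enum {: 'I_d * bool} &
    t k < sgn k.2 * tnth y k.1].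
Proof. by apply: measurable_existsin => k; exact: measurable_coord_gt. Qed.

Lemma nu_some_coord_le (t : 'I_d * bool -> R) :
  nu [set y | exists2 k, k \in enum {: 'I_d * bool} & t k < sgn k.2 * tnth y k.1]
    <= \sum_(k <- enum {: 'I_d * bool}) H (t k).
Proof.
apply: (le_trans (pr_existsin_le P _ (fun k => measurable_preX (measurable_coord_gt k (t k))))).
by apply: ler_sum => k _; rewrite -(nu_coord k).
Qed.

(** Two signed coordinates above [s > 0] belong to different axes, so that the
    Euclidean norm exceeds [sqrt 2 * s]; the rational [5 / 4] is below [sqrt 2]. *)
Lemma nu_some_coord_ge (t : 'I_d * bool -> R) s : 0 < s -> (forall k, s <= t k) ->
  \sum_(k <- enum {: 'I_d * bool}) H (t k) <=
  nu [set y | exists2 k, k \in enum {: 'I_d * bool} & t k < sgn k.2 * tnth y k.1]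
    + (2 * d)%:R * nu [set y | 5 / 4 * s < qnorm 2%:E y].
Proof.
move=> s0 st.
have mD : measurable [set w | 5 / 4 * s < qnorm 2%:E (product_vector w)].
  exact: (measurable_preX (measurable_qnorm_gt _ _)).
have := @pr_existsin_ge _ _ _ P _ (enum {: 'I_d * bool}) _ _
  (fun k => measurable_preX (measurable_coord_gt k (t k))) mD (enum_uniq _).
rewrite card_signs => H'; under eq_bigr => k _ do rewrite -(nu_coord k).
apply: H' => k l kl w /=; move: (product_vector w) => y [yk yl].
have {}yk : s < sgn k.2 * tnth y k.1 by exact: le_lt_trans yk.
have {}yl : s < sgn l.2 * tnth y l.1 by exact: le_lt_trans yl.
have kl1 : k.1 != l.1.
  apply: contraNneq kl; case: k l yk yl => [i b] [j c] /= yk yl ij; rewrite -ij in yl *.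
  apply/eqP; congr pair; apply/eqP; apply/negPn/negP => bc.
  by move: yk yl bc; case: b; case: c => //; rewrite /sgn mul1r mulN1r; lra.
have sq k' : s < sgn k'.2 * tnth y k'.1 -> s ^+ 2 <= tnth y k'.1 ^+ 2.
  move=> h; have -> : tnth y k'.1 ^+ 2 = (sgn k'.2 * tnth y k'.1) ^+ 2.
    by rewrite exprMn; case: k'.2; rewrite /sgn ?expr1n ?sqrrN ?expr1n mul1r.
  by rewrite lerXn2r// ?nnegrE ?(ltW s0)// ltW// (lt_trans s0).
have sum2 : s ^+ 2 + s ^+ 2 <= qnorm 2%:E y ^+ 2.
  rewrite qnorm2_sqr (bigD1 k.1)//= (bigD1 l.1) ?[l.1 == _]eq_sym//= addrA.
  rewrite (le_trans (lerD (sq _ yk) (sq _ yl)))// lerDl sumr_ge0// => j _.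
  exact: sqr_ge0.
rewrite ltNge; apply/negP => yle.
have : qnorm 2%:E y ^+ 2 <= (5 / 4 * s) ^+ 2.
  by rewrite lerXn2r// nnegrE ?qnorm_ge0// mulr_ge0 ?(ltW s0)// divr_ge0.
have : 0 < s ^+ 2 by rewrite exprn_gt0.
rewrite exprMn; move: (qnorm 2%:E y ^+ 2) (s ^+ 2) sum2 => a b; lra.
Qed.

(** The maximum norm exceeds [x] when one of the [2 d] signed coordinates does, and
    two of them exceed [x] with negligible probability. *)
Lemma coord_tail_equivalent : H x / G x @[x --> +oo] --> ((2 * d%:R)^-1 : R).
Proof.
have dd : 0 < 2 * d%:R :> R by rewrite mulr_gt0.
apply: cvg_ratio; [exact: max_norm_tail_gt0| |by rewrite invr_ge0 ltW].
move=> e e0.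
have sumH x : \sum_(k <- enum {: 'I_d * bool}) H x = 2 * d%:R * H x.
  by rewrite big_const_seq count_predT card_signs iter_addr_0 -[LHS]mulr_natl natrM.
have GE x : 0 <= x -> G x =
      nu [set y | exists2 k, k \in enum {: 'I_d * bool} & x < sgn k.2 * tnth y k.1].
  move=> x0; rewrite /G -nu_qnorm ?ltry//; congr nu.
  apply/seteqP; split => y /=.
    have [i ->] := qnormyE y; have [s ->] := signed_coordinate (tnth y i) => xi.
    by exists (i, s) => //; rewrite mem_enum.
  by move=> [k _ /lt_le_trans]; apply; rewrite (le_trans (signed_le _ _))// tnth_qnorm// ltry.
have e1 : 0 < e / (2 * d%:R) by rewrite divr_gt0.
near=> x.
have x0 : 0 < x by near: x; exact: nbhs_pinfty_gt.
have small : nu [set y | 5 / 4 * x < qnorm 2%:E y] <= e / (2 * d%:R) * G x.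
  by near: x; apply: nu_qnorm2_small => //; lra.
have := nu_some_coord_le (fun=> x); have := nu_some_coord_ge x0 (fun=> lexx x).
rewrite sumH -GE ?(ltW x0)// natrM => h1 h2.
have h3 : 2 * d%:R * nu [set y | 5 / 4 * x < qnorm 2%:E y] <= e * G x.
  by rewrite -ler_pdivlMl// mulrA [_^-1 * _]mulrC.
rewrite -!mulrA ![_^-1 * _]mulrC !mulrA ler_pdivrMr// ler_pdivlMr// [H x * _]mulrC.
by apply/andP; split; lra.
Unshelve. all: by end_near. Qed.

End law_of_the_product.

(** * The normalizing sequence *)
Lemma cvg_mul_near {R : realType} (I : Type) (D : set_system I) (FD : Filter D)
    (f g h : I -> R) (l1 l2 : R) :
  f i @[i --> D] --> l1 -> g i @[i --> D] --> l2 ->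
  (\forall i \near D, h i = f i * g i) -> h i @[i --> D] --> l1 * l2.
Proof.
move=> fl gl fgh; have : (fun i => f i * g i) @ D --> l1 * l2 by exact: cvgM.
apply: cvg_trans; apply: near_eq_cvg.
by move: fgh; apply: filterS => i ->.
Qed.

Section normalizing_sequence.
Context {R : realType}.
Variables (psi N G : R -> R).
Hypothesis psi0 : forall x, 0 < x -> 0 < psi x.
Hypothesis psix : forall e, 0 < e -> \forall x \near +oo, psi x <= e * x.
Hypothesis N_le : {homo N : x y /~ x <= y}.
Hypothesis N0 : forall e, 0 < e -> exists x, N x <= e.
Hypothesis G0 : \forall x \near +oo, 0 < G x.
Hypothesis Gshift : forall z, G (x + psi x * z) / G x @[x --> +oo] --> expR (- z).
Hypothesis NG : N x / G x @[x --> +oo] --> (1 : R).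

Definition tail_quantile (n : nat) : R := inf [set x | N x <= n%:R^-1].
Local Notation a := tail_quantile.

Lemma tail_gt0 x : 0 < N x.
Proof.
have [M [Mr HM]] : \forall y \near +oo, 0 < N y.
  near=> y.
  have Gy : 0 < G y by near: y.
  have : (1 / 2 : R) < N y / G y.
    by near: y; apply: (cvgr_gt _ NG); lra.
  by rewrite ltr_pdivlMr// ; apply: lt_trans; rewrite mulr_gt0.
have /HM : M < Num.max x (M + 1) by rewrite lt_max ltrDl ltr01 orbT.
by move=> /lt_le_trans; apply; apply: N_le; rewrite le_max lexx.
Unshelve. all: by end_near. Qed.

Lemma cvg_pinfty_shift z : (x + psi x * z) @[x --> +oo] --> +oo.
Proof.
apply/cvgryPge => A.
by apply: (@near_shift R psi (fun y => A <= y)) => //; exact: nbhs_pinfty_ge (num_real A).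
Qed.

Lemma tail_quantile_set_nonempty n : (0 < n)%N -> [set x | N x <= n%:R^-1] !=set0.
Proof.
move=> n0; have n0' : 0 < n%:R^-1 :> R by rewrite invr_gt0 ltr0n.
by have [x Nx] := N0 n0'; exists x.
Qed.

Lemma tail_quantile_lb M n : n%:R^-1 < N M -> lbound [set x | N x <= n%:R^-1] M.
Proof.
move=> NM x /= Nx; rewrite leNgt; apply/negP => /ltW/N_le.
by rewrite leNgt (le_lt_trans Nx).
Qed.

Lemma near_inv_lt e : 0 < e -> \forall n \near \oo, (n%:R^-1 : R) < e.
Proof.
move=> e0; near=> n.
have n0 : (0 < n)%N by near: n; exact: nbhs_infty_gt.
rewrite -[ltRHS]invrK ltf_pV2 ?posrE ?invr_gt0 ?ltr0n//.
by near: n; exact: nbhs_infty_gtr.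
Unshelve. all: by end_near. Qed.

Lemma cvg_tail_quantile : a n @[n --> \oo] --> +oo.
Proof.
apply/cvgryPge => M; near=> n.
have n0 : (0 < n)%N by near: n; exact: nbhs_infty_gt.
apply: lb_le_inf; first exact: tail_quantile_set_nonempty.
by apply: tail_quantile_lb; near: n; apply: near_inv_lt; exact: tail_gt0.
Unshelve. all: by end_near. Qed.

Let GN : G x / N x @[x --> +oo] --> (1 : R).
Proof.
rewrite (_ : (fun x => _) = fun x => (N x / G x)^-1); last first.
  by apply: funext => x; rewrite invf_div.
by rewrite -invr1; apply: cvgV => //; exact: oner_neq0.
Qed.

Lemma tail_shift z : N (x + psi x * z) / N x @[x --> +oo] --> expR (- z).
Proof.
have NGz : N (x + psi x * z) / G (x + psi x * z) @[x --> +oo] --> (1 : R).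
  exact: (cvg_comp _ _ (@cvg_pinfty_shift z) NG).
have NGG : N (x + psi x * z) / G x @[x --> +oo] --> 1 * expR (- z).
  apply: (cvg_mul_near _ NGz (@Gshift z)); near=> x.
  have Gx : 0 < G x by near: x.
  have Gxz : 0 < G (x + psi x * z).
    by near: x; apply: (@near_shift R psi (fun y => 0 < G y)).
  by field; rewrite !gt_eqF.
have : N (x + psi x * z) / N x @[x --> +oo] --> 1 * expR (- z) * 1.
  apply: (cvg_mul_near _ NGG GN); near=> x.
  have Gx : 0 < G x by near: x.
  by have Nx := tail_gt0 x; field; rewrite !gt_eqF.
by rewrite mulr1 mul1r.
Unshelve. all: by end_near. Qed.

(** Shifting the quantile by [psi] times a small constant brackets the exact
    level [1 / n] between two values of [N]. *)
Lemma cvg_N_tail_quantile : n%:R * N (a n) @[n --> \oo] --> (1 : R).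
Proof.
apply/cvgrPdist_le => e e0.
pose z := ln (1 + e / 2).
have e20 : 0 < 1 + e / 2 by lra.
have z0 : 0 < z by rewrite ln_gt0//; lra.
have Ez : expR z = 1 + e / 2 by rewrite lnK.
have ENz : 1 - e < expR (- z).
  rewrite expRN Ez -[ltRHS]div1r ltr_pdivlMr//; nra.
have shift y : N (a n) / N (a n + psi (a n) * y) @[n --> \oo] --> expR y.
  rewrite (_ : (fun n => _) = fun n => (N (a n + psi (a n) * y) / N (a n))^-1); last first.
    by apply: funext => n; rewrite invf_div.
  rewrite -[y in expR y]opprK [expR (- - y)]expRN; apply: cvgV; first by rewrite gt_eqF ?expR_gt0.
  exact: (cvg_comp _ _ cvg_tail_quantile (@tail_shift y)).
near=> n.
have n0 : (0 < n)%N by near: n; exact: nbhs_infty_gt.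
have a0 : 0 < a n by near: n; move/cvgryPgt : cvg_tail_quantile; apply.
have n0R : 0 < n%:R :> R by rewrite ltr0n.
have nonempty := tail_quantile_set_nonempty n0.
have lb : has_lbound [set x | N x <= n%:R^-1].
  by exists 0; apply: tail_quantile_lb; near: n; apply: near_inv_lt; exact: tail_gt0.
have pz : 0 < psi (a n) * z by rewrite mulr_gt0// psi0.
have Nup : n%:R * N (a n + psi (a n) * z) <= 1.
  have [x /= Nx xa] := inf_adherent pz (conj nonempty lb).
  by rewrite mulrC -ler_pdivlMr// div1r (le_trans _ Nx)// N_le// ltW.
have Nlow : 1 <= n%:R * N (a n + psi (a n) * - z).
  rewrite mulrC -ler_pdivrMr// div1r leNgt; apply/negP => /ltW Nx.
  have := ge_inf lb Nx; rewrite -/(a n) mulrN; lra.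
have U : N (a n) / N (a n + psi (a n) * z) <= 1 + e.
  near: n; apply: (cvgr_le _ (shift z)); rewrite Ez; lra.
have L : 1 - e <= N (a n) / N (a n + psi (a n) * - z).
  by near: n; apply: (cvgr_ge _ (shift (- z))).
rewrite ler_pdivrMr ?tail_gt0// in U; rewrite ler_pdivlMr ?tail_gt0// in L.
have Na := tail_gt0 (a n); have N1 := tail_gt0 (a n + psi (a n) * z).
have N2 := tail_gt0 (a n + psi (a n) * - z).
rewrite distrC ler_distl; apply/andP; split.
  have h1 : (1 - e) * (n%:R * N (a n + psi (a n) * - z)) <= n%:R * N (a n).
    by rewrite mulrCA ler_pM2l.
  have [e1|e1] := leP e 1; last by rewrite (@le_trans _ _ 0) ?mulr_ge0// ?ltW//; lra.
  by apply: le_trans h1; rewrite ler_peMr//; lra.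
have h1 : n%:R * N (a n) <= (1 + e) * (n%:R * N (a n + psi (a n) * z)).
  by rewrite mulrCA ler_pM2l.
by apply: (le_trans h1); rewrite ler_piMr//; lra.
Unshelve. all: by end_near. Qed.

(** Any function equivalent to a multiple of [G] inherits the exponential limit of
    [G], and the equivalence of [N] with [G] fixes the scale [1 / n]. *)
Lemma cvg_tail_quantile_shift (f : R -> R) l z :
  f x / G x @[x --> +oo] --> (l : R) ->
  n%:R * f (a n + psi (a n) * z) @[n --> \oo] --> l * expR (- z).
Proof.
move=> fG.
have fz : f (x + psi x * z) / G (x + psi x * z) @[x --> +oo] --> l.
  exact: (cvg_comp _ _ (@cvg_pinfty_shift z) fG).
have H : f (x + psi x * z) / G x @[x --> +oo] --> l * expR (- z).
  apply: (cvg_mul_near _ fz (@Gshift z)); near=> x.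
  have Gx : 0 < G x by near: x.
  have Gxz : 0 < G (x + psi x * z).
    by near: x; apply: (@near_shift R psi (fun y => 0 < G y)).
  by field; rewrite !gt_eqF.
have H' : f (x + psi x * z) / N x @[x --> +oo] --> l * expR (- z) * 1.
  apply: (cvg_mul_near _ H GN); near=> x.
  have Gx : 0 < G x by near: x.
  by have Nx := tail_gt0 x; field; rewrite !gt_eqF.
rewrite mulr1 in H'.
have Ha := cvg_comp _ _ cvg_tail_quantile H'.
have : n%:R * f (a n + psi (a n) * z) @[n --> \oo] --> l * expR (- z) * 1.
  apply: (cvg_mul_near _ Ha cvg_N_tail_quantile); near=> n => /=.
  by have Nx := tail_gt0 (a n); field; rewrite !gt_eqF.
by rewrite mulr1.
Unshelve. all: by end_near. Qed.

End normalizing_sequence.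

(** * Maxima over the sample *)

(** From [expR (- (p / (1 - p))) <= 1 - p <= expR (- p)]. *)
Lemma cvg_pow_expR {R : realType} (p : nat -> R) (l : R) : (forall n, 0 <= p n) ->
  n%:R * p n @[n --> \oo] --> l -> (1 - p n) ^+ n @[n --> \oo] --> expR (- l).
Proof.
move=> p0 pl.
have pc : p n @[n --> \oo] --> (0 : R).
  have : (n%:R^-1 : R) @[n --> \oo] --> (0 : R).
    apply/cvgrPdist_lt => e e0; have := near_inv_lt e0; apply: filterS => n.
    by rewrite sub0r normrN ger0_norm// invr_ge0.
  move=> i0; rewrite -(mul0r l); apply: (cvg_mul_near _ i0 pl).
  near=> n; rewrite mulrA mulVf ?mul1r// pnatr_eq0 -lt0n.
  by near: n; exact: nbhs_infty_gt.
have q1 : (1 - p n)^-1 @[n --> \oo] --> (1 : R).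
  have : (1 - p n) @[n --> \oo] --> (1 - 0 : R) by apply: cvgB => //; exact: cvg_cst.
  rewrite subr0 => h.
  have : (1 - p n)^-1 @[n --> \oo] --> (1^-1 : R) by apply: cvgV => //; exact: oner_neq0.
  by rewrite invr1.
have up : expR (- (n%:R * p n)) @[n --> \oo] --> expR (- l).
  apply: (cvg_comp _ _ (cvgN pl)); exact: continuous_expR.
have low : expR (- (n%:R * p n * (1 - p n)^-1)) @[n --> \oo] --> expR (- l).
  have h : n%:R * p n * (1 - p n)^-1 @[n --> \oo] --> l * 1.
    by apply: (cvg_mul_near _ pl q1); exact: nearW.
  rewrite mulr1 in h; apply: (cvg_comp _ _ (cvgN h)); exact: continuous_expR.
apply: (squeeze_cvgr _ low up); near=> n.
have p1 : p n < 1 by near: n; apply: (cvgr_lt _ pc).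
have s0 : 0 < 1 - p n by rewrite subr_gt0.
have E x : expR (- (n%:R * x)) = expR (- x) ^+ n by rewrite -mulrN expRM_natl.
rewrite -mulrA !E; apply/andP; split.
  rewrite lerXn2r// ?nnegrE ?expR_ge0 ?(ltW s0)//.
  rewrite expRN -[leRHS]invrK lef_pV2 ?posrE ?invr_gt0 ?expR_gt0//.
  apply: le_trans (expR_ge1Dx _); rewrite le_eqVlt; apply/orP; left; apply/eqP.
  by field; rewrite gt_eqF.
rewrite lerXn2r// ?nnegrE ?expR_ge0 ?(ltW s0)//.
exact: expR_ge1Dx.
Unshelve. all: by end_near. Qed.

(** [S] and [m] are the Euclidean and the maximum norm of a difference of two
    points, [r] its [q]-norm: [r > 2 a - B b] and [S <= 2 (a + K b)] leave
    [th * (S - m) <= (2 K + B) b]. *)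
Lemma near_axis_arith {R : realType} (a b B K e th k del m S r x2 y2 xq yq : R) :
  0 < b -> 0 < th -> 0 < k -> 0 < e -> 0 < del -> k = (2 * K + B) / th -> B * b <= a ->
  k * b <= del * a ->
  xq <= a + b * B -> yq <= a + b * B ->
  (a - 2 * B * b < xq -> x2 <= a + K * b) -> (a - 2 * B * b < yq -> y2 <= a + K * b) ->
  2 * a - B * b < r -> r <= xq + yq -> S <= x2 + y2 -> m <= S ->
  r <= S - th * (S - m) -> (S - m <= del * S -> r <= m + e / k * (S - m)) ->
  r <= m + e * b.
Proof.
move=> bn th0 k0 e0 del0 kE bB bk Hxq Hyq Hx2 Hy2 xy tri tri2 mS gap near_v.
have {Hx2} x2b := Hx2 ltac:(lra); have {Hy2} y2b := Hy2 ltac:(lra).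
have Sm : S - m <= k * b.
  by rewrite kE mulrAC ler_pdivlMr// mulrC; lra.
have rS : r <= S.
  have : 0 <= th * (S - m) by rewrite mulr_ge0 ?subr_ge0// ltW.
  by lra.
have aS : a <= S by lra.
apply: (le_trans (near_v _)).
  by apply: (le_trans Sm); apply: (le_trans bk); rewrite ler_pM2l.
rewrite lerD2l; apply: (@le_trans _ _ (e / k * (k * b))).
  by rewrite ler_pM2l// divr_gt0.
by rewrite mulrA divfK// gt_eqF.
Qed.

Section sample_maxima.
#[local] Arguments qnorm : simpl never.
Context {dO : measure_display} {O : measurableType dO} {R : realType}.
Context {P : probability O R} {d : nat} {q : \bar R}.
Variables (X : nat -> {RV P >-> d.-tuple R}) (nu : set (d.-tuple R) -> R).
Variables (i0 : 'I_d) (a b : nat -> R).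
Local Notation I := ('I_d * bool)%type.
Hypothesis q2 : (2%:E < q)%E.
Hypothesis nu_ge0 : forall A, 0 <= nu A.
Hypothesis lawX : forall i A, measurable A -> pr P [set w | A (X i w)] = nu A.
Hypothesis indepX : mutually_independent X.
Hypothesis b0 : \forall n \near \oo, 0 < b n.
Hypothesis ba : forall e, 0 < e -> \forall n \near \oo, b n <= e * a n.
Hypothesis nu_coords : forall t : I -> R,
  n%:R * nu [set y | exists2 k, k \in enum {: I} & a n + b n * t k < sgn k.2 * tnth y k.1]
    @[n --> \oo] --> \sum_(k <- enum {: I}) (2 * d%:R)^-1 * expR (- t k).
Hypothesis nu_norm : forall z,
  n%:R * nu [set y | a n + b n * z < qnorm q y] @[n --> \oo] --> expR (- z).
Hypothesis nu_tight : forall B e, 0 <= B -> 0 < e -> exists2 K, 0 < K & \forall n \near \oo,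
  n%:R * nu [set y | a n - B * b n < qnorm q y /\ a n + K * b n < qnorm 2%:E y] <= e.

Definition coord (k : I) n w := sgn k.2 * tnth (X n w) k.1.

Definition coord_max (k : I) n w := \big[Num.max/coord k 0 w]_(i < n) coord k i w.

Definition axis_max n w :=
  \big[Num.max/coord_max (i0, true) n w + coord_max (i0, false) n w]_(i < d)
  (coord_max (i, true) n w + coord_max (i, false) n w).

Let mX n : measurable_fun setT (X n). Proof. by []. Qed.

Lemma measurable_coord k n : measurable_fun setT (coord k n).
Proof.
apply: measurable_funM; first exact: measurable_cst.
exact: (measurableT_comp (measurable_tnth k.1)).
Qed.

Lemma measurable_coord_max k n : measurable_fun setT (coord_max k n).
Proof. by apply: measurable_bigmax => [|i]; exact: measurable_coord. Qed.

Lemma coord_max_le k n w t : (0 < n)%N ->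
  coord_max k n w <= t <-> forall i, (i < n)%N -> coord k i w <= t.
Proof.
case: n => // n _; split=> [h i il|h].
  apply: le_trans h; exact: (le_bigmax _ (fun i : 'I_n.+1 => coord k i w) (Ordinal il)).
by apply: bigmax_le => [|i _]; exact: h.
Qed.

Lemma coord_maxP k n w : (0 < n)%N -> exists2 i, (i < n)%N & coord_max k n w = coord k i w.
Proof.
case: n => // n _; rewrite /coord_max; elim/big_ind: _ => [|x y [i il ->] [j jl ->]|i _].
- by exists 0%N.
- by rewrite /Num.max; case: ifP => _; [exists j|exists i].
- by exists i.
Qed.

Lemma axis_le n w (i : 'I_d) : coord_max (i, true) n w + coord_max (i, false) n w <= axis_max n w.
Proof. exact: (le_bigmax _ (fun i => coord_max (i, true) n w + coord_max (i, false) n w)). Qed.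

Lemma axis_maxP n w : exists i, axis_max n w = coord_max (i, true) n w + coord_max (i, false) n w.
Proof.
rewrite /axis_max; elim/big_ind: _ => [|x y [i ->] [j ->]|i _].
- by exists i0.
- by rewrite /Num.max; case: ifP => _; [exists j|exists i].
- by exists i.
Qed.

(** By independence the probability is [(1 - p) ^+ n], where [n * p] converges to
    the sum of the exponents. *)
Lemma cvg_joint_max (t : I -> R) :
  pr P [set w | forall k, (coord_max k n w - a n) / b n <= t k] @[n --> \oo] -->
    \prod_(k <- enum {: I}) expR (- ((2 * d%:R)^-1 * expR (- t k))).
Proof.
pose A n := [set y : d.-tuple R |
  exists2 k, k \in enum {: I} & a n + b n * t k < sgn k.2 * tnth y k.1].
have mA n : measurable (A n) by exact: measurable_some_coord.
rewrite -expR_sum sumrN.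
have := cvg_pow_expR (fun n => nu_ge0 (A n)) (@nu_coords t).
apply: cvg_trans; apply: near_eq_cvg; near=> n.
have n0 : (0 < n)%N by near: n; exact: nbhs_infty_gt.
have bn : 0 < b n by near: n.
have -> : [set w | forall k, (coord_max k n w - a n) / b n <= t k] =
    [set w | forall i, i \in iota 0 n -> (~` A n) (X i w)].
  apply/seteqP; split => w /= h.
    move=> i; rewrite mem_iota/= add0n => il [k _]; apply/negP; rewrite -leNgt.
    have := h k; rewrite ler_pdivrMr// lerBlDl [t k * _]mulrC => hk.
    by have [/(_ hk) + _] := coord_max_le k w (a n + b n * t k) n0; apply.
  move=> k; rewrite ler_pdivrMr// lerBlDl [t k * _]mulrC; apply/coord_max_le => // i il.
  rewrite leNgt; apply/negP => hk; apply: (h i); first by rewrite mem_iota.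
  by exists k; rewrite ?mem_enum.
rewrite /pr (indepX (B := fun=> ~` A n) (iota_uniq 0 n))//; last by move=> i; exact: measurableC.
rewrite (eq_bigr (fun=> ((1 - nu (A n))%:E))); last first.
  move=> i _; have mXA : measurable [set w | A n (X i w)].
    by rewrite -[X in measurable X]setTI; exact: mX.
  have := prC P mXA; rewrite lawX// => <-; rewrite -prE//; exact: measurableC.
by rewrite prodEFin/= big_const_seq count_predT size_iota iter_mulr_1.
Unshelve. all: by end_near. Qed.

Definition diameter n w := max_interpoint q n (fun i => X i w).

(** The maximum of [x_i^k - x_j^k] over all pairs is the sum of the maxima of the
    two signed coordinates, and it is at most the diameter. *)
Lemma axis_max_le_diameter n w : (0 < n)%N -> axis_max n w <= diameter n w.
Proof.
move=> n0; have [k ->] := axis_maxP n w.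
have [i il ->] := coord_maxP (k, true) w n0; have [j jl ->] := coord_maxP (k, false) w n0.
rewrite /coord /sgn /= mul1r mulN1r.
have [ij|ij|ij] := ltngtP i j.
- apply: (@le_trans _ _ (qnorm q (tsub (X i w) (X j w)))).
    have := @tnth_qnorm _ _ q (tsub (X i w) (X j w)) k; rewrite tnth_mktuple.
    move=> h; apply: (le_trans (ler_norm _)); apply: h.
    by apply: lt_trans q2; rewrite lte_fin.
  exact: (bigmax_sup (Ordinal il, Ordinal jl)).
- apply: (@le_trans _ _ (qnorm q (tsub (X j w) (X i w)))).
    have := @tnth_qnorm _ _ q (tsub (X j w) (X i w)) k; rewrite tnth_mktuple distrC.
    move=> h; apply: (le_trans (ler_norm _)); apply: h.
    by apply: lt_trans q2; rewrite lte_fin.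
  exact: (bigmax_sup (Ordinal jl, Ordinal il)).
- by rewrite ij subrr; exact: bigmax_ge_id.
Qed.

Let q1 : (1 <= q)%E.
Proof. by apply: ltW; apply: lt_trans q2; rewrite lte_fin ltr1n. Qed.

(** Two points whose [q]-norms are at most [a + B b] and whose [q]-distance is
    nearly [2 a] have a difference whose Euclidean norm and [q]-norm agree up to a
    multiple of [b]; such a difference is close to a coordinate axis, where the
    [q]-norm and the maximum norm agree up to a small multiple of [b]. *)
Lemma pair_near_axis B K e : 0 < B -> 0 < K -> 0 < e -> \forall n \near \oo,
  forall x y : d.-tuple R, qnorm q x <= a n + b n * B -> qnorm q y <= a n + b n * B ->
    (a n - 2 * B * b n < qnorm q x -> qnorm 2%:E x <= a n + K * b n) ->
    (a n - 2 * B * b n < qnorm q y -> qnorm 2%:E y <= a n + K * b n) ->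
  2 * a n - B * b n < qnorm q (tsub x y) ->
  qnorm q (tsub x y) <= qnorm +oo (tsub x y) + e * b n.
Proof.
move=> B0 K0 e0.
have [th /andP[th0 _] Hth] := qnorm_gap (d := d) q2.
have [k kE] : {k | k = (2 * K + B) / th} by exact: (exist _ _ erefl).
have k0 : 0 < k by rewrite kE divr_gt0// addr_gt0// mulr_gt0.
have ek : 0 < e / k by rewrite divr_gt0.
have [del del0 Hdel] := qnorm_near_vertex (d := d) q2 ek.
have dk : 0 < del / k by rewrite divr_gt0.
have iB : 0 < B^-1 by rewrite invr_gt0.
near=> n => x y xq yq x2 y2 xy.
have bn : 0 < b n by near: n.
have b1 : b n <= del / k * a n by near: n; exact: ba.
have b2 : b n <= B^-1 * a n by near: n; exact: ba.
have bB : B * b n <= a n by rewrite -ler_pdivlMl.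
have bk : k * b n <= del * a n by rewrite -ler_pdivlMl// mulrA [_^-1 * _]mulrC.
have moo : qnorm +oo (tsub x y) <= qnorm 2%:E (tsub x y).
  by apply: qnormy_le_qnorm; rewrite lte_fin.
have two1 : (1 <= 2%:E :> \bar R)%E by rewrite lee_fin ler1n.
by apply: (@near_axis_arith _ (a n) (b n) B K e th k del) xq yq x2 y2 xy
  (le_qnormB x y q1) (le_qnormB x y two1) moo (Hth _) (Hdel _).
Unshelve. all: by end_near. Qed.

Lemma diameterP n w : diameter n w = 0 \/ exists i j, [/\ (i < n)%N, (j < n)%N &
  diameter n w = qnorm q (tsub (X i w) (X j w))].
Proof.
rewrite /diameter /max_interpoint; elim/big_ind: _ => [|x y Hx Hy|[i j] _]; first by left.
  by rewrite /Num.max; case: ifP.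
by right; exists i, j.
Qed.

Lemma measurable_diameter n : measurable_fun setT (diameter n).
Proof.
apply: measurable_bigmax => [|[i j] /=]; first exact: measurable_cst.
apply: (measurableT_comp (measurable_qnorm q)).
apply/measurable_fun_tnthP => k.
rewrite (_ : _ \o _ = fun w => tnth (X i w) k - tnth (X j w) k).
  by apply: measurable_funB; exact: (measurableT_comp (measurable_tnth k)).
by apply: funext => w /=; rewrite tnth_mktuple.
Qed.

Lemma measurable_axis_max n : measurable_fun setT (axis_max n).
Proof.
apply: measurable_bigmax => [|i]; by apply: measurable_funD; exact: measurable_coord_max.
Qed.

Definition axis_stat n w := (axis_max n w - 2 * a n) / b n.
Definition diameter_stat n w := (diameter n w - 2 * a n) / b n.

Lemma measurable_axis_stat n : measurable_fun setT (axis_stat n).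
Proof.
apply: measurable_funM; last exact: measurable_cst.
by apply: measurable_funB; [exact: measurable_axis_max|exact: measurable_cst].
Qed.

Lemma measurable_diameter_stat n : measurable_fun setT (diameter_stat n).
Proof.
apply: measurable_funM; last exact: measurable_cst.
by apply: measurable_funB; [exact: measurable_diameter|exact: measurable_cst].
Qed.

Lemma axis_stat_le : \forall n \near \oo, forall w, axis_stat n w <= diameter_stat n w.
Proof.
near=> n => w.
have n0 : (0 < n)%N by near: n; exact: nbhs_infty_gt.
have bn : 0 < b n by near: n.
by rewrite ler_pM2r ?invr_gt0// lerD2r axis_max_le_diameter.
Unshelve. all: by end_near. Qed.

(** With probability close to [1] all the points have [q]-norm at most [a + C b], and
    those with [q]-norm above [a - 2 C b] have Euclidean norm at most [a + K b]; a pair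
    that realizes a diameter above [2 a - C b] is made of two such points, and
    [pair_near_axis] applies to it. *)
Lemma diameter_stat_close B e eta : 0 < e -> 0 < eta -> \forall n \near \oo,
  pr P [set w | - B <= axis_stat n w /\ axis_stat n w + e < diameter_stat n w] <= eta.
Proof.
move=> e0 eta0.
(* [expR (- C)] bounds the limit of the probability that some point exceeds [a + C b]. *)
have [C [C0 BC EC]] : exists C : R, [/\ 0 < C, B <= C & expR (- C) < eta / 2].
  exists (Num.max 1 B + 2 / eta); have h : 0 < 2 / eta by rewrite divr_gt0.
  have m1 : 1 <= Num.max 1 B by rewrite le_max lexx.
  have mB : B <= Num.max 1 B by rewrite le_max lexx orbT.
  move: (Num.max 1 B) m1 mB => M m1 mB; split; [lra|lra|].
  rewrite expRN -[ltRHS]invrK ltf_pV2 ?posrE ?expR_gt0 ?invr_gt0 ?divr_gt0// invf_div.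
  by apply: lt_le_trans (expR_ge1Dx _); lra.
have C2 : 0 <= 2 * C by lra.
have eta2 : 0 < eta / 2 by rewrite divr_gt0.
have [K K0 HK] := nu_tight C2 eta2.
near=> n.
have n0 : (0 < n)%N by near: n; exact: nbhs_infty_gt.
have bn : 0 < b n by near: n.
have bC : b n <= (2 * C)^-1 * a n by near: n; apply: ba; rewrite invr_gt0; lra.
have Cb : 2 * C * b n <= a n by rewrite -ler_pdivlMl//; lra.
have tightK : n%:R * nu [set y | a n - 2 * C * b n < qnorm q y /\
    a n + K * b n < qnorm 2%:E y] <= eta / 2.
  by near: n.
have normC : n%:R * nu [set y | a n + b n * C < qnorm q y] <= eta / 2.
  by near: n; apply: (cvgr_le _ (@nu_norm C)).
have pairs : forall x y : d.-tuple R, qnorm q x <= a n + b n * C -> qnorm q y <= a n + b n * C ->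
    (a n - 2 * C * b n < qnorm q x -> qnorm 2%:E x <= a n + K * b n) ->
    (a n - 2 * C * b n < qnorm q y -> qnorm 2%:E y <= a n + K * b n) ->
  2 * a n - C * b n < qnorm q (tsub x y) ->
  qnorm q (tsub x y) <= qnorm +oo (tsub x y) + e * b n.
  by near: n; exact: pair_near_axis.
pose D1 := [set y : d.-tuple R | a n + b n * C < qnorm q y].
pose D2 := [set y : d.-tuple R |
  a n - 2 * C * b n < qnorm q y /\ a n + K * b n < qnorm 2%:E y].
have mD1 : measurable D1 by exact: measurable_qnorm_gt.
have mD2 : measurable D2 by apply: measurableI; exact: measurable_qnorm_gt.
have mXD i D : measurable D -> measurable [set w | D (X i w)].
  by move=> mD; rewrite -[X in measurable X]setTI; exact: mX.
have union D : measurable D ->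
    pr P [set w | exists2 i, i \in iota 0 n & D (X i w)] <= n%:R * nu D.
  move=> mD; apply: (le_trans (pr_existsin_le P _ (fun i => mXD i D mD))).
  under eq_bigr do rewrite lawX//.
  by rewrite big_const_seq count_predT size_iota iter_addr_0 mulr_natl.
have mU D : measurable D -> measurable [set w | exists2 i, i \in iota 0 n & D (X i w)].
  by move=> mD; apply: measurable_existsin => i; exact: mXD.
apply: (@le_trans _ _ (pr P ([set w | exists2 i, i \in iota 0 n & D1 (X i w)] `|`
    [set w | exists2 i, i \in iota 0 n & D2 (X i w)]))); last first.
  apply: (le_trans (prU_le P (mU _ mD1) (mU _ mD2))).
  have := union _ mD1; have := union _ mD2; rewrite /D1 /D2; lra.
apply: le_pr; [|exact: measurableU (mU _ mD1) (mU _ mD2)|].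
  apply: measurableI; first by apply: measurable_set_ler => //; exact: measurable_axis_stat.
  apply: measurable_set_ltr; last exact: measurable_diameter_stat.
  by apply: measurable_funD; [exact: measurable_axis_stat|exact: measurable_cst].
move=> w /= [LB LV].
have [in1|no1] := pselect (exists2 i, i \in iota 0 n & D1 (X i w)); first by left.
have [in2|no2] := pselect (exists2 i, i \in iota 0 n & D2 (X i w)); first by right.
exfalso; move: LB LV; rewrite /axis_stat /diameter_stat ler_pdivlMr// => LB.
rewrite ltr_pdivlMr// mulrDl divfK ?gt_eqF// => LV.
have CB : B * b n <= C * b n by rewrite ler_pM2r.
have M_gt : 2 * a n - C * b n < diameter n w.
  have eb : 0 < e * b n by rewrite mulr_gt0.
  by move: (diameter n w) (axis_max n w) LB LV => M A LB LV; lra.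
have [M0|[i [j [il jl Mij]]]] := diameterP n w.
  by have Cb0 : 0 < C * b n by [rewrite mulr_gt0]; rewrite M0 in M_gt; clear LB LV; lra.
have out1 i' : (i' < n)%N -> qnorm q (X i' w) <= a n + b n * C.
  move=> i'l; rewrite leNgt; apply/negP => h; apply: no1; exists i' => //.
  by rewrite mem_iota.
have out2 i' : (i' < n)%N -> a n - 2 * C * b n < qnorm q (X i' w) ->
    qnorm 2%:E (X i' w) <= a n + K * b n.
  move=> i'l h; rewrite leNgt; apply/negP => h'; apply: no2; exists i' => //.
  by rewrite mem_iota.
have Moo : diameter n w <= qnorm +oo (tsub (X i w) (X j w)) + e * b n.
  rewrite Mij; apply: pairs; [exact: out1|exact: out1|exact: out2|exact: out2|].
  by rewrite -Mij.
have : qnorm +oo (tsub (X i w) (X j w)) <= axis_max n w.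
  have [k ->] := qnormyE i0 (tsub (X i w) (X j w)).
  rewrite tnth_mktuple; apply: le_trans (axis_le n w k).
  have le_max s i' : (i' < n)%N -> sgn s * tnth (X i' w) k <= coord_max (k, s) n w.
    by move=> i'l; have [/(_ (lexx _)) + _] := coord_max_le (k, s) w (coord_max (k, s) n w) n0; apply.
  have h1 := le_max true _ il; have h2 := le_max false _ il.
  have h3 := le_max true _ jl; have h4 := le_max false _ jl.
  move: h1 h2 h3 h4; rewrite /sgn !mul1r !mulN1r; clear LB LV M_gt Moo.
  move: (coord_max _ _ _) (coord_max _ _ _) (tnth _ _) (tnth _ _) => u v u' v' h1 h2 h3 h4.
  by rewrite ler_norml; apply/andP; split; lra.
by move: (qnorm _ _) (diameter n w) (axis_max n w) LV Moo => r M A LV Moo; lra.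
Unshelve. all: by end_near. Qed.

End sample_maxima.

(** * Weak convergence from the convergence of joint distribution functions *)
Section bounded_means.
Context {dO : measure_display} {O : measurableType dO} {R : realType}.
Variable P : probability O R.
Implicit Types (g h : O -> R).

Definition bounded_measurable h :=
  measurable_fun setT h /\ exists M, forall w, `|h w| <= M.

Definition mean h : R := fine ('E_P[h])%E.

Lemma bounded_measurable_integrable h : bounded_measurable h ->
  P.-integrable setT (EFin \o h).
Proof.
move=> [mh [M hM]]; apply: measurable_bounded_integrable => //.
  by rewrite (le_lt_trans (probability_le1 _ _))// ltry.
exists M; split; first exact: num_real.
by move=> x Mx w _ /=; rewrite (le_trans (hM w))// ltW.
Qed.

Lemma bounded_measurable_Lfun h : bounded_measurable h -> h \in Lfun P 1.
Proof. by move=> /bounded_measurable_integrable/Lfun1_integrable. Qed.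

Lemma meanE h : bounded_measurable h -> ('E_P[h] = (mean h)%:E)%E.
Proof. by move=> bh; rewrite fineK// expectation_fin_num// bounded_measurable_Lfun. Qed.

Lemma bounded_measurableD g h : bounded_measurable g -> bounded_measurable h ->
  bounded_measurable (g \+ h).
Proof.
move=> [mg [M gM]] [mh [K hK]]; split; first exact: measurable_funD.
by exists (M + K) => w; rewrite (le_trans (ler_normD _ _))// lerD.
Qed.

Lemma bounded_measurable_indic (c : R) (A : set O) : measurable A ->
  bounded_measurable (fun w => c * \1_A w).
Proof.
move=> mA; split.
  by apply: measurable_funM; [exact: measurable_cst|exact: measurable_indic].
exists `|c| => w; rewrite normrM ler_piMr// indicE; case: (_ \in _) => /=.
  by rewrite normr1.
by rewrite normr0.
Qed.

Lemma meanD g h : bounded_measurable g -> bounded_measurable h ->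
  mean (g \+ h) = mean g + mean h.
Proof.
move=> bg bh; rewrite /mean expectationD ?bounded_measurable_Lfun//.
by rewrite fineD// expectation_fin_num// bounded_measurable_Lfun.
Qed.

Lemma mean_indic (c : R) (A : set O) : measurable A ->
  mean (fun w => c * \1_A w) = c * pr P A.
Proof.
move=> mA; have b1 : bounded_measurable (\1_A : O -> R).
  by have := bounded_measurable_indic 1 mA; under eq_fun do rewrite mul1r.
have -> : (fun w => c * \1_A w) = c \o* (\1_A : O -> R).
  by apply: funext => w /=; rewrite mulrC.
rewrite /mean expectationZl ?bounded_measurable_Lfun// expectation_indic//.
by rewrite prE.
Qed.

Lemma le_mean g h : bounded_measurable g -> bounded_measurable h ->
  (forall w, g w <= h w) -> mean g <= mean h.
Proof.
move=> bg bh gh; rewrite -lee_fin -!meanE// unlock.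
apply: le_integral => //; [exact: bounded_measurable_integrable..|].
by move=> w _; rewrite lee_fin.
Qed.

Lemma mean_simple (J : Type) (s : seq J) (c : J -> R) (A : J -> set O) :
  (forall j, measurable (A j)) ->
  bounded_measurable (fun w => \sum_(j <- s) c j * \1_(A j) w) /\
  mean (fun w => \sum_(j <- s) c j * \1_(A j) w) = \sum_(j <- s) c j * pr P (A j).
Proof.
move=> mA; elim: s => [|j s [IH1 IH2]].
  rewrite big_nil; under eq_fun do rewrite big_nil.
  have := bounded_measurable_indic 0 (@measurable0 _ O).
  have := mean_indic 0 (@measurable0 _ O); rewrite mul0r.
  by under eq_fun do rewrite mul0r; move=> -> H; split => //;
     move: H; under eq_fun do rewrite mul0r.
have -> : (fun w => \sum_(j <- j :: s) c j * \1_(A j) w) =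
    (fun w => c j * \1_(A j) w) \+ (fun w => \sum_(j <- s) c j * \1_(A j) w).
  by apply: funext => w; rewrite big_cons.
have bj := bounded_measurable_indic (c j) (mA j).
split; first exact: bounded_measurableD.
by rewrite big_cons meanD// IH2 mean_indic.
Qed.

(** The simple function with value [c j] on [A j] differs from [h] by at most [e] off
    [D] and by at most [2 * M] on [D]. *)
Lemma mean_near_simple (J : eqType) (s : seq J) (c : J -> R) (A : J -> set O)
    (D : set O) h e M :
  bounded_measurable h -> (forall j, measurable (A j)) -> measurable D -> uniq s ->
  0 <= e -> (forall w, `|h w| <= M) -> (forall j, `|c j| <= M) ->
  (forall i j w, A i w -> A j w -> i = j) ->
  (forall w, ~ D w -> exists2 j, j \in s & A j w /\ `|h w - c j| <= e) ->
  `|mean h - \sum_(j <- s) c j * pr P (A j)| <= e + 2 * M * pr P D.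
Proof.
move=> bh mA mD us e0 hM cM trivA near_c.
have [bS meanS] := mean_simple s c mA.
have bE := bounded_measurableD (bounded_measurable_indic e measurableT)
  (bounded_measurable_indic (2 * M) mD).
have bE' := bounded_measurableD (bounded_measurable_indic (- e) measurableT)
  (bounded_measurable_indic (- (2 * M)) mD).
have S_val w : (exists2 j, j \in s & A j w /\ \sum_(j <- s) c j * \1_(A j) w = c j) \/
    \sum_(j <- s) c j * \1_(A j) w = 0.
  have [[j js Aj]|no] := pselect (exists2 j, j \in s & A j w).
    left; exists j => //; split => //; rewrite (bigD1_seq j)//= big1 ?addr0.
      by rewrite indicE mem_set// mulr1.
    move=> i ij; rewrite indicE memNset ?mulr0// => Ai.
    by move: ij; rewrite (trivA _ _ _ Ai Aj) eqxx.
  right; rewrite big_seq big1// => j js; rewrite indicE memNset ?mulr0// => Aj.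
  by apply: no; exists j.
have close w : `|h w - \sum_(j <- s) c j * \1_(A j) w| <= e + 2 * M * \1_D w.
  have [Dw|nDw] := pselect (D w).
    rewrite indicE mem_set// mulr1 (le_trans (ler_normB _ _))//.
    have Sle : `|\sum_(j <- s) c j * \1_(A j) w| <= M.
      have [[j _ [_ ->]]|->] := S_val w; first exact: cM.
      by rewrite normr0 (le_trans _ (hM w)).
    by have := hM w; lra.
  rewrite indicE memNset// mulr0 addr0.
  have [j js [Aj hj]] := near_c w nDw.
  have [[i _ [Ai ->]]|] := S_val w; first by rewrite (trivA _ _ _ Ai Aj).
  rewrite (bigD1_seq j)//= indicE mem_set// mulr1 big1 ?addr0; last first.
    move=> i ij; rewrite indicE memNset ?mulr0// => Ai.
    by move: ij; rewrite (trivA _ _ _ Ai Aj) eqxx.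
  by [].
have oneT (w : O) : \1_(setT : set O) w = 1 :> R by rewrite indicE in_setT.
have up : mean h <= mean ((fun w => \sum_(j <- s) c j * \1_(A j) w) \+
    ((fun w => e * \1_setT w) \+ (fun w => 2 * M * \1_D w))).
  apply: le_mean => //; first exact: bounded_measurableD.
  move=> w /=; have := close w; rewrite ler_norml oneT mulr1; lra.
have low : mean ((fun w => \sum_(j <- s) c j * \1_(A j) w) \+
    ((fun w => - e * \1_setT w) \+ (fun w => - (2 * M) * \1_D w))) <= mean h.
  apply: le_mean => //; first exact: bounded_measurableD.
  move=> w /=; have := close w; rewrite ler_norml oneT mulr1; lra.
have mS c1 c2 : mean ((fun w => \sum_(j <- s) c j * \1_(A j) w) \+
    ((fun w => c1 * \1_setT w) \+ (fun w => c2 * \1_D w))) =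
    \sum_(j <- s) c j * pr P (A j) + (c1 + c2 * pr P D).
  have b1 := bounded_measurable_indic c1 (@measurableT _ O).
  have b2 := bounded_measurable_indic c2 mD.
  rewrite (meanD bS (bounded_measurableD b1 b2)) meanS (meanD b1 b2).
  by rewrite !mean_indic// prT mulr1.
rewrite mS in up; rewrite mS in low.
by rewrite ler_norml; apply/andP; split; lra.
Qed.

End bounded_means.

Section boxes.
Context {dO : measure_display} {O : measurableType dO} {R : realType}.
Context {P : probability O R} {I : eqType}.

Lemma measurable_forallin (s : seq I) (A : I -> set O) :
  (forall k, measurable (A k)) -> measurable [set w | forall k, k \in s -> A k w].
Proof.
move=> mA; elim: s => [|j s IH].
  rewrite (_ : [set _ | _] = setT); first exact: measurableT.
  by apply/seteqP; split.
rewrite (_ : [set _ | _] = A j `&` [set w | forall k, k \in s -> A k w]).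
  exact: measurableI.
apply/seteqP; split => w /= => [h|[hj h] k].
  by split=> [|k ks]; apply: h; rewrite inE ?eqxx// ks orbT.
by rewrite inE => /predU1P[->|/h].
Qed.

Lemma measurable_above (Y : I -> O -> R) (lo : I -> R) (s : seq I) :
  (forall k, measurable_fun setT (Y k)) ->
  measurable [set w | forall k, k \in s -> lo k < Y k w].
Proof.
by move=> mY; apply: measurable_forallin => k; exact: measurable_set_ltr.
Qed.

(** One lower bound at a time, the probability of a box is a difference of two
    probabilities with one lower bound less; the second box is obtained by lowering
    one upper bound. *)
Lemma pr_box_cons (Y : I -> O -> R) (t lo : I -> R) (i : I) (s : seq I) :
  (forall k, measurable_fun setT (Y k)) ->
  (forall t : I -> R, measurable [set w | forall k, Y k w <= t k]) ->
  pr P [set w | (forall k, Y k w <= t k) /\ forall k, k \in i :: s -> lo k < Y k w] =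
  pr P [set w | (forall k, Y k w <= t k) /\ forall k, k \in s -> lo k < Y k w] -
  pr P [set w | (forall k, Y k w <= (if k == i then Num.min (t k) (lo k) else t k)) /\
     forall k, k \in s -> lo k < Y k w].
Proof.
move=> mY mB.
set L := [set w | _ /\ forall k, k \in i :: s -> _].
set A := [set w | (forall k, Y k w <= t k) /\ forall k, k \in s -> lo k < Y k w].
have mA : measurable A := measurableI _ _ (mB t) (measurable_above lo s mY).
have mi : measurable [set w | Y i w <= lo i] by exact: measurable_set_ler.
rewrite (prID P mA mi) [pr P (A `&` _) + _]addrC.
rewrite (_ : A `&` [set w | Y i w <= lo i] = [set w |
   (forall k, Y k w <= (if k == i then Num.min (t k) (lo k) else t k)) /\
     forall k, k \in s -> lo k < Y k w]); last first.
  apply/seteqP; split => w /=.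
    move=> [[h1 h2] h3]; split => // k; case: eqP => [->|//]; by rewrite le_min h1.
  move=> [h1 h2]; split; first split => // k.
    by have := h1 k; case: eqP => // _; rewrite le_min => /andP[].
  by have := h1 i; rewrite eqxx le_min => /andP[].
rewrite addrK; congr (pr P _); apply/seteqP; split => w /=.
  move=> [h1 h2]; split; first by split => // k ks; apply: h2; rewrite inE ks orbT.
  by move=> h; have := h2 i; rewrite inE eqxx => /(_ isT); rewrite ltNge h.
move=> [[h1 h2] h3]; split => // k; rewrite inE => /predU1P[->|]; last exact: h2.
by rewrite ltNge; apply/negP.
Qed.

End boxes.

Lemma uniform_continuity {R : realType} (f : R -> R) (B e : R) : continuous f -> 0 < e ->
  exists2 r, 0 < r & forall x y, `|x| <= B -> `|x - y| <= r -> `|f x - f y| <= e.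
Proof.
move=> cf e0.
have : compact `[- B, B]%classic by exact: segment_compact.
move/compact_near_coveringP => /(_ _ (0 : R)^'+
  (fun r x => forall y, `|x - y| <= r -> `|f x - f y| <= e) _) [|].
  move=> x _; have /cvgrPdist_lt/(_ (e / 2)) := cf x; rewrite divr_gt0// => /(_ isT).
  move=> /nbhs_ballP[r /= r0 Hr].
  exists (ball x (r / 2), [set d | d < r / 2]) => /=.
    split; first by apply: nbhsx_ballx; rewrite divr_gt0.
    by apply: nbhs_right_lt; rewrite divr_gt0.
  move=> [x' d'] [/= xx' dr] y yd.
  have rr : ball x r x'.
    by move: xx'; rewrite /ball/= => h; apply: (lt_trans h); lra.
  have yr : ball x r y.
    rewrite /ball/= -(subrK x' x) -addrA (le_lt_trans (ler_normD _ _))//.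
    by move: xx'; rewrite /ball/= => h; lra.
  have := Hr _ rr; have := Hr _ yr => /= h1 h2.
  rewrite -(subrK (f x) (f x')) -addrA (le_trans (ler_normD _ _))// [`|f x' - _|]distrC.
  by move: h1 h2; move: (`|_|) (`|_|) => u v; lra.
move=> r /= r0 Hr; have [u [u0 ur]] : exists u, 0 < u /\ u < r by exists (r / 2); split; lra.
exists u => // x y xB xy; apply: (Hr u) => //=; rewrite /ball/= ?sub0r ?normrN ?gtr0_norm//.
by rewrite in_itv/= -ler_norml.
Qed.

Lemma grid_cell {R : realType} (h lo y : R) m : lo < y -> y <= lo + h * m%:R ->
  exists i : 'I_m, lo + h * i%:R < y <= lo + h * i.+1%:R.
Proof.
move=> ly; elim: m => [|m IH]; first by rewrite mulr0 addr0 leNgt ly.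
move=> ym; have [/IH[i hi]|my] := leP y (lo + h * m%:R).
  by exists (widen_ord (leqnSn m) i).
by exists ord_max; rewrite my.
Qed.

Lemma three_eps {R : realType} (a a' s s' u u' e : R) :
  `|a - s| <= e / 6 + u -> `|a' - s'| <= e / 6 + u' -> `|s' - s| <= e / 6 ->
  u + u' <= e / 2 -> `|a' - a| <= e.
Proof. by rewrite !ler_norml => /andP[? ?] /andP[? ?] /andP[? ?] ?; apply/andP; split; lra. Qed.

(** [Y n] has a joint limit [Z], [S n] is a Lipschitz function [L] of [Y n], and
    [V n] is an upper approximation of [S n], close to it in probability where [S n]
    is not very negative; then [V n] converges weakly to [L Z]. *)
Section weak_limit.
Context {R : realType} {I : finType}.
Variables (L : (I -> R) -> R) (f : R -> R) (M : R).
Hypothesis L0 : L (fun=> 0) = 0.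
Hypothesis L_lip : forall y z r, (forall k, `|y k - z k| <= r) -> `|L y - L z| <= 2 * r.
Hypothesis fM : forall x, `|f x| <= M.
Hypothesis cf : continuous f.

Lemma L_le y B : (forall k, `|y k| <= B) -> `|L y| <= 2 * B.
Proof. by move=> h; rewrite -[L y]subr0 -L0; apply: L_lip => k; rewrite subr0. Qed.

Definition box {O : Type} (Y : I -> O -> R) (t lo : I -> R) : set O :=
  [set w | (forall k, Y k w <= t k) /\ forall k, k \in enum I -> lo k < Y k w].

Lemma measurable_corner {dO : measure_display} {O : measurableType dO} (Y : I -> O -> R) t :
  (forall k, measurable_fun setT (Y k)) -> measurable [set w | forall k, Y k w <= t k].
Proof.
move=> mY; rewrite (_ : [set _ | _] = [set w | forall k, k \in enum I -> Y k w <= t k]).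
  by apply: (@measurable_forallin _ _ _ _ (fun k => [set w | Y k w <= t k])) => k;
     exact: measurable_set_ler.
by apply/seteqP; split => w /= h k; [move=> _; exact: h|apply: h; rewrite mem_enum].
Qed.

Lemma measurable_box {dO : measure_display} {O : measurableType dO} (Y : I -> O -> R) t lo :
  (forall k, measurable_fun setT (Y k)) -> measurable (box Y t lo).
Proof.
by move=> mY; apply: measurableI; [exact: measurable_corner|exact: measurable_above].
Qed.

(** Half-open cells of side [h], indexed by their lower corners [- B + h * kappa]. *)
Definition lower_corner (h B : R) m (kappa : {ffun I -> 'I_m}) : I -> R :=
  fun k => - B + h * (kappa k)%:R.
Definition upper_corner (h B : R) m (kappa : {ffun I -> 'I_m}) : I -> R :=
  fun k => - B + h * (kappa k).+1%:R.

(** On a cell of the grid of mesh [h] the value [L Y] is known up to [2 h], and [V]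
    up to [4 h], so that the mean of [f V] is nearly a combination of probabilities
    of cells whose coefficients depend on the grid only. *)
Lemma mean_near_grid {dO : measure_display} {O : measurableType dO}
    (P : probability O R) (Y : I -> O -> R) (V : O -> R) (D : set O) (h B e : R) m :
  (forall k, measurable_fun setT (Y k)) -> measurable_fun setT V -> measurable D ->
  0 < h -> 0 <= e -> h * m%:R = 2 * B ->
  (forall x y, `|x| <= 2 * B -> `|x - y| <= 4 * h -> `|f x - f y| <= e) ->
  (forall w, ~ D w -> box Y (fun=> B) (fun=> - B) w /\
    L (Y ^~ w) <= V w <= L (Y ^~ w) + 2 * h) ->
  `|mean P (f \o V) - \sum_(kappa <- enum {: {ffun I -> 'I_m}})
     f (L (lower_corner h B kappa)) *
       pr P (box Y (upper_corner h B kappa) (lower_corner h B kappa))|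
   <= e + 2 * M * pr P D.
Proof.
move=> mY mV mD h0 e0 hm uc good.
apply: mean_near_simple => //.
- split; last by exists M => w; exact: fM.
  by apply: measurableT_comp => //; exact: continuous_measurable_fun.
- by move=> kappa; exact: measurable_box.
- exact: enum_uniq.
- by move=> w; exact: fM.
- move=> kap lam w [u1 l1] [u2 l2]; apply/ffunP => k; apply/val_inj => /=.
  have ord (i j : nat) : - B + h * j%:R < Y k w -> Y k w <= - B + h * i.+1%:R -> (j <= i)%N.
    move=> a b; have : h * j%:R < h * i.+1%:R by lra.
    by rewrite ltr_pM2l// ltr_nat ltnS.
  by apply/eqP; rewrite eqn_leq; apply/andP; split; apply: ord;
    [apply: l1|apply: u2|apply: l2|apply: u1]; rewrite ?mem_enum.
move=> w /good[[uB lB] /andP[LV VL]].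
have cell k : exists i : 'I_m, - B + h * i%:R < Y k w <= - B + h * i.+1%:R.
  apply: grid_cell; first by apply: lB; rewrite mem_enum.
  by rewrite hm; have := uB k; lra.
have [kappa Hk] := choice cell.
exists [ffun k => kappa k]; rewrite ?mem_enum//; split.
  split=> k; rewrite /lower_corner /upper_corner ffunE; first by have /andP[] := Hk k.
  by move=> _; have /andP[] := Hk k.
rewrite distrC; apply: uc.
  apply: L_le => k; rewrite /lower_corner ffunE ler_norml.
  have h1 : 0 <= h * (kappa k)%:R by rewrite mulr_ge0// ltW.
  have h2 : h * (kappa k)%:R <= h * m%:R.
    by rewrite ler_pM2l// ler_nat ltnW.
  by rewrite hm in h2; apply/andP; split; lra.
have : `|L (lower_corner h B [ffun k => kappa k]) - L (Y ^~ w)| <= 2 * h.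
  apply: L_lip => k; rewrite /lower_corner ffunE ler_norml.
  have /andP[] := Hk k; rewrite -natr1 mulrDr mulr1.
  by move: (Y k w) (h * _) => y z h1 h2; apply/andP; split; lra.
rewrite !ler_norml => /andP[h1 h2]; apply/andP.
by move: (V w) (L _) (L _) LV VL h1 h2 => v l1 l2 *; split; lra.
Qed.

Context {dO dO' : measure_display} {O : measurableType dO} {O' : measurableType dO'}.
Variables (P : probability O R) (P' : probability O' R).
Variables (Y : nat -> I -> O -> R) (Z : I -> O' -> R) (S V : nat -> O -> R).
Hypothesis mY : forall n k, measurable_fun setT (Y n k).
Hypothesis mZ : forall k, measurable_fun setT (Z k).
Hypothesis mS : forall n, measurable_fun setT (S n).
Hypothesis mV : forall n, measurable_fun setT (V n).
Hypothesis mLZ : measurable_fun setT (fun w => L (Z ^~ w)).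
Hypothesis cvg_corner : forall t : I -> R,
  pr P [set w | forall k, Y n k w <= t k] @[n --> \oo] --> pr P' [set w | forall k, Z k w <= t k].
Hypothesis tightZ : forall e, 0 < e -> exists2 B, 0 < B &
  1 - e <= pr P' (box Z (fun=> B) (fun=> - B)).
Hypothesis SE : \forall n \near \oo, forall w, S n w = L (Y n ^~ w).
Hypothesis SV : \forall n \near \oo, forall w, S n w <= V n w.
Hypothesis close : forall B e eta, 0 < e -> 0 < eta -> \forall n \near \oo,
  pr P [set w | - B <= S n w /\ S n w + e < V n w] <= eta.

Lemma cvg_box t lo :
  pr P (box (Y n) t lo) @[n --> \oo] --> pr P' (box Z t lo).
Proof.
rewrite /box; elim: (enum I) t => [|i s IH] t.
  have F (A : Type) (U : I -> A -> R) : [set w | (forall k, U k w <= t k) /\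
      forall k, k \in [::] -> lo k < U k w] = [set w | forall k, U k w <= t k].
    by apply/seteqP; split => w //= [].
  by rewrite F; under eq_fun do rewrite F; exact: cvg_corner.
rewrite pr_box_cons//; last by move=> ?; exact: measurable_corner.
have mC n t' := measurable_corner t' (@mY n).
under eq_fun do rewrite (pr_box_cons _ _ _ _ (@mY _) (@mC _)).
by apply: cvgB; exact: IH.
Qed.

(** The same grid serves for all [n] and for the limit: the coefficients agree, and
    the probabilities of the cells converge. *)
Lemma cvg_mean_lipschitz : mean P (f \o V n) @[n --> \oo] --> mean P' (f \o (fun w => L (Z ^~ w))).
Proof.
have M0 : 0 <= M by exact: le_trans (normr_ge0 _) (fM 0).
apply/cvgrPdist_le => e e0.
have [eta [eta0 Meta]] : exists eta, 0 < eta /\ 2 * M * (4 * eta) <= e / 2.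
  have h : 0 < 16 * (M + 1) by lra.
  exists (e / (16 * (M + 1))); split; first by rewrite divr_gt0.
  rewrite (_ : 2 * M * _ = (e / 2) * (M / (M + 1))); last by field; rewrite gt_eqF//; lra.
  by rewrite ler_piMr ?divr_ge0 ?(ltW e0)// ler_pdivrMr ?mul1r; lra.
have [B B0 tB] := tightZ eta0.
have e6 : 0 < e / 6 by rewrite divr_gt0.
have [r r0 Hr] := uniform_continuity (2 * B) cf e6.
have [h [m [h0 hm hr]]] : exists h : R, exists m, [/\ 0 < h, h * m%:R = 2 * B & 4 * h <= r].
  have c0 : 0 < 8 * B / r by rewrite divr_gt0//; lra.
  have := archi_boundP (ltW c0); set m := Num.bound _ => cm.
  have m0 : 0 < m%:R :> R by apply: lt_trans cm.
  exists (2 * B / m%:R), m; split; [by rewrite divr_gt0//; lra|by rewrite divfK// gt_eqF|].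
  rewrite mulrA ler_pdivrMr// [leRHS]mulrC -ler_pdivrMr//.
  by move: cm; rewrite (_ : 4 * (2 * B) = 8 * B); [exact: ltW|lra].
have uc x y : `|x| <= 2 * B -> `|x - y| <= 4 * h -> `|f x - f y| <= e / 6.
  by move=> xB xy; apply: Hr => //; exact: le_trans hr.
pose cells := enum {: {ffun I -> 'I_m}}.
have cvg_cells : \sum_(kappa <- cells) f (L (lower_corner h B kappa)) *
      pr P (box (Y n) (upper_corner h B kappa) (lower_corner h B kappa)) @[n --> \oo] -->
    \sum_(kappa <- cells) f (L (lower_corner h B kappa)) *
      pr P' (box Z (upper_corner h B kappa) (lower_corner h B kappa)).
  elim: cells => [|kappa s IH].
    by rewrite big_nil; under eq_fun do rewrite big_nil; exact: cvg_cst.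
  rewrite big_cons; under eq_fun do rewrite big_cons.
  by apply: cvgD => //; apply: cvgM; [exact: cvg_cst|exact: cvg_box].
have mbZ := measurable_box (fun=> B) (fun=> - B) mZ.
have approxZ := mean_near_grid P' mZ mLZ (measurableC mbZ) h0 (ltW e6) hm uc.
have {}approxZ := approxZ (fun w nw => conj (contrapT nw) _).
have h2 : 0 < 2 * h by lra.
move/cvgrPdist_le : cvg_cells => /(_ _ e6) cvg_cells.
near=> n.
have SEn : forall w, S n w = L (Y n ^~ w) by near: n.
have SVn : forall w, S n w <= V n w by near: n.
have far_eta : pr P [set w | - (2 * B) <= S n w /\ S n w + 2 * h < V n w] <= eta.
  by near: n; exact: close.
pose far := [set w | - (2 * B) <= S n w /\ S n w + 2 * h < V n w].

have mfar : measurable far.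
  apply: measurableI; first by apply: measurable_set_ler => //; exact: mS.
  apply: measurable_set_ltr; last exact: mV.
  by apply: measurable_funD; [exact: mS|exact: measurable_cst].
have mb := measurable_box (fun=> B) (fun=> - B) (@mY n).
have box_eta : 1 - eta - eta <= pr P (box (Y n) (fun=> B) (fun=> - B)).
  near: n; apply: (cvgr_ge _ (@cvg_box (fun=> B) (fun=> - B))).
  by apply: lt_le_trans tB; lra.
have mD : measurable (~` box (Y n) (fun=> B) (fun=> - B) `|` far).
  by apply: measurableU => //; exact: measurableC.
have approx := mean_near_grid P (@mY n) (@mV n) mD h0 (ltW e6) hm uc.
apply: three_eps (approx _) (approxZ _) _ _.
- move=> w /= /not_orP[/contrapT inbox nfar]; split => //.
  rewrite -SEn SVn/= leNgt; apply/negP => Vfar; apply: nfar; split => //.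
  have : `|S n w| <= 2 * B.
    rewrite SEn; apply: L_le => k; case: inbox => /(_ k) h1 /(_ k).
    by rewrite mem_enum ler_norml h1 andbT => /(_ isT)/ltW.
  by rewrite ler_norml => /andP[].
- by move=> w; rewrite lexx/= lerDl ltW.
- by near: n; exact: cvg_cells.
have outP : pr P (~` box (Y n) (fun=> B) (fun=> - B) `|` far) <= 3 * eta.
  apply: le_trans (prU_le P (measurableC mb) mfar) _; rewrite prC//.
  by move: box_eta far_eta; rewrite -/far; lra.
have outZ : pr P' (~` box Z (fun=> B) (fun=> - B)) <= eta by rewrite prC// lerBlDr -lerBlDl.
apply: (le_trans _ Meta); rewrite -mulrDr ler_wpM2l ?mulr_ge0//.
by move: outP outZ; move: (pr _ _) (pr _ _) => u u'; lra.
Unshelve. all: by end_near. Qed.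

End weak_limit.

(** * The limit variable *)
Section finite_sup.
Context {R : realType} {d : nat} (i0 : 'I_d).
Implicit Types g : 'I_d -> R.

Lemma sup_rangeE g : sup (range g) = \big[Num.max/g i0]_(i < d) g i.
Proof.
apply/eqP; rewrite eq_le; apply/andP; split.
  apply: ge_sup; first by exists (g i0), i0.
  by move=> _ [i _ <-]; exact: le_bigmax.
have ubg : has_ubound (range g).
  by exists (\big[Num.max/g i0]_(i < d) g i) => _ [i _ <-]; exact: le_bigmax.
by apply: bigmax_le => [|i _]; apply: ub_le_sup.
Qed.

Lemma le_sup_range g i : g i <= sup (range g).
Proof. by rewrite sup_rangeE; exact: le_bigmax. Qed.

Lemma sup_range_attained g : exists i, sup (range g) = g i.
Proof.
rewrite sup_rangeE; elim/big_ind: _ => [|x y [i ->] [j ->]|i _].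
- by exists i0.
- by rewrite /Num.max; case: ifP => _; [exists j|exists i].
- by exists i.
Qed.

Definition largest_sum (y : 'I_d * bool -> R) : R :=
  sup (range (fun i => y (i, true) + y (i, false))).

Lemma largest_sum0 : largest_sum (fun=> 0) = 0.
Proof.
by rewrite /largest_sum; have [i ->] := sup_range_attained (fun=> 0 + 0); rewrite addr0.
Qed.

Lemma largest_sum_lipschitz y z r :
  (forall k, `|y k - z k| <= r) -> `|largest_sum y - largest_sum z| <= 2 * r.
Proof.
move=> yz; have half u v : (forall k, `|u k - v k| <= r) -> largest_sum u <= largest_sum v + 2 * r.
  move=> uv; rewrite [leLHS]/largest_sum.
  have [i ->] := sup_range_attained (fun i => u (i, true) + u (i, false)).
  have := le_sup_range (fun i => v (i, true) + v (i, false)) i.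
  rewrite -/(largest_sum v) => vi.
  have := uv (i, true); have := uv (i, false); rewrite !ler_norml => /andP[_ h1] /andP[_ h2].
  by lra.
have h1 := half _ _ yz; have h2 : largest_sum z <= largest_sum y + 2 * r.
  by apply: half => k; rewrite distrC.
by rewrite ler_distl; apply/andP; split; lra.
Qed.

Lemma measurable_largest_sum {dO : measure_display} {O : measurableType dO}
    (Z : 'I_d * bool -> O -> R) : (forall k, measurable_fun setT (Z k)) ->
  measurable_fun setT (fun w => largest_sum (Z ^~ w)).
Proof.
move=> mZ; rewrite /largest_sum; under eq_fun do rewrite sup_rangeE.
by apply: measurable_bigmax => [|i]; exact: measurable_funD.
Qed.

Lemma axis_statE {dO : measure_display} {O : measurableType dO} {P : probability O R}
    (X : nat -> {RV P >-> d.-tuple R}) (a b : nat -> R) n w : 0 < b n ->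
  axis_stat X i0 a b n w = largest_sum (fun k => (coord_max X k n w - a n) / b n).
Proof.
move=> bn; rewrite /axis_stat /largest_sum sup_rangeE.
have E i : (coord_max X (i, true) n w - a n) / b n + (coord_max X (i, false) n w - a n) / b n =
    (coord_max X (i, true) n w + coord_max X (i, false) n w - 2 * a n) / b n.
  by rewrite -mulrDl; congr (_ / _); lra.
apply/eqP; rewrite eq_le; apply/andP; split.
  have [i ->] := axis_maxP X i0 n w; rewrite -E.
  exact: (le_bigmax _ (fun i => (coord_max X (i, true) n w - a n) / b n +
    (coord_max X (i, false) n w - a n) / b n)).
by apply: bigmax_le => [|i _]; rewrite E ler_pM2r ?invr_gt0// lerD2r axis_le.
Qed.

End finite_sup.

Section gumbel_limit.
Context {dO : measure_display} {O : measurableType dO} {R : realType} {P : probability O R}.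

Lemma fine_cdf (Z : {RV P >-> R}) x : fine (cdf Z x) = pr P [set w | Z w <= x].
Proof. by rewrite /cdf /distribution /pushforward /pr; congr (fine (P _)). Qed.

Lemma fine_ccdf (Z : {RV P >-> R}) x : fine (ccdf Z x) = pr P [set w | x < Z w].
Proof.
rewrite /ccdf /distribution /pushforward /pr; congr (fine (P _)).
by apply/seteqP; split => w /=; rewrite in_itv/= andbT.
Qed.

Lemma tight_family {I : finType} (Z : I -> {RV P >-> R}) e : 0 < e ->
  exists2 B, 0 < B & 1 - e <= pr P (box (fun k => Z k : O -> R) (fun=> B) (fun=> - B)).
Proof.
move=> e0; have s0 : 0 < (#|I|%:R + 1 : R) by rewrite ltr_wpDl.
have [e' [e'0 e'le]] : exists e', 0 < e' /\ #|I|%:R * (2 * e') <= e.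
  exists (e / (2 * (#|I|%:R + 1))); split; first by rewrite divr_gt0// mulr_gt0.
  rewrite (_ : _ * _ = e * (#|I|%:R / (#|I|%:R + 1))); last by field; rewrite gt_eqF.
  by rewrite ler_piMr ?(ltW e0)// ler_pdivrMr ?mul1r// lerDl.
have bad k : \forall B \near +oo,
    pr P [set w | Z k w <= - B] <= e' /\ pr P [set w | B < Z k w] <= e'.
  have low : \forall B \near +oo, pr P [set w | Z k w <= - B] <= e'.
    have /cvgNy_compNP/fine_cvgP[_ /= h] := cvg_cdfNy0 (Z k).
    move/cvgrPdist_le : h => /(_ _ e'0); apply: filterS => B.
    by rewrite sub0r normrN/= fine_cdf; exact: le_trans (ler_norm _).
  have up : \forall B \near +oo, pr P [set w | B < Z k w] <= e'.
    have /fine_cvgP[_ /= h] := cvg_ccdfy0 (Z k).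
    move/cvgrPdist_le : h => /(_ _ e'0); apply: filterS => B.
    by rewrite sub0r normrN/= fine_ccdf; exact: le_trans (ler_norm _).
  by near=> B; split; near: B.
have [B [B0 HB]] : exists B, 0 < B /\ forall k,
    pr P [set w | Z k w <= - B] <= e' /\ pr P [set w | B < Z k w] <= e'.
  near +oo_R => B; exists B; split; first by near: B; exact: nbhs_pinfty_gt.
  by near: B; apply: filter_forall.
exists B => //.
have mZ k : measurable_fun setT (Z k) by [].
pose A k := [set w | Z k w <= - B] `|` [set w | B < Z k w].
have m1 k : measurable [set w | Z k w <= - B] by exact: measurable_set_ler.
have m2 k : measurable [set w | B < Z k w] by exact: measurable_set_ltr.
have mA k : measurable (A k) by exact: measurableU.
have mbox := measurable_box (fun=> B) (fun=> - B) mZ.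
suff : pr P (~` box (fun k => Z k : O -> R) (fun=> B) (fun=> - B)) <= e.
  by rewrite prC// lerBlDr -lerBlDl.
apply: (@le_trans _ _ (pr P [set w | exists2 k, k \in enum I & A k w])).
  apply: le_pr; [exact: measurableC|exact: measurable_existsin|].
  move=> w /= nbox; apply: contrapT => noA; apply: nbox; split=> k.
    rewrite leNgt; apply/negP => h; apply: noA; exists k; rewrite ?mem_enum//; by right.
  move=> _; rewrite ltNge; apply/negP => h; apply: noA; exists k; rewrite ?mem_enum//; by left.
apply: (le_trans (pr_existsin_le P _ mA)); apply: le_trans e'le.
apply: (@le_trans _ _ (\sum_(k <- enum I) (2 * e'))).
  apply: ler_sum => k _; apply: le_trans (prU_le P (m1 k) (m2 k)) _.
  by have [h1 h2] := HB k; lra.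
by rewrite big_const_seq count_predT -cardE iter_addr_0 -[leLHS]mulr_natl.
Unshelve. all: by end_near. Qed.

Lemma pr_independent_corner {I : finType} (Z : I -> {RV P >-> R}) (F : R -> R) (t : I -> R) :
  mutually_independent Z -> (forall k x, cdf (Z k) x = (F x)%:E) ->
  pr P [set w | forall k, Z k w <= t k] = \prod_(k <- enum I) F (t k).
Proof.
move=> indep cdfZ.
have -> : [set w | forall k, Z k w <= t k] =
    [set w | forall k, k \in enum I -> `]-oo, t k]%classic (Z k w)].
  apply/seteqP; split => w /= h k; first by rewrite in_itv/=; move=> _; exact: h.
  by have := h k; rewrite mem_enum in_itv/= => /(_ isT).
rewrite /pr (indep (enum I) (fun k => `]-oo, t k]%classic)) ?enum_uniq//.
rewrite (eq_bigr (fun k => (F (t k))%:E)) ?prodEFin// => k _.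
exact: cdfZ.
Qed.

End gumbel_limit.

(** * The product at the normalizing sequence *)
Section normalized_product.
#[local] Arguments qnorm : simpl never.
Context {dO : measure_display} {O : measurableType dO} {R : realType}.
Context {P : probability O R} {d : nat} {q : \bar R}.
Variables (T : {RV P >-> R}) (W : {RV P >-> d.-tuple R}) (psi : R -> R).
Variable i0 : 'I_d.
Hypothesis q2 : (2%:E < q)%E.
Hypothesis T0 : {ae P, forall w, 0 < T w}.
Hypothesis gumbelT : gumbel_domain T psi.
Hypothesis unifW : uniform_on_sphere W.
Hypothesis indepTW : independent2 T W.

Let N x := nu T W [set y | x < qnorm q y].
Let G x := pr P [set w | x < T w * qnorm +oo (W w)].
Let a := tail_quantile N.
Let b n := psi (a n).

Let psi0 x : 0 < x -> 0 < psi x.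
Proof. by case: (radial_gumbel_tail gumbelT) => _ _ + _ _; apply. Qed.
Let psix e : 0 < e -> \forall x \near +oo, psi x <= e * x.
Proof. by case: (radial_gumbel_tail gumbelT) => _ _ _ + _; apply. Qed.
Let G0 : \forall x \near +oo, 0 < G x := max_norm_tail_gt0 i0 q2 T0 gumbelT unifW indepTW.
Let Gshift z : G (x + psi x * z) / G x @[x --> +oo] --> expR (- z).
Proof. exact: (max_norm_tail_shift i0 q2 T0 gumbelT unifW indepTW). Qed.
Let NG : N x / G x @[x --> +oo] --> (1 : R).
Proof. exact: (qnorm_tail_equivalent i0 q2 T0 gumbelT unifW indepTW). Qed.

Lemma qnorm_tail_nonincreasing : {homo N : x y /~ x <= y}.
Proof.
move=> x y yx; apply: le_nu; [exact: measurable_qnorm_gt..|].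
by move=> u /=; exact: le_lt_trans.
Qed.

Lemma qnorm_tail_vanishes e : 0 < e -> exists x, N x <= e.
Proof.
move=> e0; have [th /andP[th0 _] gap] := qnorm_gap (d := d) q2.
have := gumbel_tail_rapid (radial_gumbel_tail gumbelT) (ltr1n R 2) e0.
move=> small; near +oo_R => x; exists (2 * x).
have : pr P [set w | 2 * x < T w] <= e * pr P [set w | x < T w] by near: x.
have : pr P [set w | x < T w] <= 1 by apply: pr_le1; exact: measurable_set_ltr.
rewrite -(ler_pM2l e0) mulr1 => h1 h2; apply: le_trans (le_trans h2 h1).
rewrite -(nu_qnorm2 T0 unifW); apply: le_nu; [exact: measurable_qnorm_gt..|].
move=> u /= h; apply: (lt_le_trans h); apply: (le_trans (gap u)).
by rewrite gerBl mulr_ge0 ?(ltW th0)// subr_ge0 qnormy_le_qnorm// lte_fin.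
Unshelve. all: by end_near. Qed.

(** The distribution function of the norm is [1 - N], so the level [1 - 1 / n] is
    reached where the tail [N] falls to [1 / n]. *)
Lemma quantile_qnorm n :
  quantile P (fun w => qnorm q (tscale (T w) (W w))) (1 - n%:R^-1) = a n.
Proof.
rewrite /quantile /a /tail_quantile; congr (inf _); apply/seteqP.
have E x : P [set w | qnorm q (tscale (T w) (W w)) <= x] = (1 - N x)%:E.
  have m := measurable_preX T W (measurable_qnorm_gt q x).
  rewrite -(prC P m) -prE; last exact: measurableC.
  by congr (P _); apply/seteqP; split => w /=; rewrite -/(product_vector T W w) leNgt => /negP.
by split => x /=; rewrite E lee_fin lerD2l lerN2.
Qed.

Let a_pinfty : a n @[n --> \oo] --> +oo.
Proof. exact: (cvg_tail_quantile qnorm_tail_nonincreasing qnorm_tail_vanishes G0 NG). Qed.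

Lemma near_tail_quantile (Q : R -> Prop) :
  (\forall x \near +oo, Q x) -> \forall n \near \oo, Q (a n).
Proof. by move=> HQ; exact: a_pinfty. Qed.

Lemma cvg_shifted_tail f l z : f x / G x @[x --> +oo] --> (l : R) ->
  n%:R * f (a n + b n * z) @[n --> \oo] --> l * expR (- z).
Proof.
exact: (cvg_tail_quantile_shift psi0 psix qnorm_tail_nonincreasing qnorm_tail_vanishes G0 Gshift NG).
Qed.

Lemma tail_quantile_gt0 : \forall n \near \oo, 0 < a n.
Proof. by have /near_tail_quantile : \forall x \near +oo, 0 < (x : R) by exact: nbhs_pinfty_gt. Qed.

Lemma scale_gt0 : \forall n \near \oo, 0 < b n.
Proof. by move: tail_quantile_gt0; apply: filterS => n; exact: psi0. Qed.

Lemma scale_small e : 0 < e -> \forall n \near \oo, b n <= e * a n.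
Proof. by move=> e0; exact: (near_tail_quantile (psix e0)). Qed.

Lemma scaled_max_norm_tail_le2 : \forall n \near \oo, n%:R * G (a n) <= 2.
Proof.
have : n%:R * G (a n + b n * 0) @[n --> \oo] --> (1 * expR (- 0) : R).
  apply: (cvg_shifted_tail (f := G)); apply/cvgrPdist_le => e e0.
  by move: G0; apply: filterS => x Gx; rewrite divff ?gt_eqF// subrr normr0 ltW.
rewrite oppr0 expR0 mulr1 => /cvgr_le/(_ 2); rewrite ltr1n => /(_ isT).
by apply: filterS => n; rewrite mulr0 addr0.
Qed.

Lemma cvg_nu_qnorm z :
  n%:R * nu T W [set y | a n + b n * z < qnorm q y] @[n --> \oo] --> expR (- z).
Proof. by rewrite -[expR _]mul1r; exact: (cvg_shifted_tail (f := N)). Qed.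

(** [nu_radial_tight] at [x = a n], where [n * G x] is bounded. *)
Lemma near_nu_radial B e : 0 <= B -> 0 < e -> exists2 K, 0 < K & \forall n \near \oo,
  n%:R * nu T W [set y | a n - B * b n < qnorm q y /\ a n + K * b n < qnorm 2%:E y] <= e.
Proof.
move=> B0 e0; have e2 : 0 < e / 2 by rewrite divr_gt0.
have [K K0 HK] := nu_radial_tight i0 q2 T0 gumbelT unifW indepTW B0 e2.
exists K => //; near=> n.
have h : nu T W [set y | a n - B * b n < qnorm q y /\ a n + K * b n < qnorm 2%:E y] <=
    e / 2 * G (a n) by near: n; exact: (near_tail_quantile HK).
have nG : n%:R * G (a n) <= 2 by near: n; exact: scaled_max_norm_tail_le2.
apply: (le_trans (ler_wpM2l (ler0n R n) h)); rewrite mulrCA.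
by apply: (le_trans (ler_wpM2l (ltW e2) nG)); rewrite divfK.
Unshelve. all: by end_near. Qed.

(** The events that distinct signed coordinates are large are asymptotically
    disjoint, so that the probability of their union is the sum of the
    probabilities.  All the thresholds exceed [9 / 10 * a n], and
    [5 / 4 * 9 / 10 = 9 / 8 > 1] makes the intersections negligible. *)
Lemma cvg_nu_some_coord (t : 'I_d * bool -> R) :
  n%:R * nu T W [set y | exists2 k, k \in enum {: 'I_d * bool} &
      a n + b n * t k < sgn k.2 * tnth y k.1] @[n --> \oo] -->
    \sum_(k <- enum {: 'I_d * bool}) (2 * d%:R)^-1 * expR (- t k).
Proof.
pose H x := nu T W [set y | x < tnth y i0].
pose U n := \sum_(k <- enum {: 'I_d * bool}) n%:R * H (a n + b n * t k).
have cvgU : U n @[n --> \oo] -->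
    \sum_(k <- enum {: 'I_d * bool}) (2 * d%:R)^-1 * expR (- t k).
  rewrite /U; elim: (enum _) => [|k s IH].
    by rewrite big_nil; under eq_fun do rewrite big_nil; exact: cvg_cst.
  rewrite big_cons; under eq_fun do rewrite big_cons.
  apply: cvgD => //; apply: (cvg_shifted_tail (f := H)); exact: (coord_tail_equivalent i0 q2 T0 gumbelT unifW indepTW).
have shift : \forall n \near \oo, forall k, 9 / 10 * a n <= a n + b n * t k.
  apply: filter_forall => k.
  have c0 : 0 < 10 * (`|t k| + 1) by rewrite mulr_gt0// ltr_wpDl.
  near=> n.
  have bn : 0 < b n by near: n; exact: scale_gt0.
  have : b n <= (10 * (`|t k| + 1))^-1 * a n by near: n; apply: scale_small; rewrite invr_gt0.
  rewrite mulrC ler_pdivlMr// => h.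
  have : - (b n * `|t k|) <= b n * t k.
    by rewrite -mulrN ler_pM2l// lerNl -normrN ler_norm.
  lra.
apply/cvgrPdist_le => e e0; have e2 : 0 < e / 2 by rewrite divr_gt0.
have d0 : 0 < (2 * d)%:R :> R by rewrite ltr0n muln_gt0 (leq_trans _ (ltn_ord i0)).
have e' : 0 < e / 4 / (2 * d)%:R by rewrite !divr_gt0.
have c1 : 1 < 9 / 8 :> R by lra.
have small := nu_qnorm2_small i0 q2 T0 gumbelT unifW indepTW c1 e'.
move/cvgrPdist_le : cvgU => /(_ _ e2) cvgU.
near=> n.
have an : 0 < a n by near: n; exact: tail_quantile_gt0.
have le_t : forall k, 9 / 10 * a n <= a n + b n * t k by near: n.
have nG : n%:R * G (a n) <= 2 by near: n; exact: scaled_max_norm_tail_le2.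
have far : nu T W [set y | 9 / 8 * a n < qnorm 2%:E y] <= e / 4 / (2 * d)%:R * G (a n).
  by near: n; exact: (near_tail_quantile small).
have Un : `|(\sum_(k <- enum {: 'I_d * bool}) (2 * d%:R)^-1 * expR (- t k)) - U n| <= e / 2.
  by near: n; exact: cvgU.
have s0 : 0 < 9 / 10 * a n by rewrite mulr_gt0.
have := nu_some_coord_le i0 unifW indepTW (fun k => a n + b n * t k).
have := nu_some_coord_ge i0 unifW indepTW s0 le_t.
rewrite /= (_ : 5 / 4 * (9 / 10 * a n) = 9 / 8 * a n); last by lra.
move=> /(ler_wpM2l (ler0n R n)) lo /(ler_wpM2l (ler0n R n)) hi.
rewrite mulr_sumr -/(U n) in hi; rewrite mulrDr mulr_sumr -/(U n) in lo.
have : n%:R * ((2 * d)%:R * nu T W [set y | 9 / 8 * a n < qnorm 2%:E y]) <= e / 2.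
  rewrite mulrCA; apply: (@le_trans _ _ ((2 * d)%:R * (e / 4 / (2 * d)%:R * (n%:R * G (a n))))).
    by rewrite ler_pM2l// mulrCA; apply: ler_wpM2l far.
  rewrite mulrA [_ * (e / 4 / _)]mulrC divfK ?gt_eqF//.
  by have := ler_wpM2l (ltW (divr_gt0 e0 (ltr0n R 4))) nG; lra.
move: lo hi Un; move: (n%:R * _) (n%:R * _) (U n) (\sum_(k <- _) _) => u v w s.
by rewrite !ler_norml => lo hi /andP[h1 h2] h3; apply/andP; split; lra.
Unshelve. all: by end_near. Qed.

End normalized_product.
Theorem theorem4p3 (R : realType) (d : nat) (q : \bar R)
    (d1 d2 d3 : measure_display) (O1 : measurableType d1)
    (O2 : measurableType d2) (O3 : measurableType d3)
    (P1 : probability O1 R) (P2 : probability O2 R) (P3 : probability O3 R)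
    (T : {RV P1 >-> R}) (W : {RV P1 >-> d.-tuple R}) (psi : R -> R)
    (X : nat -> {RV P2 >-> d.-tuple R})
    (G : 'I_d * bool -> {RV P3 >-> R}) :
  (2 <= d)%N ->
  (2%:E < q)%E ->
  {ae P1, forall w, 0 < T w} ->
  gumbel_domain T psi ->
  uniform_on_sphere W ->
  independent2 T W ->
  mutually_independent X ->
  (forall i (A : set (d.-tuple R)), measurable A ->
     P2 [set w | A (X i w)] = P1 [set w | A (tscale (T w) (W w))]) ->
  mutually_independent G ->
  (forall k x, cdf (G k) x = (expR (- ((2 * d%:R)^-1 * expR (- x))))%:E) ->
  let a (n : nat) :=
    quantile P1 (fun w => qnorm q (tscale (T w) (W w))) (1 - n%:R^-1) in
  let b (n : nat) := psi (a n) in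
  cvg_weakly P2 P3
    (fun n w => (max_interpoint q n (fun i => X i w) - 2 * a n) / b n)
    (fun w => sup (range (fun i : 'I_d => G (i, true) w + G (i, false) w))).
Proof.
move=> d_ge2 q2 T0 gumbelT unifW indepTW indepX lawX indepG cdfG a b f cf bf.
pose i0 : 'I_d := Ordinal (ltnW d_ge2).
have aE : a = tail_quantile (fun x => nu T W [set y | x < qnorm q y]).
  by apply: funext => n; exact: quantile_qnorm.
have [M fM] : exists M, forall x, `|f x| <= M.
  by case: bf => M [_ fM]; exists (M + 1) => x; apply: fM; rewrite // ltrDl.
have mX n k : measurable_fun setT (fun w => (coord_max X k n w - a n) / b n).
  apply: measurable_funM; last exact: measurable_cst.
  by apply: measurable_funB; [exact: measurable_coord_max|exact: measurable_cst].
have mG k : measurable_fun setT (G k) by [].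
have mLG := measurable_largest_sum i0 mG.
have nu0 A : 0 <= nu T W A by exact: pr_ge0.
have law i A : measurable A -> pr P2 [set w | A (X i w)] = nu T W A.
  by move=> mA; rewrite /pr lawX.
have b0 : \forall n \near \oo, 0 < b n.
  by rewrite /b aE; exact: (scale_gt0 i0 q2 T0 gumbelT unifW indepTW).
have ba e : 0 < e -> \forall n \near \oo, b n <= e * a n.
  by rewrite /b aE; exact: (scale_small i0 q2 T0 gumbelT unifW indepTW).
have corner (t : 'I_d * bool -> R) :
    pr P2 [set w | forall k, (coord_max X k n w - a n) / b n <= t k] @[n --> \oo] -->
    pr P3 [set w | forall k, G k w <= t k].
  rewrite (pr_independent_corner
    (F := fun x => expR (- ((2 * d%:R)^-1 * expR (- x)))) t indepG cdfG).
  apply: (cvg_joint_max nu0 law indepX b0) => u.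
  by rewrite /b aE; exact: (cvg_nu_some_coord i0 q2 T0 gumbelT unifW indepTW).
have close B e eta : 0 < e -> 0 < eta -> \forall n \near \oo,
    pr P2 [set w | - B <= axis_stat X i0 a b n w /\
      axis_stat X i0 a b n w + e < diameter_stat (q := q) X a b n w] <= eta.
  apply: (diameter_stat_close i0 q2 law b0 ba).
    by move=> z; rewrite /b aE; exact: (cvg_nu_qnorm i0 q2 T0 gumbelT unifW indepTW).
  by move=> C eps C0 eps0; rewrite /b aE; exact: (near_nu_radial i0 q2 T0 gumbelT unifW indepTW).
have SE : \forall n \near \oo, forall w,
    axis_stat X i0 a b n w = largest_sum (fun k => (coord_max X k n w - a n) / b n).
  by move: b0; apply: filterS => n bn w; exact: axis_statE.
have := cvg_mean_lipschitz (largest_sum0 i0) (largest_sum_lipschitz i0) fM cf mX mG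
  (measurable_axis_stat X i0 a b) (measurable_diameter_stat X a b) mLG corner
  (tight_family G) SE (axis_stat_le X i0 a q2 b0) close.
have bounded_comp dO (O : measurableType dO) (h : O -> R) :
    measurable_fun setT h -> bounded_measurable (f \o h).
  move=> mh; split; last by exists M => w; exact: fM.
  by apply: measurableT_comp => //; exact: continuous_measurable_fun.
move=> lim; rewrite (meanE P3 (bounded_comp _ _ _ mLG)).
apply: cvg_EFin.
  by apply: nearW => n; rewrite (meanE P2 (bounded_comp _ _ _ (measurable_diameter_stat X a b n))).
exact: lim.
Qed.
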